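(* Let $S=(S_i)_{i\ge 0}$ be the simple random walk on $\mathbb{Z}^5$ started at the origin, and let $(b_n)$ be a sequence of positive reals with $b_n\to\infty$ and $b_n/\sqrt{\log n}\to 0$ as $n\to\infty$. Then for every $\lambda>0$ and for each choice of the sign $\pm$, $$\lim_{n\to\infty}\frac1{b_n}\log\mathbb{P}\Big(\pm\big\{\mathrm{Cap}(S[0,n])-\mathbb{E}\,\mathrm{Cap}(S[0,n])\big\}\ge\lambda\sqrt{n\,b_n\log n}\Big)=-\frac{\lambda^2}{2\sigma^2},$$ where $\sigma^2>0$ is the constant such that $\mathrm{Var}(\mathrm{Cap}(S[0,n]))\sim\sigma^2 n\log n$ as $n\to\infty$.
   Context: $S[0,n]=\{S_0,S_1,\dots,S_n\}$ is the range of the walk. For a finite set $A\subset\mathbb{Z}^d$, $d\ge3$, $\tau_A=\min\{i>0: S_i\in A\}$ is the first positive hitting time of $A$ by simple random walk, $\mathbb{P}^x$ is the law of simple random walk started at $x$, and the capacity is $\mathrm{Cap}(A)=\sum_{x\in A}\mathbb{P}^x(\tau_A=\infty)$. It is known (Schapira) that in dimension $5$ the limit $\sigma^2=\lim_n \mathrm{Var}(\mathrm{Cap}(S[0,n]))/(n\log n)$ exists in $(0,\infty)$. *)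

(* Defs.v *)
From HB Require Import structures.
From mathcomp Require Import all_boot all_order all_algebra.
From mathcomp Require Import finmap.
From mathcomp Require Import all_classical all_reals all_analysis.
Set Implicit Arguments.
Unset Strict Implicit.
Unset Printing Implicit Defensive.

Import Order.TTheory GRing.Theory Num.Theory.
Import numFieldNormedType.Exports.

Local Open Scope classical_set_scope.
Local Open Scope ring_scope.

Definition increment (T : Type) (k : nat) (S : nat -> T -> 'rV[int]_k)
    (i : nat) (w : T) : 'rV[int]_k := S i.+1 w - S i w.

(* Measurability and independence are relative to the discrete sigma-algebra of
   Z^k.  The signed basis vectors (-1)^s e_j are 2k distinct points, so the
   third clause determines the law of each increment. *)
Record simple_random_walk (R : realType) (d : measure_display)
    (T : measurableType d) (P : probability T R) (k : nat) (x : 'rV[int]_k)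
    (S : nat -> T -> 'rV[int]_k) : Prop := SimpleRandomWalk {
  srw_measurable : forall (i : nat) (B : set 'rV[int]_k),
    measurable (S i @^-1` B) ;
  srw_start : P (S 0%N @^-1` [set x]) = 1%E ;
  srw_step : forall (i : nat) (j : 'I_k) (s : bool),
    P (increment S i @^-1` [set (-1) ^+ s *: delta_mx 0 j])
      = ((2 * k)%N%:R^-1)%:E ;
  srw_indep : forall (J : {fset nat}) (B : nat -> set 'rV[int]_k),
    P (\bigcap_(i in [set` J]) (increment S i @^-1` B i))
      = (\prod_(i <- J) P (increment S i @^-1` B i))%E }.

(* +oo when the trajectory never visits A at a positive time. *)
Definition hitting_time (R : realType) (k : nat) (A : {fset 'rV[int]_k})
    (s : nat -> 'rV[int]_k) : \bar R :=
  ereal_inf [set (i%:R)%:E | i in [set i : nat | (0 < i)%N /\ s i \in A]].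

(* When S is a simple random walk from the origin under P, the law P^x of the
   walk started at x is realised as the law of x + S; the value depends only on
   A, and is the usual capacity when k >= 3. *)
Definition capacity (R : realType) (d : measure_display) (T : measurableType d)
    (P : probability T R) (k : nat) (S : nat -> T -> 'rV[int]_k)
    (A : {fset 'rV[int]_k}) : R :=
  \sum_(x <- A)
    fine (P [set w | hitting_time R A (fun i => x + S i w) = +oo%E]).

Definition walk_range (T : Type) (k : nat) (S : nat -> T -> 'rV[int]_k)
    (n : nat) (w : T) : {fset 'rV[int]_k} :=
  [fset S i w | i in iota 0 n.+1]%fset.

Definition cap_range (R : realType) (d : measure_display)
    (T : measurableType d) (P : probability T R) (k : nat)
    (S : nat -> T -> 'rV[int]_k) (n : nat) (w : T) : R :=
  capacity P S (walk_range S n w).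

(* Main.v *)
Require Import Defs.
From HB Require Import structures.
From mathcomp Require Import all_boot all_order all_algebra.
From mathcomp Require Import finmap.
From mathcomp Require Import all_classical all_reals all_analysis.
From mathcomp Require Import measurable_realfun.
From mathcomp Require Import ring lra zify.
Import Order.TTheory GRing.Theory Num.Theory.
Import numFieldNormedType.Exports.
Local Open Scope classical_set_scope.
Local Open Scope ring_scope.
Set Implicit Arguments.
Unset Strict Implicit.
Unset Printing Implicit Defensive.

(* The capacity defect chi u v = C u + C v - C (u v) of two consecutive pieces of
   the walk is at most twice the sum of the Green function over their two ranges.
   The heat kernel bound n^(-5/2) bounds its moment of order 2 q by
   K^q (3 q)! n^q, so that halving a word of length n repeatedly writes the
   centred capacity as a sum of independent centred block capacities minus the
   centred defects of all levels, the i-th of which is a sum of 2^i independent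
   terms of size sqrt (n / 2^i).  With about (ln n)^8 blocks the defects above the
   blocks are negligible at the scale sqrt (n b ln n), because b = o(sqrt (ln n));
   the centred block capacities can be truncated, and their variances, which sum
   to sigma2 n ln n (1 + o(1)), determine the limiting quadratic cumulant
   generating function.  A Gartner-Ellis argument concludes. *)

(** * Averages over words and the heat kernel *)

(** The square of a defect, divided by [n], is only shown to have the moments [(3 q)!] of the cube
    of an exponential variable. This gives a stretched exponential tail of exponent 2/3, so no
    exponential moment is at hand and every exponential estimate is preceded by a truncation. The
    origin of [(3 q)!] is this: with geometric weights of rate [1 / Q], the [k]-th moment of a Green
    sum over two walks is at most [(k!)^2] times [Q^(k/2)], up to a constant to the power [k]. For
    [k = 2 q] and [Q] close to [n / q], removing the weights costs a constant to the power [q], and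
    [(2 q)!^2 / q^q <= 4^q (3 q)!].

    The full strength of the condition on [b] is spent at one point: the levels above the blocks
    exceed [eps sqrt (n b ln n)] with probability about [exp (- k r)], where [r^2 = b sqrt (ln n)],
    and [r] dominates every multiple of [b] exactly when [b = o(sqrt (ln n))].

    Estimates are made on averages over finite words in ten letters. Probability spaces enter only
    through the law of the path up to time [n] and the escape probabilities; the Green function is
    truncated accordingly. *)

Section WordAverage.
Variables (R : realFieldType) (A : finType).
Implicit Types (n m : nat) (f g : seq A -> R) (w u v : seq A).

(** The expectation over [n] independent uniform letters. A function of plain sequences, unlike one
    of tuples, can be averaged at every length, and independence of consecutive pieces is
    [avg_cat]. *)
Fixpoint avg n f : R :=
  if n is n'.+1 then (#|A|%:R)^-1 * \sum_(a : A) avg n' (fun w => f (a :: w))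
  else f [::].

Lemma avg_le n f g :
  (forall w, size w = n -> f w <= g w) -> avg n f <= avg n g.
Proof.
elim: n f g => [|n IH] f g fg /=; first exact: fg.
apply: ler_wpM2l; first by rewrite invr_ge0 ler0n.
by apply: ler_sum => a _; apply: IH => w sw; apply: fg; rewrite /= sw.
Qed.

Lemma avg_ext n f g :
  (forall w, size w = n -> f w = g w) -> avg n f = avg n g.
Proof.
by move=> fg; apply/eqP; rewrite eq_le !avg_le // => w /fg ->.
Qed.

Lemma avgD n f g : avg n (fun w => f w + g w) = avg n f + avg n g.
Proof.
elim: n f g => [//|n IH] f g /=.
by rewrite -mulrDr -big_split /=; congr (_ * _); apply: eq_bigr => a _; rewrite IH.
Qed.

Lemma avgZ n c f : avg n (fun w => c * f w) = c * avg n f.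
Proof.
elim: n f => [//|n IH] f /=.
rewrite mulrCA [in RHS]mulr_sumr; congr (_ * _).
by apply: eq_bigr => a _; rewrite IH.
Qed.

Lemma avgZr n c f : avg n (fun w => f w * c) = avg n f * c.
Proof.
by rewrite mulrC -avgZ; apply: avg_ext => w _; rewrite mulrC.
Qed.

Lemma avgN n f : avg n (fun w => - f w) = - avg n f.
Proof.
by rewrite -mulN1r -avgZ; apply: avg_ext => w _; rewrite mulN1r.
Qed.

Lemma avgB n f g : avg n (fun w => f w - g w) = avg n f - avg n g.
Proof. by rewrite avgD avgN. Qed.

Lemma avg0 n : avg n (fun=> 0) = 0.
Proof. by elim: n => [//|n IH] /=; rewrite big1 ?mulr0. Qed.

Lemma avg_ge0 n f : (forall w, size w = n -> 0 <= f w) -> 0 <= avg n f.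
Proof. by move=> f0; rewrite -(avg0 n); apply: avg_le. Qed.

Lemma avg_sum n (I : Type) (r : seq I) (P : pred I) (F : I -> seq A -> R) :
  avg n (fun w => \sum_(i <- r | P i) F i w) = \sum_(i <- r | P i) avg n (F i).
Proof.
elim: r => [|i r IH].
  by rewrite big_nil -[RHS](avg0 n); apply: avg_ext => w _; rewrite big_nil.
rewrite big_cons -IH; case: ifP => Pi.
  by rewrite -avgD; apply: avg_ext => w _; rewrite big_cons Pi.
by apply: avg_ext => w _; rewrite big_cons Pi.
Qed.

Lemma avg_cat m n f :
  avg (m + n) f = avg m (fun u => avg n (fun v => f (u ++ v))).
Proof.
elim: m f => [//|m IH] f /=; congr (_ * _).
by apply: eq_bigr => a _; rewrite IH.
Qed.

Lemma avg_rcons n f :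
  avg n.+1 f = avg n (fun u => (#|A|%:R)^-1 * \sum_(a : A) f (rcons u a)).
Proof.
rewrite -addn1 avg_cat; apply: avg_ext => u _ /=.
by congr (_ * _); apply: eq_bigr => a _; rewrite cats1.
Qed.

Lemma avg_rev n f : avg n (fun w => f (rev w)) = avg n f.
Proof.
elim: n f => [//|n IH] f; rewrite avg_rcons /=.
rewrite avgZ avg_sum; congr (_ * _); apply: eq_bigr => a _.
by rewrite -[RHS]IH; apply: avg_ext => w _; rewrite rev_rcons.
Qed.

Lemma avg_map n f (h : A -> A) :
  injective h -> avg n (fun w => f (map h w)) = avg n f.
Proof.
move=> hI; elim: n f => [//|n IH] f /=; congr (_ * _).
rewrite [RHS](reindex_inj hI) /=; apply: eq_bigr => a _.
by rewrite -[RHS](IH (fun w => f (h a :: w))).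
Qed.

Hypothesis A_gt0 : (0 < #|A|)%N.

Lemma avg_const n c : avg n (fun=> c) = c.
Proof.
elim: n => [//|n IH] /=; rewrite IH sumr_const -[c *+ _]mulr_natl mulrA.
by rewrite mulVf ?mul1r // pnatr_eq0 -lt0n.
Qed.

Lemma avg_le_const n f c : (forall w, size w = n -> f w <= c) -> avg n f <= c.
Proof. by move=> fc; rewrite -[leRHS](avg_const n); apply: avg_le. Qed.

Lemma avg_sqr_le n f : avg n f ^+ 2 <= avg n (fun w => f w ^+ 2).
Proof.
rewrite -subr_ge0.
suff <- : avg n (fun w => (f w - avg n f) ^+ 2)
  = avg n (fun w => f w ^+ 2) - avg n f ^+ 2.
  by apply: avg_ge0 => w _; exact: sqr_ge0.
set m := avg n f.
rewrite (@avg_ext _ _ (fun w => f w ^+ 2 + (- (2 * m) * f w + m ^+ 2))).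
  by rewrite !avgD avgZ avg_const -/m; ring.
by move=> w _; ring.
Qed.

End WordAverage.

Lemma avg_swap (R : realFieldType) (A B : finType) m n
    (f : seq A -> seq B -> R) :
  avg m (fun u => avg n (fun v => f u v)) = avg n (fun v => avg m (fun u => f u v)).
Proof.
elim: m f => [//|m IH] f /=; rewrite avgZ avg_sum; congr (_ * _).
by apply: eq_bigr => a _; rewrite IH.
Qed.

(** * The heat kernel of simple random walk on [Z^5] *)

Section SimpleWalk.
Variable R : realType.

Definition step : finType := ('I_5 * bool)%type.
Definition dir (s : step) : 'rV[int]_5 := (-1) ^+ s.2 *: delta_mx 0 s.1.
Definition pos (w : seq step) : 'rV[int]_5 := \sum_(s <- w) dir s.
Definition heat (n : nat) (x : 'rV[int]_5) : R :=
  avg n (fun w => (pos w == x)%:R).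

Lemma card_step : #|step| = 10%N.
Proof. by rewrite card_prod card_ord card_bool. Qed.

Lemma card_step_gt0 : (0 < #|step|)%N.
Proof. by rewrite card_step. Qed.

Lemma pos_nil : pos [::] = 0. Proof. by rewrite /pos big_nil. Qed.

Lemma pos_cons s w : pos (s :: w) = dir s + pos w.
Proof. by rewrite /pos big_cons. Qed.

Lemma pos_cat u v : pos (u ++ v) = pos u + pos v.
Proof. by rewrite /pos big_cat. Qed.

Lemma pos_rev w : pos (rev w) = pos w.
Proof. by rewrite /pos; apply: perm_big; rewrite perm_rev. Qed.

Lemma sum_step (F : step -> R) :
  \sum_(s : step) F s = \sum_(j < 5) (F (j, true) + F (j, false)).
Proof.
rewrite (eq_bigr (fun j => \sum_(b : bool) F (j, b))).
  by rewrite pair_bigA /=; apply: eq_bigr => -[].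
by move=> j _; rewrite big_bool.
Qed.

(** The transition kernel of simple random walk on the integers. *)
Fixpoint coin (N : nat) (y : int) : R :=
  if N is N'.+1 then (coin N' (y - 1) + coin N' (y + 1)) / 2 else (y == 0)%:R.

Lemma coin_odd N z : coin N (N%:Z - 2 * z - 1) = 0.
Proof.
elim: N z => [|N IH] z /=; first by case: eqP => //; lia.
rewrite (_ : _ - 1 - 1 = N%:Z - 2 * z - 1); last by lia.
rewrite (_ : _ - 1 + 1 = N%:Z - 2 * (z - 1) - 1); last by lia.
by rewrite !IH addr0 mul0r.
Qed.

(** [z] counts the steps down, so no path corresponds to a negative [z]. By parity, this and
    [coin_odd] cover all points. *)
Lemma coin_even N z : coin N (N%:Z - 2 * z)
  = (if z is Posz i then 'C(N, i)%:R else 0) / 2 ^+ N.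
Proof.
elim: N z => [|N IH] z /=.
  rewrite divr1; case: z => [[|i]|i]; rewrite ?bin0 ?bin0n //=;
    by case: eqP => //; lia.
rewrite (_ : _ - 1 = N%:Z - 2 * z); last by lia.
rewrite (_ : _ + 1 = N%:Z - 2 * (z - 1)); last by lia.
rewrite !IH -mulrDl exprSr invfM mulrA; congr (_ / _ / _).
case: z => [[|i]|i].
- by rewrite /= !bin0 addr0.
- by rewrite (_ : i.+1%:Z - 1 = i%:Z) ?binS ?natrD //; lia.
- rewrite (_ : Negz i - 1 = Negz i.+1); last by lia.
  by rewrite addr0.
Qed.

Lemma bin_le_mid N i : ('C(N, i) <= 'C(N, N./2))%N.
Proof.
have up a b : (a <= b)%N -> (b <= N./2)%N -> ('C(N, a) <= 'C(N, b))%N.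
  elim: b => [|b IH]; first by rewrite leqn0 => /eqP ->.
  rewrite leq_eqVlt => /predU1P [-> //|]; rewrite ltnS => ab bN.
  apply: (leq_trans (IH ab (ltnW bN))).
  rewrite -(@leq_pmul2l b.+1) // mul_bin_left leq_mul2r.
  by apply/orP; right; lia.
case: (leqP i N./2) => [iN|iN]; first exact: up.
case: (leqP i N) => [iN'|iN']; last by rewrite bin_small.
by rewrite -bin_sub //; apply: (@leq_trans 'C(N, N./2)) => //; apply: up; lia.
Qed.

(** By induction: the ratio of consecutive central coefficients reduces the step to
    [(2m+1)(2m+3) <= 4(m+1)^2]. *)
Lemma central_bin_le m : ('C(m.*2, m) ^ 2 * m.*2.+1 <= 16 ^ m)%N.
Proof.
elim: m => [//|m IH].
have E : ('C(m.+1.*2, m.+1) * m.+1 = 'C(m.*2, m) * (2 * m.*2.+1))%N.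
  have := mul_bin_diag m.*2.+1 m; have := mul_bin_down m.*2.+1 m.
  rewrite doubleS /= => H1 H2.
  have H3 : ('C(m.*2.+1, m) * m.+1 = 'C(m.*2, m) * m.*2.+1)%N by lia.
  rewrite binS mulnDl H3 [X in (X + _)%N]mulnC -H2; lia.
rewrite -(@leq_pmul2r (m.+1 ^ 2)) // mulnAC -expnMn E expnMn.
have H : ((2 * m.*2.+1) ^ 2 * m.+1.*2.+1 <= 16 * m.+1 ^ 2 * m.*2.+1)%N.
  by rewrite -!muln2 !expnS !expn0; nia.
rewrite (expnS 16 m); move: IH H; move: (_ ^ 2)%N (m.+1 ^ 2)%N (16 ^ m)%N ((2 * _) ^ 2)%N.
move=> X Z Y W IH H; apply: (@leq_trans (X * (16 * Z * m.*2.+1))%N).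
  by rewrite -mulnA leq_mul2l H orbT.
by rewrite mulnCA [leqRHS]mulnAC leq_mul2l IH orbT.
Qed.

Lemma mid_bin_le N : ('C(N, N./2) ^ 2 * N.+1 <= 4 ^ N)%N.
Proof.
rewrite -(odd_double_half N).
set m := N./2; case: (odd N); rewrite ?add0n ?add1n; last first.
  rewrite doubleK -addnn expnD -expnMn.
  by apply: leq_trans (central_bin_le m); rewrite addnn.
(* The odd case comes from the even one at [m.+1], because ['C(2m+2, m+1)] is twice
   ['C(2m+1, m)]. *)
have -> : m.*2.+1./2 = m by lia.
have E : ('C(m.+1.*2, m.+1) = 2 * 'C(m.*2.+1, m))%N.
  rewrite doubleS binS; suff -> : 'C(m.*2.+1, m.+1) = 'C(m.*2.+1, m) by lia.
  by rewrite -bin_sub; [congr 'C(_, _)|]; lia.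
have := central_bin_le m.+1; rewrite E.
rewrite expnMn (_ : 16 = 4 ^ 2)%N // -expnM mul2n doubleS expnS.
rewrite (expnS 4 m.*2.+1); nia.
Qed.

(** The square is bounded so that only reciprocals [1 / (N_j + 1)] of letter counts, and no roots,
    have to be averaged in [heat_le]. *)
Lemma coin_sqr_le N y : coin N y ^+ 2 <= (N.+1%:R)^-1.
Proof.
have [z [->|->]] : exists z : int, y = N%:Z - 2 * z \/ y = N%:Z - 2 * z - 1.
  exists ((N%:Z - y) %/ 2)%Z; lia.
  rewrite coin_even.
  case: z => i; last by rewrite mul0r expr0n /= invr_ge0 ler0n.
  rewrite expr_div_n ler_pdivrMr ?exprn_gt0 // mulrC ler_pdivlMr ?ltr0Sn //.
  rewrite -exprM mulnC exprM (_ : 2 ^+ 2 = 4%:R :> R); last by rewrite -natrX.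
  rewrite -!natrX -natrM ler_nat; apply: leq_trans (mid_bin_le N).
  by rewrite leq_mul2r leq_exp2r // bin_le_mid.
by rewrite coin_odd expr0n /= invr_ge0 ler0n.
Qed.

Lemma heat0 x : heat 0 x = (x == 0)%:R.
Proof. by rewrite /heat /= pos_nil eq_sym. Qed.

Lemma heatS n x : heat n.+1 x = (10%:R)^-1 * \sum_(s : step) heat n (x - dir s).
Proof.
rewrite /heat [LHS]/= card_step; congr (_ * _); apply: eq_bigr => s _.
apply: avg_ext => w _; rewrite pos_cons; congr (_%:R); congr nat_of_bool.
by rewrite [RHS]eq_sym subr_eq eq_sym addrC.
Qed.

(* Conditionally on the coordinates chosen, the walk is a product of five
   independent one-dimensional simple walks. *)
Lemma heat_coins n x :
  heat n x = avg n (fun c : seq 'I_5 => \prod_(j < 5) coin (count_mem j c) (x 0 j)).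
Proof.
elim: n x => [|n IH] x.
  rewrite heat0 /=; case: (eqVneq x 0) => [->|x0].
    by rewrite big1 // => j _; rewrite mxE eqxx.
  have [j xj] : exists j, x 0 j != 0.
    by apply/existsP; rewrite -negb_forall; apply: contra x0 => /forallP H;
       apply/eqP/rowP => j; rewrite mxE; apply/eqP.
  by rewrite (bigD1 j) //= (negbTE xj) mul0r.
rewrite heatS sum_step [RHS]/= card_ord.
rewrite mulr_sumr [RHS]mulr_sumr; apply: eq_bigr => j _.
rewrite !IH -avgD -!avgZ; apply: avg_ext => c _.
have E s : \prod_(k < 5) coin (count_mem k c) ((x - dir (j, s)) 0 k)
   = coin (count_mem j c) (x 0 j - (-1) ^+ s)
     * \prod_(k < 5 | k != j) coin (count_mem k c) (x 0 k).
  rewrite (bigD1 j) //=; congr (_ * _).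
    by rewrite !mxE /= !eqxx mulr1.
  apply: eq_bigr => k kj; rewrite !mxE /= (negbTE kj).
  by rewrite mulr0 subr0.
rewrite !E [in RHS](bigD1 j isT) /= eqxx /=.
have -> : \prod_(k < 5 | k != j) coin ((j == k) + count_mem k c) (x 0 k)
    = \prod_(k < 5 | k != j) coin (count_mem k c) (x 0 k).
  by apply: eq_bigr => k kj; rewrite eq_sym (negbTE kj).
rewrite expr1 expr0 opprK add0n /=; field.
by [].
Qed.

(** Size biasing: insert a letter [j] at each of the [n.+1] places of a word of length [n]. A longer
    word arises once for every [j] it contains, which cancels the denominator; words without [j] do
    not arise at all, whence an inequality. *)
Lemma avg_size_bias n (j : 'I_5) (F : seq 'I_5 -> R) :
  (forall u v, F (u ++ j :: v) = F (u ++ v)) -> (forall u, 0 <= F u) ->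
  avg n (fun c => F c / (count_mem j c).+1%:R) <= 5 / n.+1%:R * avg n.+1 F.
Proof.
move=> Fj F0; pose H c := F c / (count_mem j c).+1%:R.
have E : \sum_(i < n.+1) avg n.+1 (fun c => (nth j c i == j)%:R * H (take i c ++ drop i.+1 c))
   = n.+1%:R / 5 * avg n H.
  rewrite (eq_bigr (fun=> 5^-1 * avg n H)); last first.
    move=> i _; have := ltn_ord i; move: (nat_of_ord i) => {}i i_lt.
    have E1 : n.+1 = (i + (1 + (n - i)))%N by lia.
    have E2 : n = (i + (n - i))%N by lia.
    rewrite [in LHS]E1 [in RHS]E2 !avg_cat -avgZ; apply: avg_ext => u su.
    rewrite avg_cat /= card_ord; congr (_ * _).
    rewrite (bigD1 j) //= big1 ?addr0; last first.
      move=> a aj; rewrite -[RHS](avg0 R 'I_5 (n - i)); apply: avg_ext => v _.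
      by rewrite nth_cat su ltnn subnn /= (negbTE aj) mul0r.
    apply: avg_ext => v _; rewrite nth_cat su ltnn subnn /= eqxx mul1r.
    rewrite take_size_cat // drop_cat su ltnNge leqnSn /= subSnn /=.
    by rewrite drop0.
  by rewrite sumr_const card_ord -[_ *+ n.+1]mulr_natl mulrA.
have -> : avg n H = 5 / n.+1%:R * (n.+1%:R / 5 * avg n H).
  by rewrite mulrA mulf_div [5 * _]mulrC divff ?mul1r //.
rewrite -E; apply: ler_wpM2l; first by rewrite divr_ge0.
rewrite -avg_sum; apply: avg_le => c sc.
have cnt : (\sum_(i < n.+1) (nth j c i == j))%N = count_mem j c.
  rewrite -sum1_count big_mkcond /= (big_nth j) sc big_mkord.
  by rewrite [RHS]big_mkcond; apply: eq_bigr => i _; case: eqP.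
rewrite (@eq_bigr _ _ _ _ _ _ _ (fun i : 'I_n.+1 => (nth j c i == j)%:R * (F c / (count_mem j c)%:R))); last first.
  move=> i _; case: eqP => [ci|]; last by rewrite !mul0r.
  rewrite !mul1r /H; have ic : (i < size c)%N by rewrite sc.
  have Ec : c = take i c ++ j :: drop i.+1 c.
    by rewrite -{1}ci -drop_nth // cat_take_drop.
  by rewrite [in RHS]Ec Fj !count_cat /= eqxx add1n addnS.
rewrite -mulr_suml -natr_sum cnt.
case: (posnP (count_mem j c)) => [->|H0]; first by rewrite mul0r.
by rewrite mulrCA mulfV ?mulr1 // pnatr_eq0 -lt0n.
Qed.

(** Each application of [avg_size_bias] removes one denominator and lengthens the word by one
    letter, which only improves the next factor. By [uniq J], inserting [j] leaves the other counts
    unchanged. *)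
Lemma avg_inv_counts n (J : seq 'I_5) : uniq J ->
  avg n (fun c : seq 'I_5 => \prod_(j <- J) ((count_mem j c).+1%:R)^-1)
    <= (5 / n.+1%:R) ^+ size J :> R.
Proof.
elim: J n => [|j J IH] n.
  by rewrite expr0 (@avg_ext _ _ _ _ (fun=> 1)) ?avg_const ?card_ord // => w _; rewrite big_nil.
move=> /= /andP [jJ uJ].
rewrite (@avg_ext _ _ _ _ (fun c => \prod_(j <- J) ((count_mem j c).+1%:R)^-1
    / (count_mem j c).+1%:R)); last by move=> c _; rewrite big_cons mulrC.
apply: le_trans (avg_size_bias _ _ _) _.
- move=> u v; apply: eq_big_seq => k kJ; rewrite !count_cat /=.
  by case: eqP => // jk; move: jJ; rewrite jk kJ.
- by move=> u; apply: prodr_ge0 => k _; rewrite invr_ge0 ler0n.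
rewrite exprS; apply: ler_wpM2l; first by rewrite divr_ge0.
apply: le_trans (IH _ uJ) _; apply: lerXn2r; rewrite ?nnegrE ?divr_ge0 //.
by apply: ler_wpM2l => //; rewrite lef_pV2 ?posrE ?ltr0Sn // ler_nat.
Qed.

(* [56 ^ 2 >= 5 ^ 5]: the square of the kernel is at most the mean of the
   product of five factors [1 / (N_j + 1)], each costing [5 / (n + 1)]. *)
Definition kbound (n : nat) : R := 56 / (n.+1%:R ^+ 2 * Num.sqrt n.+1%:R).

Lemma kbound_gt0 n : 0 < kbound n.
Proof. by rewrite divr_gt0 // mulr_gt0 ?exprn_gt0 ?sqrtr_gt0 ?ltr0Sn. Qed.

Lemma heat_ge0 n x : 0 <= heat n x.
Proof. by apply: avg_ge0 => w _; rewrite ler0n. Qed.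

Lemma heat_le n x : heat n x <= kbound n.
Proof.
rewrite -(@ler_pXn2r _ 2) ?nnegrE ?heat_ge0 ?(ltW (kbound_gt0 n)) //.
rewrite heat_coins; apply: le_trans (avg_sqr_le _ _ _) _; first by rewrite card_ord.
apply: le_trans (_ : avg n (fun c : seq 'I_5 => \prod_(j <- enum 'I_5) ((count_mem j c).+1%:R)^-1) <= _).
  apply: avg_le => c _; rewrite -prodrXl big_enum /=.
  by apply: ler_prod => j _; rewrite sqr_ge0 coin_sqr_le.
apply: le_trans (avg_inv_counts _ (enum_uniq _)) _.
rewrite size_enum_ord /kbound !expr_div_n exprMn -exprM sqr_sqrtr ?ler0n // -exprSr.
by rewrite ler_pM2r ?invr_gt0 ?exprn_gt0 ?ltr0Sn //; lra.
Qed.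

End SimpleWalk.

Lemma sqr_sum_le (R : realFieldType) (I : Type) (s : seq I) (a : I -> R) :
  (\sum_(i <- s) a i) ^+ 2 <= (size s)%:R * \sum_(i <- s) a i ^+ 2.
Proof.
elim: s => [|i s IH]; first by rewrite !big_nil mulr0 expr0n.
rewrite !big_cons /=; move: IH; set S := \sum_(j <- s) a j.
set Q := \sum_(j <- s) _ => IH.
have [/size0nil s0|s0] := posnP (size s).
  by rewrite /S /Q s0 !big_nil /= !addr0 mul1r.
have m0 : 0 < (size s)%:R :> R by rewrite ltr0n.
rewrite -natr1; set m := (size s)%:R in IH m0 *.
have H : 2 * a i * S <= m * a i ^+ 2 + S ^+ 2 / m.
  rewrite -subr_ge0 (_ : _ - _ = (m * a i - S) ^+ 2 / m).
    by rewrite divr_ge0 ?sqr_ge0 // ltW.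
  by field; rewrite gt_eqF.
have H2 : S ^+ 2 / m <= Q by rewrite ler_pdivrMr // mulrC.
by nra.
Qed.

(** * Moments of Green sums over two walks *)

Section WordSum.
Variables (R : realFieldType) (T : Type) (Ths : seq T).
Implicit Types (f g : seq T -> R) (k : nat) (t : seq T).

(** Words over a list of sites index the expansion of a [k]-th power of a sum, see [exp_sumw]. *)
Fixpoint sumw k f : R :=
  if k is k'.+1 then \sum_(th <- Ths) sumw k' (fun t => f (th :: t)) else f [::].

Lemma sumw_le k f g :
  (forall t, size t = k -> f t <= g t) -> sumw k f <= sumw k g.
Proof.
elim: k f g => [|k IH] f g fg /=; first exact: fg.
by apply: ler_sum => th _; apply: IH => t st; apply: fg; rewrite /= st.
Qed.

Lemma sumw_ext k f g :
  (forall t, size t = k -> f t = g t) -> sumw k f = sumw k g.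
Proof.
by move=> fg; apply/eqP; rewrite eq_le !sumw_le // => t /fg ->.
Qed.

Lemma sumwD k f g : sumw k (fun t => f t + g t) = sumw k f + sumw k g.
Proof.
elim: k f g => [//|k IH] f g /=.
by rewrite -big_split /=; apply: eq_bigr => a _; rewrite IH.
Qed.

Lemma sumwZ k c f : sumw k (fun t => c * f t) = c * sumw k f.
Proof.
elim: k f => [//|k IH] f /=.
by rewrite mulr_sumr; apply: eq_bigr => a _; rewrite IH.
Qed.

Lemma sumw0 k : sumw k (fun=> 0) = 0.
Proof. by elim: k => [//|k IH] /=; rewrite big1. Qed.

Lemma sumw_sum k (I : Type) (r : seq I) (F : I -> seq T -> R) :
  sumw k (fun t => \sum_(i <- r) F i t) = \sum_(i <- r) sumw k (F i).
Proof.
elim: r => [|i r IH].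
  by rewrite big_nil -[RHS](sumw0 k); apply: sumw_ext => t _; rewrite big_nil.
rewrite big_cons -IH -sumwD; apply: sumw_ext => t _; by rewrite big_cons.
Qed.

Lemma sumw_avg k (A : finType) n (f : seq T -> seq A -> R) :
  sumw k (fun t => avg n (f t)) = avg n (fun w => sumw k (fun t => f t w)).
Proof.
elim: k f => [//|k IH] f /=; rewrite avg_sum.
by apply: eq_bigr => th _; rewrite IH.
Qed.

Lemma exp_sumw k (a : T -> R) :
  (\sum_(th <- Ths) a th) ^+ k = sumw k (fun t => \prod_(th <- t) a th).
Proof.
elim: k => [|k IH] /=; first by rewrite big_nil expr0.
rewrite exprS IH mulr_suml; apply: eq_bigr => th _.
by rewrite -sumwZ; apply: sumw_ext => t _; rewrite big_cons.
Qed.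

(** The Cauchy-Schwarz inequality in the rational form [f g <= (B/A) f^2/2 + (A/B) g^2/2]. *)
Lemma sumw_mul_le k f g (A B W : R) : 0 < A -> 0 < B ->
  sumw k (fun t => f t ^+ 2) <= A ^+ 2 * W ->
  sumw k (fun t => g t ^+ 2) <= B ^+ 2 * W ->
  sumw k (fun t => f t * g t) <= A * B * W.
Proof.
move=> A0 B0 Hf Hg.
apply: (@le_trans _ _ (sumw k (fun t => B / A / 2 * f t ^+ 2 + A / B / 2 * g t ^+ 2))).
  apply: sumw_le => t _; rewrite -subr_ge0.
  rewrite (_ : _ - _ = (B * f t - A * g t) ^+ 2 / (2 * A * B)).
    by rewrite divr_ge0 ?sqr_ge0 // !mulr_ge0 // ltW.
  by field; rewrite !gt_eqF.
rewrite sumwD !sumwZ.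
rewrite (_ : A * B * W = B / A / 2 * (A ^+ 2 * W) + A / B / 2 * (B ^+ 2 * W)).
  by apply: lerD; apply: ler_wpM2l => //; rewrite !divr_ge0 // ltW.
by field; rewrite !gt_eqF.
Qed.

Fixpoint picks (t : seq T) : seq (T * seq T) :=
  if t is th :: t' then (th, t') :: [seq (p.1, th :: p.2) | p <- picks t']
  else [::].

Lemma size_picks t : size (picks t) = size t.
Proof. by elim: t => [//|th t IH] /=; rewrite size_map IH. Qed.

(** Replacing the factors [f + g] by [g] one at a time gives a telescoping sum; in each difference
    the factors already replaced are enlarged back to [f + g]. *)
Lemma prod_picks t (f g : T -> R) : (forall th, 0 <= f th) -> (forall th, 0 <= g th) ->
  \prod_(th <- t) (f th + g th) <=
  \sum_(p <- picks t) f p.1 * \prod_(th <- p.2) (f th + g th) + \prod_(th <- t) g th.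
Proof.
move=> f0 g0; elim: t => [|th t IH] /=; first by rewrite !big_nil add0r.
rewrite !big_cons big_map /= mulrDl -addrA lerD2l.
apply: le_trans (ler_wpM2l (g0 th) IH) _; rewrite mulrDr lerD2r mulr_sumr.
apply: ler_sum => p _; rewrite big_cons mulrCA; apply: ler_wpM2l => //.
apply: ler_wpM2r; last by rewrite lerDr.
by apply: prodr_ge0 => a _; rewrite addr_ge0.
Qed.

(** By symmetry each of the [k.+1] positions of the removed entry contributes the same sum. *)
Lemma sumw_picks k (h : T -> seq T -> R) :
  sumw k.+1 (fun t => \sum_(p <- picks t) h p.1 p.2)
  = k.+1%:R * \sum_(th <- Ths) sumw k (h th).
Proof.
elim: k h => [|k IH] h.
  by rewrite mul1r /=; apply: eq_bigr => th _; rewrite big_seq1.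
rewrite [LHS](_ : _ = \sum_(th <- Ths) sumw k.+1 (fun t =>
  \sum_(p <- picks (th :: t)) h p.1 p.2)) //.
transitivity (\sum_(th <- Ths) (sumw k.+1 (h th)
   + sumw k.+1 (fun t => \sum_(p <- picks t) h p.1 (th :: p.2)))).
  apply: eq_bigr => th _; rewrite -sumwD; apply: sumw_ext => t _.
  by rewrite /= big_cons big_map.
rewrite big_split /= -[k.+2%:R]natr1 mulrDl mul1r addrC; congr (_ + _).
transitivity (\sum_(th <- Ths) k.+1%:R * \sum_(a <- Ths) sumw k (fun t => h a (th :: t))).
  apply: eq_bigr => th _.
  by have /= := IH (fun a t => h a (th :: t)); apply.
by rewrite -mulr_sumr exchange_big.
Qed.

End WordSum.

(* A Gram kernel [\sum_th phi th x * phi th y] factorises the [k]-th moment of a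
   double sum over two independent walks into quantities of one walk, to which
   the Cauchy-Schwarz inequality applies. *)
Section Moments.
Variables (R : realFieldType) (T : Type) (Ths : seq T).
Variable phi : T -> 'rV[int]_5 -> R.
Hypothesis phi_ge0 : forall th x, 0 <= phi th x.

(** The mixed moment, for a walk from [x], of its local times smeared by [phi] at the sites of
    [t]. *)
Definition hits n x (t : seq T) : R :=
  avg n (fun w => \prod_(th <- t) \sum_(i < n.+1) phi th (x + pos (take i w))).

Definition Gram x y : R := \sum_(th <- Ths) phi th x * phi th y.

Lemma Gram_ge0 x y : 0 <= Gram x y.
Proof. by apply: sumr_ge0 => th _; rewrite mulr_ge0. Qed.

Lemma hits_ge0 n x t : 0 <= hits n x t.
Proof.
by apply: avg_ge0 => w _; apply: prodr_ge0 => th _; apply: sumr_ge0.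
Qed.

(* Split according to which site of [t] is hit first, and at which time. *)
Lemma hits_first n x t : (0 < size t)%N ->
  hits n x t <= \sum_(p <- picks t) \sum_(i < n.+1)
    avg i (fun u => phi p.1 (x + pos u) * hits (n - i) (x + pos u) p.2).
Proof.
move=> t0; elim: n x => [|n IH] x.
  rewrite /hits /= pos_nil addr0.
  case: t t0 => [//|th t] _ /=; rewrite [leLHS]big_cons [leRHS]big_cons big_map.
  rewrite big_ord1 [X in _ <= X + _]big_ord1 /= pos_nil !addr0.
  rewrite lerDl; apply: sumr_ge0 => p _; apply: sumr_ge0 => i _.
  apply: avg_ge0 => u _; rewrite mulr_ge0 //.
  by apply: prodr_ge0 => *; apply: sumr_ge0.
have E w th : \sum_(i < n.+2) phi th (x + pos (take i w))
  = phi th x + \sum_(i < n.+1) phi th (x + pos (take i.+1 w)).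
  rewrite big_ord_recl; congr (_ + _); first by rewrite take0 pos_nil addr0.
apply: (@le_trans _ _ (\sum_(p <- picks t) phi p.1 x * hits n.+1 x p.2
   + (#|step|%:R)^-1 * \sum_s hits n (x + dir s) t)).
  have -> : (#|step|%:R)^-1 * \sum_s hits n (x + dir s) t
     = avg n.+1 (fun w => \prod_(th <- t) \sum_(i < n.+1) phi th (x + pos (take i.+1 w))).
    rewrite /hits [RHS]/=; congr (_ * _); apply: eq_bigr => s _.
    apply: avg_ext => w _; apply: eq_bigr => th _; apply: eq_bigr => i _.
    by rewrite pos_cons addrA.
  rewrite /hits; under [X in _ <= X + _]eq_bigr do rewrite -avgZ.
  rewrite -avg_sum -avgD; apply: avg_le => w _.
  rewrite (eq_bigr _ (fun th _ => E w th)).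
  apply: le_trans (prod_picks _ _ _) _ => //; first by move=> th; apply: sumr_ge0.
  rewrite lerD2r le_eqVlt; apply/orP; left; apply/eqP.
  apply: eq_bigr => p _; congr (_ * _).
  by rewrite (eq_bigr _ (fun th _ => E w th)).
under [X in _ <= X]eq_bigr do rewrite big_ord_recl /= pos_nil addr0 subn0.
rewrite big_split /= lerD2l.
apply: (@le_trans _ _ (#|step|%:R^-1 * \sum_s \sum_(p <- picks t) \sum_(i < n.+1)
    avg i (fun u => phi p.1 (x + dir s + pos u) * hits (n - i) (x + dir s + pos u) p.2))).
  by apply: ler_wpM2l; [rewrite invr_ge0 ler0n|apply: ler_sum => s _; exact: IH].
rewrite exchange_big mulr_sumr le_eqVlt; apply/orP; left; apply/eqP.
apply: eq_bigr => p _; rewrite exchange_big mulr_sumr; apply: eq_bigr => i _.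
rewrite /bump leq0n add0n add1n subSS; congr (_ * _); apply: eq_bigr => s _; apply: avg_ext => u _.
by rewrite pos_cons addrA.
Qed.

Variables (rho kappa : R) (N : nat).
Hypothesis rho_gt0 : 0 < rho.
Hypothesis rho_le1 : rho <= 1.
Hypothesis kappaP : forall x, \sum_(i < N.+1) \sum_(j < N.+1)
  rho ^+ (i + j) * avg i (fun u => avg j (fun v => Gram (x + pos u) (x + pos v)))
    <= kappa.

Lemma kappa_ge0 : 0 <= kappa.
Proof.
apply: le_trans (kappaP 0); apply: sumr_ge0 => i _; apply: sumr_ge0 => j _.
rewrite mulr_ge0 ?exprn_ge0 ?(ltW rho_gt0) //.
by apply: avg_ge0 => u _; apply: avg_ge0 => v _; exact: Gram_ge0.
Qed.

(* Geometric weights [rho ^+ i] replace the horizon [n], so that the induction on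
   [k] through [hits_first] keeps the same constant [kappa] at every step. *)
Lemma hits_norm k n x : (n <= N)%N ->
  sumw Ths k (fun t => hits n x t ^+ 2)
    <= (rho ^- n) ^+ 2 * (k`!%:R ^+ 2 * kappa ^+ k).
Proof.
elim: k n x => [|k IH] n x nN.
  rewrite /= /hits fact0 !expr0 !mulr1 expr1n mulr1.
  rewrite (@avg_ext _ _ _ _ (fun=> 1)) ?avg_const ?card_step //; last first.
    by move=> w _; rewrite big_nil.
  by rewrite expr1n exprn_ege1 // invf_ge1 ?exprn_gt0 // exprn_ile1 // ltW.
set W := (k`!%:R ^+ 2 * kappa ^+ k) in IH.
pose g th t := \sum_(i < n.+1)
    avg i (fun u => phi th (x + pos u) * hits (n - i) (x + pos u) t).
(* Cauchy-Schwarz over the choices of the first site gives one factor [k.+1] and [sumw_picks] a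
   second; together they build the squared factorial. *)
apply: (@le_trans _ _ (sumw Ths k.+1 (fun t => \sum_(p <- picks t) k.+1%:R * g p.1 p.2 ^+ 2))).
  apply: sumw_le => t st; rewrite -mulr_sumr -{1}st -(size_picks t).
  apply: le_trans (sqr_sum_le _ _).
  apply: lerXn2r; rewrite ?nnegrE ?hits_ge0 //.
    apply: sumr_ge0 => p _; apply: sumr_ge0 => i _; apply: avg_ge0 => u _.
    by rewrite mulr_ge0 // hits_ge0.
  by apply: hits_first; rewrite st.
rewrite (sumw_picks Ths k (fun a t => k.+1%:R * g a t ^+ 2)).
under eq_bigr do rewrite sumwZ.
rewrite -mulr_sumr.
suff H : \sum_(th <- Ths) sumw Ths k (fun t => g th t ^+ 2)
    <= (rho ^- n) ^+ 2 * (W * kappa).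
  rewrite factS natrM exprMn [kappa ^+ k.+1]exprSr.
  apply: (@le_trans _ _ (k.+1%:R * (k.+1%:R * ((rho ^- n) ^+ 2 * (W * kappa))))).
    by rewrite !ler_wpM2l.
  by rewrite le_eqVlt; apply/orP; left; apply/eqP; rewrite /W; ring.
have E th t : g th t ^+ 2 = \sum_(i < n.+1) \sum_(j < n.+1)
   avg i (fun u => avg j (fun v => phi th (x + pos u) * phi th (x + pos v)
     * (hits (n - i) (x + pos u) t * hits (n - j) (x + pos v) t))).
  rewrite expr2 /g mulr_suml; apply: eq_bigr => i _.
  rewrite mulr_sumr; apply: eq_bigr => j _.
  rewrite -avgZr; apply: avg_ext => u _; rewrite -avgZ; apply: avg_ext => v _.
  by rewrite mulrACA.
have -> : \sum_(th <- Ths) sumw Ths k (fun t => g th t ^+ 2)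
  = \sum_(i < n.+1) \sum_(j < n.+1) avg i (fun u => avg j (fun v =>
     Gram (x + pos u) (x + pos v)
     * sumw Ths k (fun t => hits (n - i) (x + pos u) t * hits (n - j) (x + pos v) t))).
  transitivity (\sum_(th <- Ths) \sum_(i < n.+1) \sum_(j < n.+1)
    avg i (fun u => avg j (fun v => phi th (x + pos u) * phi th (x + pos v)
     * sumw Ths k (fun t => hits (n - i) (x + pos u) t * hits (n - j) (x + pos v) t)))).
    apply: eq_bigr => th _.
    rewrite (@sumw_ext _ _ _ _ _ _ (fun t _ => E th t)) sumw_sum; apply: eq_bigr => i _.
    rewrite sumw_sum; apply: eq_bigr => j _.
    rewrite sumw_avg; apply: avg_ext => u _; rewrite sumw_avg.
    by apply: avg_ext => v _; rewrite sumwZ.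
  rewrite exchange_big; apply: eq_bigr => i _.
  rewrite exchange_big; apply: eq_bigr => j _.
  rewrite -avg_sum; apply: avg_ext => u _; rewrite -avg_sum; apply: avg_ext => v _.
  by rewrite -mulr_suml.
have W0 : 0 <= W by rewrite mulr_ge0 ?exprn_ge0 ?kappa_ge0 ?ler0n.
have rn0 : 0 <= (rho ^- n) ^+ 2 * W by rewrite mulr_ge0 ?sqr_ge0.
pose F i j := rho ^+ (i + j) * avg i (fun u => avg j (fun v => Gram (x + pos u) (x + pos v))).
have F0 i j : 0 <= F i j.
  rewrite mulr_ge0 ?exprn_ge0 ?(ltW rho_gt0) //.
  by apply: avg_ge0 => u _; apply: avg_ge0 => v _; exact: Gram_ge0.
apply: (@le_trans _ _ (\sum_(i < n.+1) \sum_(j < n.+1) (rho ^- n) ^+ 2 * W * F i j)).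
  apply: ler_sum => i _; apply: ler_sum => j _.
  rewrite /F mulrA -!avgZ; apply: avg_le => u _; rewrite -avgZ; apply: avg_le => v _.
  rewrite [leRHS]mulrC; apply: ler_wpM2l; first exact: Gram_ge0.
  have le_in : (i <= n)%N by rewrite -ltnS.
  have le_jn : (j <= n)%N by rewrite -ltnS.
  (* The induction hypothesis at the remaining times [n - i] and [n - j] leaves the factor
     [rho ^+ (i + j)] over, which is the weight in [kappaP]. *)
  rewrite (_ : _ * _ * _ = rho ^- (n - i) * rho ^- (n - j) * W).
    apply: sumw_mul_le; rewrite ?invr_gt0 ?exprn_gt0 //; apply: IH; lia.
  have rn : rho ^+ n = rho ^+ (n - i) * rho ^+ i by rewrite -exprD subnK.
  have rn' : rho ^+ n = rho ^+ (n - j) * rho ^+ j by rewrite -exprD subnK.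
  rewrite expr2 {1}rn rn' exprD; have r0 : rho != 0 by rewrite gt_eqF.
  by field; rewrite !expf_neq0.
rewrite (_ : _ * (W * kappa) = (rho ^- n) ^+ 2 * W * kappa); last by rewrite mulrA.
under eq_bigr do rewrite -mulr_sumr.
rewrite -mulr_sumr; apply: ler_wpM2l => //; apply: le_trans (kappaP x).
apply: (@le_trans _ _ (\sum_(i < n.+1) \sum_(j < N.+1) F i j)).
  apply: ler_sum => i _; rewrite [leLHS](big_ord_widen N.+1 (F i)) // [leLHS]big_mkcond /=.
  by apply: ler_sum => j _; case: ifP.
rewrite [leLHS](big_ord_widen N.+1 (fun i => \sum_(j < N.+1) F i j)) // [leLHS]big_mkcond /=.
by apply: ler_sum => i _; case: ifP => // _; apply: sumr_ge0 => j _; exact: F0.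
Qed.

(** Expanded over words [t] of sites, the moment factorises by independence into
    [hits n1 0 t * hits n2 0 t]. *)
Lemma cross_moment k n1 n2 : (n1 <= N)%N -> (n2 <= N)%N ->
  avg n1 (fun u => avg n2 (fun v => (\sum_(i < n1.+1) \sum_(j < n2.+1)
     Gram (pos (take i u)) (pos (take j v))) ^+ k))
  <= rho ^- (n1 + n2) * (k`!%:R ^+ 2 * kappa ^+ k).
Proof.
move=> n1N n2N.
have -> : avg n1 (fun u => avg n2 (fun v => (\sum_(i < n1.+1) \sum_(j < n2.+1)
     Gram (pos (take i u)) (pos (take j v))) ^+ k))
  = sumw Ths k (fun t => hits n1 0 t * hits n2 0 t).
  transitivity (avg n1 (fun u => avg n2 (fun v => sumw Ths k (fun t =>
     (\prod_(th <- t) \sum_(i < n1.+1) phi th (0 + pos (take i u)))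
     * (\prod_(th <- t) \sum_(i < n2.+1) phi th (0 + pos (take i v))))))).
    apply: avg_ext => u _; apply: avg_ext => v _.
    rewrite -[RHS](@sumw_ext _ _ _ _ (fun t => \prod_(th <- t)
       ((\sum_(i < n1.+1) phi th (0 + pos (take i u))) *
         (\sum_(i < n2.+1) phi th (0 + pos (take i v)))))); last first.
      by move=> t _; rewrite big_split.
    rewrite -exp_sumw; congr (_ ^+ _).
    rewrite [RHS](eq_bigr (fun th => \sum_(i < n1.+1) \sum_(j < n2.+1)
       phi th (pos (take i u)) * phi th (pos (take j v)))).
      rewrite [RHS]exchange_big; apply: eq_bigr => i _.
      by rewrite [RHS]exchange_big; apply: eq_bigr => j _.
    move=> th _; rewrite mulr_suml; apply: eq_bigr => i _.
    by rewrite mulr_sumr; apply: eq_bigr => j _; rewrite !add0r.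
  rewrite [RHS](@sumw_ext _ _ _ _ _ (fun t => avg n1 (fun u => avg n2 (fun v =>
     (\prod_(th <- t) \sum_(i < n1.+1) phi th (0 + pos (take i u)))
     * (\prod_(th <- t) \sum_(i < n2.+1) phi th (0 + pos (take i v))))))).
    by rewrite sumw_avg; apply: avg_ext => u _; rewrite sumw_avg.
  by move=> t _; rewrite /hits -avgZr; apply: avg_ext => u _; rewrite -avgZ.
rewrite exprD invfM.
by apply: sumw_mul_le; rewrite ?invr_gt0 ?exprn_gt0 //; exact: hits_norm.
Qed.

End Moments.

(** * The Green function of the walk as a Gram kernel *)

Section GreenMoments.
Variable R : realType.
Notation heat := (@heat R).
Notation kbound := (@kbound R).

Definition flip (s : step) : step := (s.1, ~~ s.2).

Lemma flip_inj : injective flip.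
Proof. by apply: (can_inj (g := flip)) => -[j b]; rewrite /flip negbK. Qed.

Lemma dir_flip s : dir (flip s) = - dir s.
Proof.
by case: s => j [] /=; rewrite /dir /= ?expr0 ?expr1 scaleN1r scale1r ?opprK.
Qed.

Lemma pos_flip w : pos (map flip w) = - pos w.
Proof.
by rewrite /pos big_map -sumrN; apply: eq_bigr => s _; rewrite dir_flip.
Qed.

Lemma heatN n x : heat n (- x) = heat n x.
Proof.
rewrite /heat -(avg_map _ _ flip_inj); apply: avg_ext => w _.
by rewrite pos_flip eqr_opp.
Qed.

Lemma avg_heat i l y : avg i (fun u => heat l (y + pos u)) = heat (l + i) y.
Proof.
rewrite /heat avg_swap avg_cat; apply: avg_ext => w _.
rewrite -(avg_map _ _ flip_inj); apply: avg_ext => u _.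
by rewrite pos_flip pos_cat -subr_eq opprK.
Qed.

Lemma sum_heat_le1 n x (Z : seq 'rV[int]_5) : uniq Z ->
  \sum_(z <- Z) heat n (x - z) <= 1.
Proof.
move=> uZ; rewrite /heat -avg_sum; apply: avg_le_const; first by rewrite card_step.
move=> w _; rewrite (eq_bigr (fun z => (z == x - pos w)%:R)); last first.
  move=> z _; congr (_%:R); congr nat_of_bool.
  by rewrite eq_sym [RHS]eq_sym !subr_eq addrC.
rewrite -natr_sum lern1; have := count_uniq_mem (x - pos w) uZ.
by rewrite -sum1_count big_mkcond /= => ->; case: (_ \in _).
Qed.

(** The Chapman-Kolmogorov equation. It is enough that [Z] contain the points at [b] steps from [y],
    so the sum over the lattice becomes finite. *)
Lemma heat_conv a b x y (Z : seq 'rV[int]_5) : uniq Z ->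
  (forall v, size v = b -> y - pos v \in Z) ->
  heat (a + b) (x - y) = \sum_(z <- Z) heat a (x - z) * heat b (y - z).
Proof.
move=> uZ yZ; rewrite -avg_heat.
rewrite [RHS](eq_bigr (fun z => avg b (fun v => heat a (x - z) * (pos v == y - z)%:R))); last first.
  by move=> z _; rewrite avgZ.
rewrite -avg_sum; apply: avg_ext => v sv.
rewrite (bigD1_seq (y - pos v)) ?yZ //= big1 ?addr0.
  by rewrite subKr eqxx mulr1 opprB addrAC -addrA.
move=> z zy; case: eqP => [pv|]; last by rewrite mulr0.
by move: zy; rewrite pv subKr eqxx.
Qed.

Lemma kbound_nincr a b : (a <= b)%N -> kbound b <= kbound a.
Proof.
move=> ab; rewrite /kbound ler_pM2l // lef_pV2 ?posrE ?mulr_gt0 ?exprn_gt0 ?sqrtr_gt0 ?ltr0Sn //.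
apply: ler_pM; rewrite ?exprn_ge0 ?sqrtr_ge0 ?ler0n //.
  by apply: lerXn2r; rewrite ?nnegrE // ler_nat.
by rewrite ler_wsqrtr // ler_nat.
Qed.

(** One factor [sqrt] is frozen at its smallest value, and the remaining inverse squares are bounded
    by twice a telescoping sum; hence [112 = 2 * 56]. *)
Lemma sum_kbound M r :
  \sum_(l < M) kbound (l + r) <= 112 / (r.+1%:R * Num.sqrt r.+1%:R).
Proof.
apply: (@le_trans _ _ (\sum_(l < M) 56 / Num.sqrt r.+1%:R * ((l + r).+1%:R ^- 2))).
  apply: ler_sum => l _; rewrite /kbound -mulrA -invfM ler_pM2l //.
  rewrite lef_pV2 ?posrE ?mulr_gt0 ?exprn_gt0 ?sqrtr_gt0 ?ltr0Sn //.
  rewrite mulrC ler_pM2l ?exprn_gt0 ?ltr0Sn // ler_wsqrtr // ler_nat; lia.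
rewrite -mulr_sumr.
have H : \sum_(l < M) ((l + r).+1%:R ^- 2) <= 2 * (r.+1%:R^-1 - (M + r).+1%:R^-1) :> R.
  elim: M => [|M IH]; first by rewrite big_ord0 add0n subrr mulr0.
  rewrite big_ord_recr /=; move: IH; set S := \sum_(l < M) _ => IH.
  rewrite addSn; set m := (M + r)%N in IH *.
  have m0 : 0 < m.+1%:R :> R by rewrite ltr0n.
  have E : m.+2%:R = m.+1%:R + 1 :> R by rewrite -natr1.
  have m1 : 1 <= m.+1%:R :> R by rewrite ler1n.
  have : m.+1%:R ^- 2 <= 2 * (m.+1%:R^-1 - m.+2%:R^-1) :> R.
    rewrite E; move: (m.+1%:R : R) m0 m1 => x x0 x1.
    rewrite -subr_ge0 (_ : _ - _ = (x - 1) / (x ^+ 2 * (x + 1))).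
      by rewrite divr_ge0 ?subr_ge0 ?mulr_ge0 ?sqr_ge0 //; lra.
    by field; rewrite !gt_eqF //; lra.
  move: IH; set a := m.+1%:R ^- 2; set b := m.+1%:R^-1; set c := m.+2%:R^-1.
  by set d := r.+1%:R^-1; lra.
apply: (@le_trans _ _ (56 / Num.sqrt r.+1%:R * (2 * r.+1%:R^-1))).
  apply: ler_wpM2l; first by rewrite divr_ge0 ?sqrtr_ge0.
  by apply: le_trans H _; rewrite ler_pM2l // gerBl invr_ge0 ler0n.
rewrite invfM; set a := _^-1; set b := _^-1; lra.
Qed.

(** Below index [Q] the weights are dropped and the roots sum to at most [2 sqrt Q]; beyond it
    [1 / sqrt] is at most [1 / sqrt Q], and the geometric series sums to at most [Q]. *)
Lemma sum_geom_sqrt N Q : (0 < Q)%N ->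
  \sum_(i < N) (1 - Q%:R^-1) ^+ i / Num.sqrt i.+1%:R <= 3 * Num.sqrt Q%:R :> R.
Proof.
move=> Q0; set rho := 1 - _.
have Q0' : 0 < Q%:R :> R by rewrite ltr0n.
have rho0 : 0 <= rho by rewrite subr_ge0 invf_le1 // ler1n.
have rho1 : rho < 1 by rewrite /rho ltrBlDr ltrDl invr_gt0.
have sQ0 : 0 < Num.sqrt Q%:R :> R by rewrite sqrtr_gt0.
apply: (@le_trans _ _ (2 * Num.sqrt (minn N Q)%:R + (\sum_(i < N) rho ^+ i) / Num.sqrt Q%:R)).
  elim: N => [|N IH]; first by rewrite !big_ord0 min0n sqrtr0 mulr0 mul0r addr0.
  rewrite !big_ord_recr /= mulrDl.
  move: IH; set S := \sum_(i < N) _ / _; set G := \sum_(i < N) _ => IH.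
  suff H : rho ^+ N / Num.sqrt N.+1%:R
     <= 2 * (Num.sqrt (minn N.+1 Q)%:R - Num.sqrt (minn N Q)%:R) + rho ^+ N / Num.sqrt Q%:R.
    by lra.
  have rN0 : 0 <= rho ^+ N by rewrite exprn_ge0.
  case: (leqP Q N) => [QN|NQ].
    rewrite (minn_idPr _) ?(minn_idPr QN) ?subrr ?mulr0 ?add0r //; last lia.
    apply: ler_wpM2l => //.
    by rewrite lef_pV2 ?posrE ?sqrtr_gt0 ?ltr0Sn // ler_wsqrtr // ler_nat; lia.
  rewrite (minn_idPl _) ?(minn_idPl (ltnW NQ)) //.
  apply: (@le_trans _ _ (2 * (Num.sqrt N.+1%:R - Num.sqrt N%:R))); last first.
    by rewrite lerDl divr_ge0 // ltW.
  have rN1 : rho ^+ N <= 1 by rewrite exprn_ile1 // ltW.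
  set a := Num.sqrt N.+1%:R; set b := Num.sqrt N%:R.
  have a0 : 0 < a by rewrite sqrtr_gt0 ltr0n.
  have b0 : 0 <= b by rewrite sqrtr_ge0.
  have ba : b <= a by rewrite ler_wsqrtr // ler_nat.
  have E : a ^+ 2 = b ^+ 2 + 1 by rewrite !sqr_sqrtr ?ler0n // natr1.
  rewrite ler_pdivrMr //; nra.
have -> : 3 * Num.sqrt Q%:R = 2 * Num.sqrt Q%:R + Q%:R / Num.sqrt Q%:R :> R.
  rewrite -{3}[Q%:R : R]sqr_sqrtr ?ler0n // expr2 mulfK ?gt_eqF //; lra.
apply: lerD.
  by rewrite ler_pM2l // ler_wsqrtr // ler_nat geq_minr.
apply: ler_wpM2r; first by rewrite invr_ge0 ltW.
have E : (1 - rho) * \sum_(i < N) rho ^+ i = 1 - rho ^+ N.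
  by rewrite -[LHS]opprK -mulNr opprB -subrX1 opprB.
have -> : \sum_(i < N) rho ^+ i = Q%:R * (1 - rho ^+ N).
  by rewrite -E /rho subKr mulrA mulfV ?mul1r // gt_eqF.
by rewrite ler_piMr ?ler0n // gerBl exprn_ge0.
Qed.

Definition sites M Z := [seq (l, z) | l <- iota 0 M, z <- Z] : seq (nat * 'rV[int]_5).
(* By the semigroup property [heat l * heat l] and [heat l * heat l.+1] are the
   kernels at times [2 l] and [2 l + 1]; summing both covers every time. *)
Definition site_heat (th : nat * 'rV[int]_5) x : R :=
  heat th.1 (x - th.2) + heat th.1.+1 (x - th.2).

Lemma site_heat_ge0 th x : 0 <= site_heat th x.
Proof. by rewrite addr_ge0 ?heat_ge0. Qed.

Lemma avg_site_heat i th x :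
  avg i (fun u => site_heat th (x + pos u))
  = heat (th.1 + i) (x - th.2) + heat (th.1.+1 + i) (x - th.2).
Proof.
rewrite avgD -!avg_heat.
by congr (_ + _); apply: avg_ext => u _; rewrite addrAC.
Qed.

(** For each [l] the factor with the larger time is bounded uniformly by [2 * kbound], and the other
    one sums to at most 2 over the sites. Summing over [l] leaves the decay [-3/2], with
    [448 = 4 * 112]. *)
Lemma avg_Gram i j M Z x : uniq Z ->
  avg i (fun u => avg j (fun v => Gram (sites M Z) site_heat (x + pos u) (x + pos v)))
  <= 448 / ((maxn i j).+1%:R * Num.sqrt (maxn i j).+1%:R).
Proof.
move=> uZ.
pose h l k z := heat (l + k) (x - z) + heat (l.+1 + k) (x - z).
have -> : avg i (fun u => avg j (fun v => Gram (sites M Z) site_heat (x + pos u) (x + pos v)))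
  = \sum_(l < M) \sum_(z <- Z) h l i z * h l j z.
  transitivity (\sum_(th <- sites M Z) h th.1 i th.2 * h th.1 j th.2).
    rewrite [RHS](eq_bigr (fun th => avg i (fun u => avg j (fun v =>
      site_heat th (x + pos u) * site_heat th (x + pos v))))); last first.
      move=> th _; rewrite /h -!avg_site_heat -avgZr; apply: avg_ext => u _.
      by rewrite -avgZ.
    rewrite -avg_sum; apply: avg_ext => u _.
    by rewrite -avg_sum; apply: avg_ext => v _.
  rewrite /sites big_allpairs_dep /= -{1}[M]subn0 -/(index_iota 0 M) big_mkord.
  by [].
have h0 l k z : 0 <= h l k z by rewrite addr_ge0 ?heat_ge0.
have h1 l k z : h l k z <= 2 * kbound (l + k).
  rewrite mulr_natl mulr2n lerD ?heat_le //.
  by apply: le_trans (heat_le _ _ _) _; apply: kbound_nincr; lia.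
have h2 l k : \sum_(z <- Z) h l k z <= 2.
  by rewrite big_split /= -[2]/(1 + 1) lerD // sum_heat_le1.
have H l : \sum_(z <- Z) h l i z * h l j z <= 4 * kbound (l + maxn i j).
  wlog ij : i j / (i <= j)%N.
    move=> W; case: (leqP i j) => [|/ltnW] ij; first by have := W _ _ ij; rewrite (maxn_idPr ij).
    by have := W _ _ ij; rewrite (maxn_idPr ij); under eq_bigr do rewrite mulrC.
  rewrite (maxn_idPr ij).
  apply: (@le_trans _ _ (\sum_(z <- Z) h l i z * (2 * kbound (l + j)))).
    by apply: ler_sum => z _; apply: ler_wpM2l.
  rewrite -mulr_suml (_ : 4 * _ = 2 * (2 * kbound (l + j))); last by ring.
  by apply: ler_wpM2r; rewrite ?h2 // mulr_ge0 // ltW // kbound_gt0.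
apply: (@le_trans _ _ (\sum_(l < M) 4 * kbound (l + maxn i j))).
  by apply: ler_sum => l _; exact: H.
rewrite -mulr_sumr (_ : 448 = 4 * 112); last by ring.
by rewrite -mulrA ler_pM2l // sum_kbound.
Qed.

(** Grouped by their maximum [m], with the weight relaxed to [rho ^+ m], the pairs contribute at
    most [2 (m+1)] times [(m+1)^(-3/2)], and [sum_geom_sqrt] applies. *)
Lemma kappa_sites N M Z Q x : uniq Z -> (1 < Q)%N ->
  \sum_(i < N.+1) \sum_(j < N.+1) (1 - Q%:R^-1) ^+ (i + j)
    * avg i (fun u => avg j (fun v => Gram (sites M Z) site_heat (x + pos u) (x + pos v)))
  <= 2688 * Num.sqrt Q%:R.
Proof.
move=> uZ Q1; set rho := 1 - _.
have Q0' : 0 < Q%:R :> R by rewrite ltr0n; lia.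
have rho0 : 0 <= rho by rewrite subr_ge0 invf_le1 // ler1n; lia.
have rho1 : rho <= 1 by rewrite /rho gerBl invr_ge0 ltW.
pose F i := rho ^+ i * (448 / (i.+1%:R * Num.sqrt i.+1%:R)) : R.
have F0 i : 0 <= F i by rewrite mulr_ge0 ?exprn_ge0 ?divr_ge0 ?mulr_ge0 ?sqrtr_ge0 ?ler0n.
apply: (@le_trans _ _ (\sum_(i < N.+1) \sum_(j < N.+1) ((j <= i)%:R * F i + (i <= j)%:R * F j))).
  apply: ler_sum => i _; apply: ler_sum => j _.
  apply: (@le_trans _ _ (F (maxn i j))).
    apply: ler_pM; rewrite ?exprn_ge0 ?avg_Gram //.
      apply: avg_ge0 => u _; apply: avg_ge0 => v _; apply: Gram_ge0 => *.
      exact: site_heat_ge0.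
    by rewrite ler_wiXn2l //; lia.
  case: (leqP i j) => ij; first by rewrite mul1r lerDr mulr_ge0.
  by rewrite (ltnW ij) mul1r lerDl mul0r.
rewrite (eq_bigr (fun i : 'I_N.+1 => \sum_(j < N.+1) (j <= i)%:R * F i + \sum_(j < N.+1) (i <= j)%:R * F j)); last first.
  by move=> i _; rewrite big_split.
rewrite big_split /= [X in _ + X]exchange_big /=.
have E (i : 'I_N.+1) : \sum_(j < N.+1) (j <= i)%:R * F i = 448 * (rho ^+ i / Num.sqrt i.+1%:R).
  rewrite -mulr_suml -natr_sum.
  have -> : (\sum_(j < N.+1) (j <= i) = i.+1)%N.
    rewrite -(big_mkcond (fun j : 'I_N.+1 => (j <= i)%N) (fun=> 1%N)) /=.
    rewrite -(big_ord_widen N.+1 (fun=> 1%N) (ltn_ord i)) sum1_card card_ord //.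
  rewrite /F; have i0 : i.+1%:R != 0 :> R by rewrite pnatr_eq0.
  rewrite invfM; set a := _%:R in i0 *; set b := Num.sqrt _.
  by rewrite -[RHS]mul1r -(mulfV i0); ring.
rewrite (eq_bigr _ (fun i _ => E i)) -mulr_sumr.
have := sum_geom_sqrt N.+1 (ltnW Q1); rewrite -/rho; lra.
Qed.

(** The Green function up to an even horizon, since the Gram kernel produces the times [2 l] and
    [2 l + 1] in pairs. *)
Definition green M d : R := \sum_(l < M.*2) heat l d.

Lemma green_ge0 M d : 0 <= green M d.
Proof. by apply: sumr_ge0 => l _; exact: heat_ge0. Qed.

Lemma greenN M d : green M (- d) = green M d.
Proof. by apply: eq_bigr => l _; rewrite heatN. Qed.

Lemma green_le_Gram M Z x y : uniq Z ->
  (forall v, (size v <= M)%N -> y - pos v \in Z) ->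
  green M (x - y) <= Gram (sites M Z) site_heat x y.
Proof.
move=> uZ yZ.
have -> : green M (x - y) = \sum_(l < M) (heat (l + l) (x - y) + heat (l + l.+1) (x - y)).
  rewrite /green; elim: (M) => [|m IH]; first by rewrite !big_ord0.
  by rewrite doubleS !big_ord_recr /= IH -addrA -addnn addnS.
rewrite /Gram /sites big_allpairs_dep /= -[X in iota 0 X]subn0 -/(index_iota 0 M) big_mkord.
apply: ler_sum => l _.
rewrite !(@heat_conv _ _ _ _ Z) //; try by move=> v sv; apply: yZ; rewrite sv // ltnW.
rewrite -big_split /=; apply: ler_sum => z _; rewrite /site_heat /=.
have := heat_ge0 R l (x - z); have := heat_ge0 R l (y - z).
have := heat_ge0 R l.+1 (x - z); have := heat_ge0 R l.+1 (y - z).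
set a := heat _ _; set b := heat _ _; set c := heat _ _; set d := heat _ _.
by move=> a0 b0 c0 d0; nra.
Qed.

Definition reach L : seq 'rV[int]_5 :=
  undup (flatten [seq [seq pos (tval t) | t <- enum {: k.-tuple step}] | k <- iota 0 L.+1]).

Lemma mem_reach L w : (size w <= L)%N -> pos w \in reach L.
Proof.
move=> wL; rewrite mem_undup; apply/flattenP.
exists [seq pos (tval t) | t <- enum {: (size w).-tuple step}].
  by apply/mapP; exists (size w) => //; rewrite mem_iota add0n ltnS.
by apply/mapP; exists (in_tuple w) => //; rewrite mem_enum.
Qed.

(* [448] from [avg_Gram], [3] from [sum_geom_sqrt], and [2] for the symmetry in
   the two indices. *)
Definition green_const : R := 2688.

Lemma green_const_ge1 : 1 <= green_const.
Proof. by rewrite ler1n. Qed.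

(** Seen from the junction of the two pieces, the first one run backwards is again a simple walk:
    reversing the word and flipping its letters turns the sum into that of [cross_moment]. [Q] stays
    free and is adapted to [k] in [chi_moment]. *)
Lemma green_moment k M n1 n2 Q : (1 < Q)%N ->
  avg n1 (fun u => avg n2 (fun v => (\sum_(i < n1.+1) \sum_(j < n2.+1)
     green M (pos (drop i u) + pos (take j v))) ^+ k))
  <= (1 - Q%:R^-1) ^- (n1 + n2) * (k`!%:R ^+ 2 * (green_const * Num.sqrt Q%:R) ^+ k).
Proof.
move=> Q1; pose Z := reach (n2 + M); pose N := maxn n1 n2.
have uZ : uniq Z by rewrite undup_uniq.
have Q0' : 0 < Q%:R :> R by rewrite ltr0n; lia.
have rho0 : 0 < 1 - Q%:R^-1 :> R by rewrite subr_gt0 invf_lt1 // ltr1n.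
have rho1 : 1 - Q%:R^-1 <= 1 :> R by rewrite gerBl invr_ge0 ltW.
have HK x := @kappa_sites N M Z Q x uZ Q1.
apply: le_trans (cross_moment site_heat_ge0 rho0 rho1 HK k (leq_maxl _ _) (leq_maxr _ _)).
pose H u := avg n2 (fun v => (\sum_(i < n1.+1) \sum_(j < n2.+1)
   Gram (sites M Z) site_heat (pos (take i u)) (pos (take j v))) ^+ k).
rewrite -[leRHS]/(avg n1 H) -(avg_map n1 H flip_inj) -avg_rev.
apply: avg_le => u su; apply: avg_le => v sv.
apply: lerXn2r; rewrite ?nnegrE.
- by apply: sumr_ge0 => i _; apply: sumr_ge0 => j _; exact: green_ge0.
- apply: sumr_ge0 => i _; apply: sumr_ge0 => j _; apply: Gram_ge0 => *.
  exact: site_heat_ge0.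
rewrite (reindex_inj rev_ord_inj) /=; apply: ler_sum => i _; apply: ler_sum => j _.
have -> : pos (drop (n1.+1 - i.+1) (rev u)) = - pos (take i (map flip u)).
  rewrite -map_take pos_flip opprK subSS drop_rev pos_rev su subKn //.
  by rewrite -ltnS.
rewrite -greenN opprD opprK; apply: green_le_Gram => // v' v'M.
rewrite -pos_flip -pos_cat; apply: mem_reach; rewrite size_cat size_map size_take_min sv.
by rewrite leq_add // geq_minr.
Qed.

End GreenMoments.

(** * Moments of the capacity defect *)

Lemma bernoulli_le (R : realFieldType) (x : R) m : 0 <= x -> x <= 1 ->
  1 - m%:R * x <= (1 - x) ^+ m.
Proof.
move=> x0 x1; elim: m => [|m IH]; first by rewrite mul0r subr0 expr0.
rewrite exprS -natr1.
apply: (@le_trans _ _ ((1 - x) * (1 - m%:R * x))).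
  have : 0 <= m%:R :> R by []; move: (m%:R : R) => y y0; nra.
by apply: ler_wpM2l => //; rewrite subr_ge0.
Qed.

(** Bernoulli's inequality on the two halves of the exponent gives the factors [1/2] and [1/4]. *)
Lemma pow_inv_le (R : realFieldType) Q : (1 < Q)%N -> (1 - Q%:R^-1) ^- Q <= 8 :> R.
Proof.
move=> Q1; have Q0 : 2 <= Q%:R :> R by rewrite ler_nat.
have Qi : Q%:R * Q%:R^-1 = 1 :> R by rewrite mulfV // gt_eqF //; lra.
set x := Q%:R^-1 in Qi *.
have x0 : 0 < x by rewrite invr_gt0; lra.
have x1 : x <= 2^-1 by rewrite lef_pV2 ?posrE //; lra.
have H1 : 2^-1 <= (1 - x) ^+ Q./2.
  apply: le_trans (bernoulli_le _ _ _); [|lra|lra].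
  have : (Q./2)%:R * 2 <= Q%:R :> R by rewrite -natrM ler_nat; lia.
  move: (_%:R : R) => y; nra.
have H2 : 4^-1 <= (1 - x) ^+ (uphalf Q).
  apply: le_trans (bernoulli_le _ _ _); [|lra|lra].
  have : (uphalf Q)%:R * 2 <= Q%:R + 1 :> R by rewrite -natrM natr1 ler_nat; lia.
  move: (_%:R : R) => y; nra.
have E : (1 - x) ^+ Q = (1 - x) ^+ Q./2 * (1 - x) ^+ (uphalf Q).
  by rewrite -exprD; congr (_ ^+ _); lia.
have H3 : 8^-1 <= (1 - x) ^+ Q.
  rewrite E; apply: le_trans (ler_pM _ _ H1 H2); rewrite ?invr_ge0 //; lra.
by rewrite -[8]invrK lef_pV2 ?posrE ?invr_gt0 ?exprn_gt0 //; lra.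
Qed.

Lemma leq_fact a b : (a <= b)%N -> (a`! <= b`!)%N.
Proof.
elim: b => [|b IH]; first by rewrite leqn0 => /eqP ->.
rewrite leq_eqVlt => /predU1P [-> //|]; rewrite ltnS => /IH H.
by rewrite factS; apply: leq_trans H _; rewrite leq_pmull.
Qed.

Lemma fact_le_expn q : (q`! <= q ^ q)%N.
Proof.
have H k : (k <= q)%N -> (k`! <= q ^ k)%N.
  elim: k => [|k IH] kq; first by rewrite expn0.
  by rewrite factS expnS leq_mul // IH // ltnW.
exact: H.
Qed.

Lemma fact_add_ge a b : (a`! * b`! <= (a + b)`!)%N.
Proof.
have := bin_fact (leq_addr b a); rewrite addKn => <-.
by rewrite leq_pmull // bin_gt0 leq_addr.
Qed.

Lemma fact_double_le q : ((2 * q)`! <= 4 ^ q * (q`! * q`!))%N.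
Proof.
elim: q => [//|q IH]; rewrite mulnS -[(2 + _)%N]/((2 * q).+2) !factS expnS; nia.
Qed.

Lemma expn_le_fact q : (q ^ q <= (2 * q)`!)%N.
Proof.
have H k : (q ^ k <= (q + k)`!)%N.
  elim: k => [|k IH]; first by rewrite expn0 fact_gt0.
  by rewrite expnS addnS factS leq_mul //; lia.
by rewrite mul2n -addnn.
Qed.

(** One of the two factors is at most [4^q q! q!]; then [q! <= q^q] and [(2q)! q! <= (3q)!]. The
    power [q^q] is compensated by [Q^q], close to [(n / q)^q], in [chi_moment]. *)
Lemma fact_sqr_le q : ((2 * q)`! ^ 2 <= 4 ^ q * q ^ q * (3 * q)`!)%N.
Proof.
rewrite expnS expn1.
apply: (@leq_trans ((2 * q)`! * (4 ^ q * (q`! * q`!)))).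
  by rewrite leq_mul2l fact_double_le orbT.
have H1 := fact_le_expn q; have H2 := fact_add_ge (2 * q) q.
rewrite (_ : 3 * q = 2 * q + q)%N; last lia.
rewrite (_ : (2 * q)`! * (4 ^ q * (q`! * q`!)) = 4 ^ q * q`! * ((2 * q)`! * q`!))%N; last by lia.
by rewrite leq_mul // leq_mul2l H1 orbT.
Qed.

Lemma leq_divn_double n q : (0 < q)%N -> (1 < n %/ q)%N ->
  (n <= n %/ q * (2 * q))%N.
Proof. by move=> q0; have := divn_eq n q; have := ltn_pmod n q0; nia. Qed.

Section CrossTerm.
Variables (R : realType) (c : seq step -> R).
Hypothesis c_ge0 : forall w, 0 <= c w.
Hypothesis c_le : forall w, c w <= (size w).+1%:R.

Definition chi u v : R := c u + c v - c (u ++ v).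

Hypothesis chi_ge0 : forall u v, 0 <= chi u v.
Hypothesis chi_green : forall n1 n2, exists M, forall u v,
  size u = n1 -> size v = n2 ->
  chi u v <= 2 * (\sum_(i < n1.+1) \sum_(j < n2.+1)
     green R M (pos (drop i u) + pos (take j v))) + 1.

(** [256 = 64 * 4], with 64 from removing the geometric weights and 4 from [fact_sqr_le];
    [32 = 2 * 16], with 16 from [(2 * 2 X)^(2q)] and 2 for the additive 1 in [chi_green]. *)
Definition chi_const : R := 32 * (256 * green_const R ^+ 2).

Lemma chi_moment n1 n2 q : (0 < n1 + n2)%N ->
  avg n1 (fun u => avg n2 (fun v => chi u v ^+ (2 * q)))
  <= chi_const ^+ q * (3 * q)`!%:R * (n1 + n2)%:R ^+ q.
Proof.
set n := (n1 + n2)%N => n0.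
have [->|q0] := posnP q.
  rewrite !muln0 !expr0 fact0 !mulr1.
  rewrite (@avg_ext _ _ _ _ (fun=> 1)) ?avg_const ?card_step // => u _.
  by rewrite (@avg_ext _ _ _ _ (fun=> 1)) ?avg_const ?card_step // => v _; rewrite expr0.
have n0' : 0 < n%:R :> R by rewrite ltr0n.
have B1 : 1 <= green_const R ^+ 2 by rewrite exprn_ege1 // green_const_ge1.
have [B EB] : exists B : R, green_const R ^+ 2 = B by exists (green_const R ^+ 2).
rewrite EB in B1; have B0 : 0 <= B by lra.
have EC : chi_const = 32 * (256 * B) by rewrite /chi_const EB.
have [C ECC] : exists C : R, chi_const = C by exists chi_const.
rewrite ECC in EC *.
have C0 : 18 <= C by lra.
have f1 : 1 <= (3 * q)`!%:R :> R by rewrite ler1n fact_gt0.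
(* For short words [Q = n %/ q] would not exceed 1, but there the trivial bound [chi <= 3 n] is
   enough, because [n^q <= (2q)^q]. *)
case: (ltnP n (2 * q)) => [nq|qn].
  apply: (@le_trans _ _ (18 ^+ q * (3 * q)`!%:R * n%:R ^+ q)); last first.
    apply: ler_wpM2r; first by rewrite exprn_ge0.
    by apply: ler_wpM2r; rewrite ?ler0n //; apply: lerXn2r; rewrite ?nnegrE //; lra.
  apply: avg_le_const; first by rewrite card_step.
  move=> u su; apply: avg_le_const; first by rewrite card_step.
  move=> v sv.
  have H1 : chi u v <= 3 * n%:R.
    have := c_le u; have := c_le v; have := c_ge0 (u ++ v); rewrite su sv /chi.
    have : 1 <= n%:R :> R by rewrite ler1n.
    by rewrite /n natrD -!natr1; lra.
  apply: (@le_trans _ _ ((3 * n%:R) ^+ (2 * q))).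
    by apply: lerXn2r; rewrite ?nnegrE // mulr_ge0.
  rewrite exprMn !exprM [n%:R ^+ 2]expr2 exprMn mulrA; apply: ler_wpM2r; first by rewrite exprn_ge0.
  apply: (@le_trans _ _ (9 ^+ q * (2 * q)%:R ^+ q)).
    rewrite (_ : 3 ^+ 2 = 9); last by ring.
    apply: ler_wpM2l; first by rewrite exprn_ge0.
    by apply: lerXn2r; rewrite ?nnegrE // ler_nat ltnW.
  rewrite natrM exprMn mulrA -exprMn (_ : 9 * 2 = 18); last by ring.
  apply: ler_wpM2l; first by rewrite exprn_ge0.
  rewrite -natrX ler_nat; apply: leq_trans (expn_le_fact q) _.
  by apply: leq_fact; rewrite leq_mul2r orbT.
(* With this choice [n <= 2 q Q], so that the weights cost at most [8^(2q) = 64^q], while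
   [(sqrt Q)^(2q)] is at most [(n / q)^q]. *)
pose Q := (n %/ q)%N.
have Q1 : (1 < Q)%N by rewrite /Q leq_divRL.
have [M HM] := chi_green n1 n2.
pose X u v := \sum_(i < n1.+1) \sum_(j < n2.+1) green R M (pos (drop i u) + pos (take j v)).
have X0 u v : 0 <= X u v by apply: sumr_ge0 => i _; apply: sumr_ge0 => j _; exact: green_ge0.
have HX : avg n1 (fun u => avg n2 (fun v => X u v ^+ (2 * q)))
   <= (256 * B) ^+ q * (3 * q)`!%:R * n%:R ^+ q.
  apply: le_trans (green_moment R (2 * q) M n1 n2 Q1) _.
  have Q0' : 0 < Q%:R :> R by rewrite ltr0n ltnW.
  have rho0 : 0 < 1 - Q%:R^-1 :> R by rewrite subr_gt0 invf_lt1 // ltr1n.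
  have rho1 : 1 - Q%:R^-1 <= 1 :> R by rewrite gerBl invr_ge0 ltW.
  have nQ : (n <= Q * (2 * q))%N by apply: leq_divn_double.
  have H1 : (1 - Q%:R^-1) ^- n <= 64 ^+ q :> R.
    apply: (@le_trans _ _ ((1 - Q%:R^-1) ^- (Q * (2 * q)))).
      rewrite lef_pV2 ?posrE ?exprn_gt0 //.
      by apply: ler_wiXn2l => //; exact: ltW.
    rewrite exprM -exprVn (_ : 64 = 8 ^+ 2); last by ring.
    rewrite -exprM; apply: lerXn2r; rewrite ?nnegrE ?invr_ge0 ?exprn_ge0 ?(ltW rho0) //.
    exact: pow_inv_le.
  have H2 : (green_const R * Num.sqrt Q%:R) ^+ (2 * q) * q%:R ^+ q <= B ^+ q * n%:R ^+ q.
    rewrite [_ ^+ (2 * q)]exprM [(green_const R * _) ^+ 2]exprMn EB sqr_sqrtr ?ler0n //.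
    rewrite [(B * _) ^+ q]exprMn -mulrA; apply: ler_wpM2l; first by rewrite exprn_ge0.
    rewrite -exprMn -natrM; apply: lerXn2r; rewrite ?nnegrE // ler_nat.
    by rewrite /Q leq_divM.
  have H3 : (2 * q)`!%:R ^+ 2 <= 4 ^+ q * q%:R ^+ q * (3 * q)`!%:R :> R.
    by rewrite -!natrX -!natrM ler_nat fact_sqr_le.
  set s := (green_const R * _) ^+ _ in H2 *; set r := (1 - _) ^- _ in H1 *.
  have s0 : 0 <= s.
    by rewrite exprn_ge0 // mulr_ge0 ?sqrtr_ge0 // (le_trans ler01) ?green_const_ge1.
  have r0 : 0 <= r by rewrite invr_ge0 exprn_ge0 // ltW.
  apply: (@le_trans _ _ (64 ^+ q * (4 ^+ q * q%:R ^+ q * (3 * q)`!%:R * s))).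
    apply: ler_pM => //; first by rewrite mulr_ge0 ?sqr_ge0.
    by apply: ler_wpM2r.
  rewrite (_ : 64 ^+ q * _ = (64 ^+ q * 4 ^+ q) * (3 * q)`!%:R * (s * q%:R ^+ q)); last by ring.
  rewrite (_ : _ * n%:R ^+ q = (256 ^+ q) * (3 * q)`!%:R * (B ^+ q * n%:R ^+ q)); last first.
    by rewrite exprMn; ring.
  rewrite -exprMn (_ : 64 * 4 = 256); last by ring.
  by apply: (ler_wpM2l _ H2); rewrite mulr_ge0 ?exprn_ge0 ?ler0n.
apply: (@le_trans _ _ (avg n1 (fun u => avg n2 (fun v => 16 ^+ q * X u v ^+ (2 * q) + 4 ^+ q)))).
  apply: avg_le => u su; apply: avg_le => v sv.
  have Hc : chi u v <= 2 * Num.max (2 * X u v) 1.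
    apply: le_trans (HM _ _ su sv) _; rewrite -/(X u v).
    have : 2 * X u v <= Num.max (2 * X u v) 1 by rewrite le_max lexx.
    have : 1 <= Num.max (2 * X u v) 1 by rewrite le_max lexx orbT.
    by lra.
  apply: (@le_trans _ _ ((2 * Num.max (2 * X u v) 1) ^+ (2 * q))).
    apply: lerXn2r; rewrite ?nnegrE // mulr_ge0 // le_max mulr_ge0 //.
  have -> : 16 ^+ q = 4 ^+ q * 4 ^+ q :> R by rewrite -exprMn; congr (_ ^+ _); ring.
  rewrite exprMn exprM (_ : 2 ^+ 2 = 4); last by ring.
  case: (lerP (2 * X u v) 1) => H.
    by rewrite expr1n mulr1 lerDr !mulr_ge0 ?exprn_ge0.
  rewrite exprMn exprM (_ : 2 ^+ 2 = 4); last by ring.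
  by rewrite -mulrA lerDl exprn_ge0.
rewrite (@avg_ext _ _ _ _ (fun u => 16 ^+ q * avg n2 (fun v => X u v ^+ (2 * q)) + 4 ^+ q)); last first.
  by move=> u _; rewrite avgD avgZ avg_const ?card_step.
rewrite avgD avgZ avg_const ?card_step //.
apply: (@le_trans _ _ (16 ^+ q * ((256 * B) ^+ q * (3 * q)`!%:R * n%:R ^+ q) + 4 ^+ q)).
  by rewrite lerD2r; apply: ler_wpM2l => //; rewrite exprn_ge0.
have H4 : 4 ^+ q <= 16 ^+ q * ((256 * B) ^+ q * (3 * q)`!%:R * n%:R ^+ q).
  have G1 : 4 ^+ q <= 16 ^+ q :> R by apply: lerXn2r; rewrite ?nnegrE ?ler_nat // ler0n.
  have G2 : 1 <= (256 * B) ^+ q by rewrite exprn_ege1 //; lra.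
  have G3 : 1 <= n%:R ^+ q :> R by rewrite exprn_ege1 // ler1n.
  rewrite -[leLHS]mulr1; apply: ler_pM; rewrite ?exprn_ge0 //.
  rewrite -[leLHS]mulr1; apply: ler_pM => //; rewrite -[leLHS]mulr1; exact: ler_pM.
set Z := 16 ^+ q * _ in H4 *.
apply: (@le_trans _ _ (2 * Z)); first by lra.
have -> : C = 2 * (16 * (256 * B)) by rewrite EC; ring.
rewrite exprMn exprMn /Z -!mulrA; apply: ler_wpM2r.
  by rewrite ?mulr_ge0 ?exprn_ge0 ?mulr_ge0 ?ler0n.
by rewrite -[leLHS]expr1; apply: ler_weXn2l; rewrite ?ler1n.
Qed.

End CrossTerm.

(** * Dyadic levels *)

(** For [y > 0] the inequality [expR y <= 1 + y * expR y] is used twice; for [y <= 0] the bound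
    follows from [expR y <= 1 / (1 - y)]. *)
Lemma expR_le_quad (R : realType) (y : R) :
  expR y <= 1 + y + y ^+ 2 * expR (Num.max y 0).
Proof.
case: (lerP y 0) => y0.
  rewrite expR0 mulr1.
  have H : 1 - y <= expR (- y) by exact: expR_ge1Dx.
  have E : expR y = (expR (- y))^-1 by rewrite expRN invrK.
  rewrite E; apply: (@le_trans _ _ (1 - y)^-1).
    by rewrite lef_pV2 ?posrE ?expR_gt0 //; lra.
  rewrite -[leLHS]mul1r ler_pdivrMr; last by lra.
  have : 0 <= (- y) ^+ 3 by rewrite exprn_ge0 ?oppr_ge0.
  by rewrite !exprS expr0; nra.
have H : 1 - y <= expR (- y) by exact: expR_ge1Dx.
have e0 := expR_gt0 y.
have E : expR (- y) * expR y = 1 by rewrite -expRD addNr expR0.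
have H2 : expR y <= 1 + y * expR y by nra.
by nra.
Qed.

Lemma sum_half_le (R : realFieldType) K : \sum_(k < K) (2^-1 : R) ^+ k <= 2.
Proof.
suff -> : \sum_(k < K) (2^-1 : R) ^+ k = 2 - 2 * 2^-1 ^+ K.
  by rewrite gerBl mulr_ge0 ?exprn_ge0 ?invr_ge0.
elim: K => [|K IH]; first by rewrite big_ord0 expr0; ring.
by rewrite big_ord_recr /= IH exprS; field.
Qed.

Section Mgf.
Variables (R : realType) (A : finType).
Hypothesis A_gt0 : (0 < #|A|)%N.
Notation avg := (@avg R A).

Lemma avg_cvg n (u : nat -> seq A -> R) (l : seq A -> R) :
  (forall w, size w = n -> (fun K => u K w) @ \oo --> l w) ->
  (fun K => avg n (u K)) @ \oo --> avg n l.
Proof.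
elim: n u l => [|n IH] u l ul /=; first exact: ul.
apply: cvgMr; apply: cvg_big => [|a _]; first exact: add_continuous.
by apply: IH => w sw; apply: ul; rewrite /= sw.
Qed.

Definition mgf_const : R := 16 * 6 ^+ 6.

Lemma mgf_const_ge0 : 0 <= mgf_const.
Proof. by rewrite mulr_ge0 ?exprn_ge0. Qed.

(** The moments of [r] are those of the cube of an exponential variable, so [z], at most
    [(a r)^(1/3)], has exponential moments when [a * C] is small. The series is bounded term by
    term, [z^k] being at most the sum of the two neighbouring powers whose exponents are multiples
    of 3. *)
Lemma mgf_cubic n (r z : seq A -> R) (a C : R) :
  0 <= a -> 0 < C -> a * C <= 2^-1 ^+ 10 ->
  (forall w, 0 <= r w) -> (forall w, 0 <= z w) ->
  (forall w, z w ^+ 3 <= a * r w) ->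
  (forall q, avg n (fun w => r w ^+ q) <= C ^+ q * (3 * q)`!%:R) ->
  avg n (fun w => r w * expR (z w)) <= mgf_const * C.
Proof.
move=> a0 C0 aC r0 z0 zr rq.
have [N1024 EN2] : exists x : R, x = 2^-1 ^+ 10 by exists (2^-1 ^+ 10).
rewrite -EN2 in aC.
have cv : (fun K => avg n (fun w => r w * \sum_(k < K) z w ^+ k / k`!%:R)) @ \oo
   --> avg n (fun w => r w * expR (z w)).
  apply: avg_cvg => w _; apply: cvgMr.
  have -> : (fun K : nat => \sum_(k < K) z w ^+ k / k`!%:R) = series (exp_coeff (z w)).
    by apply/funext => K; rewrite /series /= big_mkord.
  exact: is_cvg_series_exp_coeff.
apply: (cvgr_to_le cv); near=> K.
have term k : avg n (fun w => r w * (z w ^+ k / k`!%:R)) <= 8 * 6 ^+ 6 * C * 2^-1 ^+ k.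
  pose q := (k %/ 3)%N.
  have kq : k = (3 * q + k %% 3)%N by rewrite mulnC -divn_eq.
  have t3 : (k %% 3 < 3)%N by rewrite ltn_pmod.
  set t := (k %% 3)%N in kq t3.
  have pw w : r w * z w ^+ k <= a ^+ q * r w ^+ q.+1 + a ^+ q.+1 * r w ^+ q.+2.
    have zk : z w ^+ k <= z w ^+ (3 * q) + z w ^+ (3 * q.+1).
      rewrite kq; case: (lerP (z w) 1) => z1.
        apply: le_trans (_ : z w ^+ (3 * q) <= _); last by rewrite lerDl exprn_ge0.
        by apply: ler_wiXn2l => //; rewrite leq_addr.
      apply: le_trans (_ : z w ^+ (3 * q.+1) <= _); last by rewrite lerDr exprn_ge0.
      by apply: ler_weXn2l; [exact: ltW|rewrite mulnS addnC leq_add2r ltnW].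
    have Z p : z w ^+ (3 * p) <= a ^+ p * r w ^+ p.
      by rewrite exprM -exprMn; apply: lerXn2r; rewrite ?nnegrE ?exprn_ge0 ?mulr_ge0.
    apply: (@le_trans _ _ (r w * (a ^+ q * r w ^+ q + a ^+ q.+1 * r w ^+ q.+1))).
      by apply: ler_wpM2l => //; apply: le_trans zk _; apply: lerD.
    by rewrite le_eqVlt mulrDr mulrCA -exprS mulrCA -exprS eqxx.
  apply: (@le_trans _ _ ((a ^+ q * (C ^+ q.+1 * (3 * q.+1)`!%:R)
      + a ^+ q.+1 * (C ^+ q.+2 * (3 * q.+2)`!%:R)) / (3 * q)`!%:R)).
    apply: (@le_trans _ _ (avg n (fun w => (a ^+ q * r w ^+ q.+1 + a ^+ q.+1 * r w ^+ q.+2) / (3 * q)`!%:R))).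
      apply: avg_le => w _; rewrite mulrA; apply: ler_pM => //.
      - by rewrite mulr_ge0 // exprn_ge0.
      - rewrite lef_pV2 ?posrE ?ltr0n ?fact_gt0 // ler_nat leq_fact // kq leq_addr //.
    rewrite avgZr avgD !avgZ; apply: ler_wpM2r; first by rewrite invr_ge0.
    by apply: lerD; apply: ler_wpM2l; rewrite ?exprn_ge0.
  have E1 : a ^+ q * (C ^+ q.+1 * (3 * q.+1)`!%:R) <= C * (a * C) ^+ q * (3 * q.+2)`!%:R.
    rewrite exprS exprMn (_ : a ^+ q * _ = C * (a ^+ q * C ^+ q) * (3 * q.+1)`!%:R); last by ring.
    apply: ler_wpM2l; first by rewrite !mulr_ge0 ?exprn_ge0 // ltW.
    by rewrite ler_nat leq_fact // leq_mul2l leqnSn orbT.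
  have E2 : a ^+ q.+1 * (C ^+ q.+2 * (3 * q.+2)`!%:R) <= C * (a * C) ^+ q * (3 * q.+2)`!%:R.
    rewrite !exprS exprMn (_ : a * _ * _ = (a * C) * (C * (a ^+ q * C ^+ q) * (3 * q.+2)`!%:R)); last by ring.
    rewrite ler_piMl //; first by rewrite !mulr_ge0 ?exprn_ge0 // ltW.
    by apply: le_trans aC _; rewrite EN2 exprn_ile1 ?invr_ge0 // invf_le1 // ler1n.
  have E3 : (3 * q.+2)`!%:R / (3 * q)`!%:R <= 6 ^+ 6 * (2 ^+ 6) ^+ q :> R.
    rewrite ler_pdivrMr ?ltr0n ?fact_gt0 // -!natrX -!natrM ler_nat.
    rewrite (_ : 3 * q.+2 = (3 * q + 6))%N; last by rewrite 2!mulnS addnA [LHS]addnC.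
    have q2 : (q.+2 <= 2 * 2 ^ q)%N by rewrite -expnS; exact: ltn_expl.
    have H m : (m < 6)%N -> ((3 * q + m).+1 <= 6 * 2 ^ q)%N.
      move=> m6; apply: (@leq_trans (3 * q.+2)%N); last by rewrite (_ : 6 = 3 * 2)%N // -mulnA leq_mul2l q2.
      by rewrite 2!mulnS; lia.
    have H2 m : (m <= 6)%N -> ((3 * q + m)`! <= (6 * 2 ^ q) ^ m * (3 * q)`!)%N.
      elim: m => [|m IH] m6; first by rewrite addn0 expn0 mul1n.
      rewrite addnS factS expnS -mulnA leq_mul ?H ?IH //; exact: ltnW.
    apply: leq_trans (H2 6 _) _ => //.
    by rewrite expnMn -!expnM [(q * 6)%N]mulnC.
  (* The [2^-10] of the hypothesis beats the [2^6] of the factorial ratio by [2^-4] per unit of [q]: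
     three halvings match [3 q], and the constant 4 covers the remainder of [k] modulo 3. *)
  have E4 : (2 ^+ 6) ^+ q * (a * C) ^+ q <= 4 * 2^-1 ^+ k :> R.
    rewrite -exprMn; apply: (@le_trans _ _ ((2^-1 ^+ 4) ^+ q)).
      apply: lerXn2r; rewrite ?nnegrE ?mulr_ge0 ?exprn_ge0 ?invr_ge0 // ?(ltW C0) //.
      apply: (@le_trans _ _ (2 ^+ 6 * N1024)); first by apply: ler_wpM2l => //; rewrite exprn_ge0.
      by rewrite EN2 le_eqVlt; apply/orP; left; apply/eqP; field.
    rewrite -exprM kq (_ : (4 * q) = 3 * q + q)%N; last by lia.
    rewrite (exprD _ _ q) (exprD _ _ t) [leRHS]mulrCA ler_pM2l ?exprn_gt0 ?invr_gt0 //.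
    apply: (@le_trans _ _ 1); first by rewrite exprn_ile1 ?invr_ge0 // invf_le1 // ler1n.
    by move: t3 {kq}; case: t => [|[|[|]]] //= _; rewrite ?expr0 ?expr1 ?expr2; lra.
  apply: (@le_trans _ _ (2 * (C * (a * C) ^+ q * (3 * q.+2)`!%:R) / (3 * q)`!%:R)).
    apply: ler_wpM2r; first by rewrite invr_ge0.
    by rewrite mulr_natl mulr2n lerD.
  rewrite (_ : 2 * _ / _ = 2 * C * (a * C) ^+ q * ((3 * q.+2)`!%:R / (3 * q)`!%:R)); last by rewrite !mulrA.
  apply: (@le_trans _ _ (2 * C * (a * C) ^+ q * (6 ^+ 6 * (2 ^+ 6) ^+ q))).
    by apply: ler_wpM2l; rewrite // !mulr_ge0 ?exprn_ge0 ?mulr_ge0 // ltW.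
  rewrite (_ : 8 * 6 ^+ 6 * C * 2^-1 ^+ k = 2 * C * 6 ^+ 6 * (4 * 2^-1 ^+ k)); last by ring.
  rewrite (_ : 2 * C * (a * C) ^+ q * (6 ^+ 6 * (2 ^+ 6) ^+ q) = 2 * C * 6 ^+ 6 * ((2 ^+ 6) ^+ q * (a * C) ^+ q)); last by ring.
  by apply: ler_wpM2l E4; rewrite !mulr_ge0 ?exprn_ge0 // ltW.
rewrite (@avg_ext _ _ _ _ (fun w => \sum_(k < K) r w * (z w ^+ k / k`!%:R))); last first.
  by move=> w _; rewrite mulr_sumr.
rewrite avg_sum; apply: (@le_trans _ _ (\sum_(k < K) 8 * 6 ^+ 6 * C * 2^-1 ^+ k)).
  by apply: ler_sum => k _; exact: term.
rewrite -mulr_sumr (_ : mgf_const * C = 8 * 6 ^+ 6 * C * 2); last by rewrite /mgf_const; ring.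
by apply: ler_wpM2l (sum_half_le _ _); rewrite !mulr_ge0 ?exprn_ge0 // ltW.
Unshelve. all: by end_near.
Qed.

(** Only values above [H] are replaced by 0, which lowers the mean. For the positive part
    [(s g)^3 <= s^3 H g^2], so [mgf_cubic] controls the remainder of [expR_le_quad] with
    [r = g^2 / rho^2]. *)
Lemma trunc_mgf n (g : seq A -> R) (rho C H s : R) :
  0 < rho -> 0 < C -> 0 <= H -> 0 <= s ->
  avg n g <= 0 ->
  (forall q, avg n (fun w => g w ^+ (2 * q)) <= C ^+ q * (3 * q)`!%:R * (rho ^+ 2) ^+ q) ->
  s ^+ 3 * H * rho ^+ 2 * C <= 2^-1 ^+ 10 ->
  avg n (fun w => expR (s * (if g w <= H then g w else 0)))
    <= expR (mgf_const * C * (s ^+ 2 * rho ^+ 2)).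
Proof.
move=> rho0 C0 H0 s0 g0 gq sH.
pose gt w := if g w <= H then g w else 0.
pose z w := s * (if 0 <= g w <= H then g w else 0).
pose r w := g w ^+ 2 / rho ^+ 2.
have rho20 : 0 < rho ^+ 2 by rewrite exprn_gt0.
apply: (@le_trans _ _ (avg n (fun w => 1 + s * g w + s ^+ 2 * rho ^+ 2 * (r w * expR (z w))))).
  apply: avg_le => w _; apply: le_trans (expR_le_quad _) _.
  have -> : Num.max (s * (if g w <= H then g w else 0)) 0 = z w.
    rewrite /z; case: (lerP (g w) H) => gH; last by rewrite andbF mulr0 maxxx.
    rewrite andbT; case: (lerP 0 (g w)) => g0'; first by rewrite max_l // mulr_ge0.
    by rewrite mulr0 max_r // mulr_ge0_le0 // ltW.
  have -> : s ^+ 2 * rho ^+ 2 * (r w * expR (z w)) = s ^+ 2 * g w ^+ 2 * expR (z w).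
    by rewrite /r; field; rewrite gt_eqF.
  apply: lerD.
    rewrite lerD2l; apply: ler_wpM2l => //; case: (lerP (g w) H) => // gH.
    exact: ltW (le_lt_trans H0 gH).
  apply: ler_wpM2r; first exact: expR_ge0.
  rewrite exprMn; apply: ler_wpM2l; first exact: sqr_ge0.
  by case: ifP => // _; rewrite expr0n /= sqr_ge0.
rewrite !avgD !avgZ avg_const //.
apply: (@le_trans _ _ (1 + mgf_const * C * (s ^+ 2 * rho ^+ 2))); last exact: expR_ge1Dx.
apply: lerD; first by rewrite gerDl mulr_ge0_le0.
rewrite mulrC; apply: ler_wpM2r; first by rewrite mulr_ge0 ?sqr_ge0.
apply: (@mgf_cubic n r z (s ^+ 3 * H * rho ^+ 2)) => //.
- by rewrite !mulr_ge0 ?exprn_ge0 // ltW.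
- by move=> w; rewrite divr_ge0 ?sqr_ge0.
- by move=> w; rewrite mulr_ge0 //; case: ifP => // /andP [].
- move=> w; rewrite (_ : _ * r w = s ^+ 3 * (H * g w ^+ 2)); last first.
    by rewrite /r; field; rewrite gt_eqF.
  rewrite exprMn; apply: ler_wpM2l; first by rewrite exprn_ge0.
  case: ifP => [/andP [g1 g2]|_]; last by rewrite expr0n /= mulr_ge0 ?sqr_ge0.
  by rewrite exprS; apply: ler_wpM2r; rewrite ?sqr_ge0.
move=> q; rewrite (@avg_ext _ _ _ _ (fun w => g w ^+ (2 * q) * (rho ^+ 2) ^- q)); last first.
  by move=> w _; rewrite /r expr_div_n exprM.
by rewrite avgZr ler_pdivrMr // exprn_gt0.
Qed.

(** Markov's inequality for the moment of order [2 q]: as [(3q)! <= (27 q^3)^q], the factor [expR 1]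
    in the threshold leaves [expR (- q)]. *)
Lemma moment_tail n (g : seq A -> R) (rho C : R) q :
  0 < rho -> 0 < C -> (0 < q)%N ->
  avg n (fun w => g w ^+ (2 * q)) <= C ^+ q * (3 * q)`!%:R * (rho ^+ 2) ^+ q ->
  avg n (fun w => (Num.sqrt (27 * expR 1 * C * q%:R ^+ 3) * rho < g w)%R%:R)
    <= expR (- q%:R).
Proof.
move=> rho0 C0 q0 gq; set K := 27 * expR 1 * C * q%:R ^+ 3.
have q0' : 0 < q%:R :> R by rewrite ltr0n.
have K0 : 0 < K by rewrite !mulr_gt0 ?expR_gt0 ?exprn_gt0.
set H := _ * rho; have H0 : 0 < H by rewrite mulr_gt0 // sqrtr_gt0.
apply: (@le_trans _ _ (avg n (fun w => g w ^+ (2 * q) / H ^+ (2 * q)))).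
  apply: avg_le => w _; case: (ltP H (g w)) => Hg.
    rewrite -expr_div_n exprn_ege1 // ler_pdivlMr // mul1r ltW //.
  by rewrite !exprM; apply: divr_ge0; rewrite exprn_ge0 // sqr_ge0.
rewrite avgZr ler_pdivrMr ?exprn_gt0 //; apply: le_trans gq _.
have -> : H ^+ (2 * q) = K ^+ q * (rho ^+ 2) ^+ q.
  by rewrite exprM /H [(_ * rho) ^+ 2]exprMn sqr_sqrtr ?(ltW K0) // exprMn.
rewrite mulrA.
apply: ler_wpM2r; first by rewrite exprn_ge0 ?sqr_ge0.
have -> : K ^+ q = 27 ^+ q * expR q%:R * C ^+ q * (q%:R ^+ 3) ^+ q.
  by rewrite /K 3!exprMn -expRM_natl mulr1.
set Z := (q%:R ^+ 3) ^+ q.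
have -> : expR (- q%:R) * (27 ^+ q * expR q%:R * C ^+ q * Z)
  = expR (- q%:R) * expR q%:R * (C ^+ q * (27 ^+ q * Z)) by ring.
rewrite -expRD addNr expR0 mul1r; apply: ler_wpM2l; first by rewrite exprn_ge0 // ltW.
apply: (@le_trans _ _ ((3 * q)%:R ^+ (3 * q))).
  by rewrite -natrX ler_nat fact_le_expn.
rewrite exprM natrM [(3%:R * _) ^+ 3]exprMn (_ : 3 ^+ 3 = 27); last by ring.
by rewrite exprMn.
Qed.

Fixpoint lev (j : nat) (g : seq A -> R) (w : seq A) : R :=
  if j is j'.+1 then
    lev j' g (take (size w)./2 w) + lev j' g (drop (size w)./2 w)
  else g w.

(* [m] is one of the at most two lengths of the blocks obtained by halving a
   word of length [n] [j] times. *)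
Definition blk (j n m : nat) : bool :=
  ((n < m.+1 * 2 ^ j) && (m * 2 ^ j < n + 2 ^ j))%N.

Lemma blk_half j n m : blk j n./2 m -> blk j.+1 n m.
Proof. by rewrite /blk !expnS; nia. Qed.

Lemma blk_uphalf j n m : blk j (n - n./2) m -> blk j.+1 n m.
Proof. by rewrite /blk !expnS; nia. Qed.

Lemma blk0 n : blk 0 n n.
Proof. by rewrite /blk expn0; lia. Qed.

Lemma avg_half n (F : seq A -> seq A -> R) :
  avg n (fun w => F (take (size w)./2 w) (drop (size w)./2 w))
  = avg n./2 (fun u => avg (n - n./2) (fun v => F u v)).
Proof.
have nE : n = (n./2 + (n - n./2))%N by lia.
rewrite (@avg_ext _ _ n _ (fun w => F (take n./2 w) (drop n./2 w))); last first.
  by move=> w ->.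
transitivity (avg (n./2 + (n - n./2)) (fun w => F (take n./2 w) (drop n./2 w))).
  by rewrite -nE.
rewrite avg_cat.
apply: avg_ext => u su; apply: avg_ext => v _.
by rewrite take_size_cat // drop_size_cat.
Qed.

Lemma levZ j g c w : lev j (fun u => c * g u) w = c * lev j g w.
Proof. by elim: j w => [//|j IH] w /=; rewrite !IH mulrDr. Qed.

Lemma levD j f g w : lev j (fun u => f u + g u) w = lev j f w + lev j g w.
Proof. by elim: j w => [//|j IH] w /=; rewrite !IH addrACA. Qed.

Lemma avg_lev_le j n (g : seq A -> R) B :
  (forall m, blk j n m -> avg m g <= B) -> avg n (lev j g) <= B *+ 2 ^ j.
Proof.
elim: j n => [|j IH] n gB; first by rewrite expn0 mulr1n; apply/gB/blk0.
rewrite /= (avg_half n (fun u v => lev j g u + lev j g v)).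
rewrite (@avg_ext _ _ _ _ (fun u => lev j g u + avg (n - n./2) (lev j g))); last first.
  by move=> u _; rewrite avgD avg_const.
rewrite avgD avg_const // expnS mul2n -addnn mulrnDr; apply: lerD; apply: IH => m.
  by move=> /blk_half/gB.
by move=> /blk_uphalf/gB.
Qed.

Lemma avg_expR_lev_le j n (g : seq A -> R) B : 0 <= B ->
  (forall m, blk j n m -> avg m (fun u => expR (g u)) <= B) ->
  avg n (fun w => expR (lev j g w)) <= B ^+ (2 ^ j).
Proof.
move=> B0; elim: j n => [|j IH] n gB; first by rewrite expn0 expr1; apply/gB/blk0.
rewrite /= (avg_half n (fun u v => expR (lev j g u + lev j g v))).
rewrite (@avg_ext _ _ _ _ (fun u => expR (lev j g u) * avg (n - n./2) (fun v => expR (lev j g v)))); last first.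
  by move=> u _; rewrite -avgZ; apply: avg_ext => v _; rewrite expRD.
rewrite avgZr expnS mul2n -addnn exprD; apply: ler_pM.
- by apply: avg_ge0 => w _; exact: expR_ge0.
- by apply: avg_ge0 => w _; exact: expR_ge0.
- by apply: IH => m /blk_half/gB.
- by apply: IH => m /blk_uphalf/gB.
Qed.

Lemma avg_expR_lev_ge j n (g : seq A -> R) B : 0 <= B ->
  (forall m, blk j n m -> B <= avg m (fun u => expR (g u))) ->
  B ^+ (2 ^ j) <= avg n (fun w => expR (lev j g w)).
Proof.
move=> B0; elim: j n => [|j IH] n gB; first by rewrite expn0 expr1; apply/gB/blk0.
rewrite /= (avg_half n (fun u v => expR (lev j g u + lev j g v))).
rewrite (@avg_ext _ _ _ _ (fun u => expR (lev j g u) * avg (n - n./2) (fun v => expR (lev j g v)))); last first.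
  by move=> u _; rewrite -avgZ; apply: avg_ext => v _; rewrite expRD.
rewrite avgZr expnS mul2n -addnn exprD; apply: ler_pM; rewrite ?exprn_ge0 //.
- by apply: IH => m /blk_half/gB.
- by apply: IH => m /blk_uphalf/gB.
Qed.

Lemma lev_ge0 j g w : (forall u, 0 <= g u) -> 0 <= lev j g w.
Proof. by move=> g0; elim: j w => [|j IH] w //=; rewrite addr_ge0. Qed.

(** Either no block is altered or the count of altered blocks is at least 1, so the mean of that
    count bounds the probability of the second case. *)
Lemma lev_change j (g g' k : seq A -> R) w :
  (forall u, 0 <= k u) -> (forall u, g u = g' u \/ 1 <= k u) ->
  lev j g w = lev j g' w \/ 1 <= lev j k w.
Proof.
move=> k0 gk; have ge0 i u : 0 <= lev i k u by exact: lev_ge0.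
elim: j w => [|j IH] w /=; first exact: gk.
case: (IH (take (size w)./2 w)) => [->|H1]; last by right; rewrite -[leLHS]addr0 lerD.
case: (IH (drop (size w)./2 w)) => [->|H1]; last by right; rewrite -[leLHS]add0r lerD.
by left.
Qed.

Lemma lev_trunc j (g : seq A -> R) H w (g' := fun u => if g u <= H then g u else 0) :
  lev j g w = lev j g' w \/ 1 <= lev j (fun u => (H < g u)%R%:R) w.
Proof.
apply: lev_change => u; first exact: ler0n.
by rewrite /g'; case: (lerP (g u) H); [left|right].
Qed.

(** Chosen so that [a0 <= 1] and [a0^3 * sqrt (27 e C) * C <= 2^-10], the smallness required by
    [trunc_mgf]. *)
Definition tail_scale (C : R) : R :=
  (2 ^+ 10 * (1 + Num.sqrt (27 * expR 1 * C) * C))^-1.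
Definition tail_const (C : R) : R :=
  expR (mgf_const * C * tail_scale C ^+ 2).

Lemma tail_scale_gt0 C : 0 < C -> 0 < tail_scale C.
Proof.
by move=> C0; rewrite invr_gt0 mulr_gt0 ?exprn_gt0 // ltr_pwDl // mulr_ge0 ?sqrtr_ge0 // ltW.
Qed.

(** The block values are cut at the level of [moment_tail], which fails with probability
    [expR (- q)] per block, and the exponential Markov inequality handles the sum of the cut
    values. *)
Lemma lev_tail j n (g : seq A -> R) (rho C t theta : R) q :
  0 < rho -> 0 < C -> (0 < q)%N -> 0 <= theta ->
  theta <= t -> theta * Num.sqrt q%:R <= t * Num.sqrt (2 ^ j)%:R ->
  (forall m, blk j n m -> avg m g <= 0) ->
  (forall m k, blk j n m ->
     avg m (fun w => g w ^+ (2 * k)) <= C ^+ k * (3 * k)`!%:R * (rho ^+ 2) ^+ k) ->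
  avg n (fun w => (t * Num.sqrt (2 ^ j)%:R * rho <= lev j g w)%R%:R)
    <= (2 ^ j)%:R * expR (- q%:R) + tail_const C * expR (- (tail_scale C * theta)).
Proof.
move=> rho0 C0 q0 th0 th_t th_q g0 gm.
set N : R := (2 ^ j)%:R; have N0 : 0 < N by rewrite ltr0n expn_gt0.
have q0' : 0 < q%:R :> R by rewrite ltr0n.
set sq := Num.sqrt q%:R in th_q *; have sq0 : 0 < sq by rewrite sqrtr_gt0.
have sqE : sq ^+ 2 = q%:R by rewrite sqr_sqrtr // ltW.
set sN := Num.sqrt N; have sN0 : 0 < sN by rewrite sqrtr_gt0.
have sNE : sN ^+ 2 = N by rewrite sqr_sqrtr // ltW.
rewrite -/N -/sN in th_q.
have a00 := tail_scale_gt0 C0; set a0 := tail_scale C in a00 *.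
pose x := Num.sqrt (27 * expR 1 * C).
have x0 : 0 <= x by rewrite sqrtr_ge0.
pose y := Num.sqrt (27 * expR 1 * C * q%:R ^+ 3).
have yE : y = x * (q%:R * sq).
  rewrite /y sqrtrM; last by rewrite !mulr_ge0 ?expR_ge0 // ltW.
  by rewrite [q%:R ^+ 3]exprSr [Num.sqrt (q%:R ^+ 2 * _)]sqrtrM ?sqr_ge0 // sqrtr_sqr ger0_norm // ltW.
pose H := y * rho.
have H0 : 0 <= H by rewrite mulr_ge0 ?sqrtr_ge0 // ltW.
(* The variance term of all blocks is proportional to [a^2 N / q] and must stay bounded, so the tilt
   shrinks when there are more than [q] blocks. The two hypotheses relating [theta] and [t] serve
   the two cases. *)
pose a := if N <= q%:R then a0 else a0 * (sq / sN).
have a_gt0 : 0 < a by rewrite /a; case: ifP => // _; rewrite mulr_gt0 // divr_gt0.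
have aa0 : a <= a0.
  rewrite /a; case: (lerP N q%:R) => // qN; rewrite ler_piMr // ?(ltW a00) //.
  by rewrite ler_pdivrMr // mul1r ler_wsqrtr // ltW.
have aN : a ^+ 2 * N / q%:R <= a0 ^+ 2.
  rewrite /a; case: (lerP N q%:R) => qN.
    by rewrite -mulrA ler_piMr ?sqr_ge0 // ler_pdivrMr // mul1r.
  by rewrite exprMn expr_div_n sqE sNE le_eqVlt; apply/orP; left; apply/eqP; field; rewrite !gt_eqF.
have ath : a0 * theta <= a * t * sN / sq.
  rewrite /a; case: (lerP N q%:R) => qN.
    by rewrite -!mulrA ler_pM2l // mulrA ler_pdivlMr.
  rewrite (_ : _ / sq = a0 * t); first by rewrite ler_pM2l.
  by field; rewrite !gt_eqF.
(* As the cut level is proportional to [q^(3/2) rho], the powers of [q] and [rho] cancel in the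
   condition of [trunc_mgf]. *)
pose s := a / (rho * sq).
have s0 : 0 <= s by rewrite divr_ge0 ?mulr_ge0 // ltW.
pose g' u := if g u <= H then g u else 0.
have mgf : avg n (fun w => expR (s * lev j g' w)) <= expR (mgf_const * C * a0 ^+ 2).
  rewrite (@avg_ext _ _ _ _ (fun w => expR (lev j (fun u => s * g' u) w))); last first.
    by move=> w _; rewrite levZ.
  apply: le_trans (avg_expR_lev_le (B := expR (mgf_const * C * (s ^+ 2 * rho ^+ 2))) (expR_ge0 _) _) _.
    move=> m bm; apply: trunc_mgf => //; first exact: g0.
      by move=> k; exact: gm.
    rewrite /s /H yE -/a0.
    have -> : (a / (rho * sq)) ^+ 3 * (x * (q%:R * sq) * rho) * rho ^+ 2 * C = a ^+ 3 * (x * C).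
      by rewrite -sqE; field; rewrite !gt_eqF.
    have z0 : 0 <= x * C by rewrite mulr_ge0 // ltW.
    have a0E : a0 = 2^-1 ^+ 10 * (1 + x * C)^-1 by rewrite exprVn -invfM.
    have [N1024 EN] : exists r : R, r = 2^-1 ^+ 10 by exists (2^-1 ^+ 10).
    have N0' : 0 < N1024 by rewrite EN exprn_gt0 ?invr_gt0.
    have N1' : N1024 <= 1 by rewrite EN exprn_ile1 ?invr_ge0 // invf_le1 // ler1n.
    rewrite -EN in a0E *.
    have ax : a0 * (1 + x * C) = N1024 by rewrite a0E mulfVK // gt_eqF // ltr_pwDl.
    have axC : 0 <= a0 * (x * C) by rewrite mulr_ge0 // ltW.
    rewrite mulrDr mulr1 in ax; have a01 : a0 <= 1 by lra.
    apply: (@le_trans _ _ (a0 * (x * C))); last by lra.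
    apply: ler_wpM2r => //; apply: (@le_trans _ _ (a0 ^+ 3)).
      by apply: lerXn2r; rewrite ?nnegrE // ltW.
    by rewrite exprS ler_piMr ?(ltW a00) // exprn_ile1 // ltW.
  rewrite -expRM_natl ler_expR -/N [leLHS]mulrCA.
  apply: ler_wpM2l; first by rewrite mulr_ge0 ?mgf_const_ge0 // ltW.
  apply: le_trans aN; rewrite le_eqVlt /s; apply/orP; left; apply/eqP.
  by rewrite -sqE; field; rewrite !gt_eqF.
apply: (@le_trans _ _ (avg n (fun w => lev j (fun u => (H < g u)%R%:R) w
   + expR (- (a0 * theta)) * expR (s * lev j g' w)))).
  apply: avg_le => w _.
  have l0 : 0 <= lev j (fun u => (H < g u)%R%:R) w.
    by elim: (j) (w) => [|i IH] u /=; rewrite ?ler0n ?addr_ge0.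
  have e0 r : 0 <= expR (- (a0 * theta)) * expR r by rewrite mulr_ge0 ?expR_ge0.
  case: (lev_trunc j g H w) => [E|E]; last first.
    apply: le_trans (_ : 1 <= _); first by rewrite lern1; case: (_ <= _)%R.
    by rewrite -[leLHS]addr0 lerD.
  case: (lerP (t * sN * rho) (lev j g w)) => Hl; last by rewrite addr_ge0.
  rewrite -[leLHS]add0r lerD // -expRD -[leLHS]expR0 ler_expR addrC subr_ge0.
  apply: le_trans ath _; rewrite -/g' in E; rewrite -E.
  apply: le_trans (_ : s * (t * sN * rho) <= _); last by rewrite ler_wpM2l.
  rewrite le_eqVlt /s; apply/orP; left; apply/eqP.
  by field; rewrite !gt_eqF.
rewrite avgD avgZ; apply: lerD.
  rewrite mulr_natl; apply: avg_lev_le => m bm; apply: moment_tail => //.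
  exact: gm.
by rewrite mulrC; apply: ler_wpM2r; rewrite ?expR_ge0.
Qed.

End Mgf.

Section AbsLevel.
Variables (R : realType) (A : finType).
Hypothesis A_gt0 : (0 < #|A|)%N.
Notation avg := (@avg R A).

Lemma levN j (g : seq A -> R) w : lev j (fun u => - g u) w = - lev j g w.
Proof.
rewrite -mulN1r -levZ; congr lev; apply/funext => u; by rewrite mulN1r.
Qed.

Lemma abs_lev_tail j n (g : seq A -> R) (rho C t theta : R) q :
  0 < rho -> 0 < C -> (0 < q)%N -> 0 <= theta ->
  theta <= t -> theta * Num.sqrt q%:R <= t * Num.sqrt (2 ^ j)%:R ->
  (forall m, blk j n m -> avg m g = 0) ->
  (forall m k, blk j n m ->
     avg m (fun w => g w ^+ (2 * k)) <= C ^+ k * (3 * k)`!%:R * (rho ^+ 2) ^+ k) ->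
  avg n (fun w => (t * Num.sqrt (2 ^ j)%:R * rho <= `|lev j g w|)%R%:R)
    <= 2 * ((2 ^ j)%:R * expR (- q%:R) + tail_const C * expR (- (tail_scale C * theta))).
Proof.
move=> rho0 C0 q0 th0 th_t th_q g0 gm.
rewrite mulr_natl mulr2n.
apply: le_trans (lerD (lev_tail A_gt0 (n := n) (g := g) rho0 C0 q0 th0 th_t th_q _ gm)
  (lev_tail A_gt0 (n := n) (g := fun w => - g w) rho0 C0 q0 th0 th_t th_q _ _)); last first.
- move=> m k bm; rewrite (@avg_ext _ _ _ _ (fun w => g w ^+ (2 * k))); first exact: gm.
  by move=> w _; rewrite !exprM sqrrN.
- by move=> m bm; rewrite avgN g0 ?oppr0.
- by move=> m bm; rewrite g0.
rewrite -avgD; apply: avg_le => w _; rewrite levN.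
set T := t * _ * _; set x := lev j g w.
case: (lerP T `|x|) => Tx; last by rewrite addr_ge0.
have [x0|x0] := lerP 0 x.
  by rewrite -(ger0_norm x0) Tx lerDl.
by rewrite -[- x](ltr0_norm x0) Tx lerDr.
Qed.

End AbsLevel.

Lemma sum_34_le (R : realFieldType) K : \sum_(k < K) (3 / 4 : R) ^+ k <= 4.
Proof.
suff -> : \sum_(k < K) (3 / 4 : R) ^+ k = 4 - 4 * (3 / 4) ^+ K.
  by rewrite gerBl mulr_ge0 ?exprn_ge0 ?divr_ge0.
elim: K => [|K IH]; first by rewrite big_ord0 expr0; ring.
by rewrite big_ord_recr /= IH exprS; field.
Qed.

(** * Tails of the dyadic expansion *)

Section Fluctuation.
Variables (R : realType) (c : seq step -> R).
Hypothesis c_ge0 : forall w, 0 <= c w.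
Hypothesis c_le : forall w, c w <= (size w).+1%:R.
Hypothesis chi_ge0 : forall u v, 0 <= chi c u v.
Hypothesis chi_green : forall n1 n2, exists M, forall u v,
  size u = n1 -> size v = n2 ->
  chi c u v <= 2 * (\sum_(i < n1.+1) \sum_(j < n2.+1)
     green R M (pos (drop i u) + pos (take j v))) + 1.

Notation avg := (@avg R step).

Definition fluct w : R := c w - avg (size w) c.
Definition split_chi w : R := chi c (take (size w)./2 w) (drop (size w)./2 w).
Definition xi w : R := split_chi w - avg (size w) split_chi.

Lemma avg_fluct n : avg n fluct = 0.
Proof.
rewrite (@avg_ext _ _ n _ (fun w => c w - avg n c)); last by move=> w; rewrite /fluct => ->.
by rewrite avgB avg_const ?subrr // card_step.
Qed.

Lemma avg_xi n : avg n xi = 0.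
Proof.
rewrite (@avg_ext _ _ n _ (fun w => split_chi w - avg n split_chi)); last by move=> w; rewrite /xi => ->.
by rewrite avgB avg_const ?subrr // card_step.
Qed.

Lemma fluct_split w : fluct w = lev 1 fluct w - xi w.
Proof.
rewrite /= /xi /fluct; set n := size w.
have su : size (take n./2 w) = n./2.
  by rewrite size_take_min; apply/minn_idPl; rewrite /n; lia.
have sv : size (drop n./2 w) = (n - n./2)%N by rewrite size_drop.
have E : avg n split_chi = avg n./2 c + avg (n - n./2) c - avg n c.
  rewrite /split_chi (avg_half card_step_gt0 n (chi c)) /chi.
  rewrite (@avg_ext _ _ _ _ (fun u => c u + avg (n - n./2) c - avg (n - n./2) (fun v => c (u ++ v)))); last first.
    by move=> u _; rewrite avgB avgD avg_const ?card_step.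
  rewrite avgB avgD avg_const ?card_step // -avg_cat.
  by rewrite (_ : n./2 + (n - n./2) = n)%N //; lia.
rewrite su sv E /split_chi /chi -/n cat_take_drop; ring.
Qed.

Lemma lev_lev1 j (g : seq step -> R) w : lev j (lev 1 g) w = lev j.+1 g w.
Proof. by elim: j w => [//|j IH] w; rewrite [LHS]/= !IH. Qed.

Lemma fluct_levels j w : fluct w = lev j fluct w - \sum_(i < j) lev i xi w.
Proof.
elim: j => [|j IH]; first by rewrite big_ord0 subr0.
have E : lev j fluct w = lev j.+1 fluct w - lev j xi w.
  rewrite -lev_lev1 -levN -levD; congr lev; apply/funext => u.
  exact: fluct_split.
by rewrite IH E big_ord_recr opprD addrA addrAC.
Qed.

Definition xi_const : R := 12 * chi_const R.

Lemma chi_const_ge1 : 1 <= chi_const R.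
Proof.
have := green_const_ge1 R; rewrite /chi_const; move: (green_const R) => x x1.
have : 1 <= x ^+ 2 by rewrite exprn_ege1.
by move: (x ^+ 2) => y y1; lra.
Qed.

Lemma xi_const_ge9 : 9 <= xi_const.
Proof. by have := chi_const_ge1; rewrite /xi_const; lra. Qed.

Lemma xi_const_gt0 : 0 < xi_const.
Proof. by apply: lt_le_trans xi_const_ge9. Qed.

Lemma split_chi_ge0 w : 0 <= split_chi w.
Proof. exact: chi_ge0. Qed.

Lemma split_chi_moment n k : (0 < n)%N ->
  avg n (fun w => split_chi w ^+ (2 * k)) <= chi_const R ^+ k * (3 * k)`!%:R * n%:R ^+ k.
Proof.
move=> n0; rewrite /split_chi (avg_half card_step_gt0 n (fun u v => chi c u v ^+ (2 * k))).
have nE : (n./2 + (n - n./2) = n)%N by lia.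
by rewrite -{4}nE; apply: chi_moment => //; rewrite nE.
Qed.

(** Since [split_chi] is nonnegative, its distance to its mean [m] is at most the larger of the two.
    The case [k = 1] of its moment bound gives [m^2 <= 6 C n] with [6 = 3!], and doubling gives the
    12 of [xi_const]. *)
Lemma xi_moment n k : (0 < n)%N ->
  avg n (fun w => xi w ^+ (2 * k)) <= xi_const ^+ k * (3 * k)`!%:R * n%:R ^+ k.
Proof.
move=> n0; case: k => [|k].
  rewrite !muln0 !expr0 fact0 !mulr1.
  by rewrite (@avg_ext _ _ _ _ (fun=> 1)) ?avg_const ?card_step.
set K := k.+1; set m := avg n split_chi.
have m0 : 0 <= m by apply: avg_ge0 => w _; exact: split_chi_ge0.
have H1 := split_chi_moment 1 n0; have HK := split_chi_moment K n0.
have C1 := chi_const_ge1; rewrite /xi_const.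
move: (chi_const R) H1 HK C1 => C H1 HK C1.
have n1 : 1 <= n%:R :> R by rewrite ler1n.
have m2 : m ^+ 2 <= 6 * C * n%:R.
  apply: le_trans (avg_sqr_le _ _ _) _; first by rewrite card_step.
  by move: H1; rewrite !expr1 !muln1 (_ : 3`! = 6)%N // [C * _]mulrC.
apply: (@le_trans _ _ (avg n (fun w => split_chi w ^+ (2 * K) + (m ^+ 2) ^+ K))).
  apply: avg_le => w sw; rewrite /xi sw -/m.
  have := split_chi_ge0 w; move: (split_chi w) => x x0.
  rewrite !exprM; case: (lerP m x) => mx.
    apply: (@le_trans _ _ ((x ^+ 2) ^+ K)); last by rewrite lerDl exprn_ge0 // sqr_ge0.
    apply: lerXn2r; rewrite ?nnegrE ?sqr_ge0 //; apply: lerXn2r; rewrite ?nnegrE ?subr_ge0 //.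
    by rewrite gerBl.
  apply: (@le_trans _ _ ((m ^+ 2) ^+ K)); last by rewrite lerDr exprn_ge0 // sqr_ge0.
  have mx0 : 0 <= m - x by rewrite subr_ge0 ltW.
  apply: lerXn2r; rewrite ?nnegrE ?sqr_ge0 // -sqrrN opprB.
  by apply: lerXn2r; rewrite ?nnegrE // gerBl.
rewrite avgD avg_const ?card_step //.
apply: (@le_trans _ _ (C ^+ K * (3 * K)`!%:R * n%:R ^+ K + (6 * C * n%:R) ^+ K)).
  by apply: lerD => //; apply: lerXn2r; rewrite ?nnegrE ?sqr_ge0 ?mulr_ge0 //; lra.
rewrite !exprMn.
have f1 : 1 <= (3 * K)`!%:R :> R by rewrite ler1n fact_gt0.
have CK : 1 <= C ^+ K by rewrite exprn_ege1.
have nK : 1 <= n%:R ^+ K :> R by rewrite exprn_ege1.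
have N6 : 1 <= 6 ^+ K :> R by rewrite exprn_ege1 // ler1n.
have N12 : 2 * 6 ^+ K <= 12 ^+ K :> R.
  rewrite (_ : 12 = 2 * 6); last by ring.
  rewrite exprMn; apply: ler_wpM2r; first by rewrite exprn_ge0.
  by rewrite /K exprS ler_peMr // exprn_ege1 // ler1n.
move: CK nK N6 N12 f1; move: (C ^+ K) (n%:R ^+ K) (6 ^+ K) (12 ^+ K) ((3 * K)`!%:R).
move=> a b d e f a1 b1 d1 de f1.
rewrite (_ : _ + _ = (f + d) * (a * b)); last by ring.
rewrite (_ : e * a * f * b = e * f * (a * b)); last by ring.
apply: ler_wpM2r; first by rewrite mulr_ge0 //; lra.
by nra.
Qed.

Lemma blk_gt0 i n m : (2 ^ i <= n)%N -> blk i n m -> (0 < m)%N.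
Proof. by move=> ni /andP []; case: m => //; rewrite mul1n; lia. Qed.

Lemma blk_le i n m : (2 ^ i <= n)%N -> blk i n m -> (m * 2 ^ i < 2 * n)%N.
Proof. by move=> ni /andP []; lia. Qed.

Definition level_tail (N q : R) (theta : R) : R :=
  2 * (N * expR (- q) + tail_const xi_const * expR (- (tail_scale xi_const * theta))).

Section Level.
Variables (n i : nat).
Hypothesis ni : (2 ^ i <= n)%N.
(** Blocks of level [i] are shorter than [2 n / 2^i]. With this size the threshold
    [t sqrt (2^i) rho] is [t sqrt (2 n)] at every level. *)
Let rho : R := Num.sqrt (2 * n%:R / (2 ^ i)%:R).

Let n_gt0 : (0 < n)%N.
Proof. by apply: leq_trans ni; rewrite expn_gt0. Qed.

Let N_gt0 : 0 < (2 ^ i)%:R :> R.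
Proof. by rewrite ltr0n expn_gt0. Qed.

Let rho_sqr : rho ^+ 2 = 2 * n%:R / (2 ^ i)%:R.
Proof. by rewrite sqr_sqrtr // divr_ge0 ?mulr_ge0. Qed.

Let rho_gt0 : 0 < rho.
Proof. by rewrite sqrtr_gt0 divr_gt0 // mulr_gt0 // ltr0n. Qed.

Let scale t : t * Num.sqrt (2 ^ i)%:R * rho = t * Num.sqrt (2 * n%:R).
Proof.
rewrite -mulrA; congr (_ * _); rewrite /rho -sqrtrM ?ler0n //; congr Num.sqrt.
by rewrite mulrCA divff ?mulr1 // gt_eqF.
Qed.

Lemma xi_level_tail (t theta : R) q : (0 < q)%N -> 0 <= theta ->
  theta <= t -> theta * Num.sqrt q%:R <= t * Num.sqrt (2 ^ i)%:R ->
  avg n (fun w => (t * Num.sqrt (2 * n%:R) <= `|lev i xi w|)%R%:R)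
    <= level_tail (2 ^ i)%:R q%:R theta.
Proof.
move=> q0 th0 th_t th_q; rewrite -scale.
apply: abs_lev_tail => //; rewrite ?card_step ?xi_const_gt0 //.
  by move=> m _; exact: avg_xi.
move=> m k bm; apply: le_trans (xi_moment _ (blk_gt0 ni bm)) _.
apply: ler_wpM2l; first by rewrite mulr_ge0 ?exprn_ge0 // ltW // xi_const_gt0.
apply: lerXn2r; rewrite ?nnegrE ?sqr_ge0 // rho_sqr.
by rewrite ler_pdivlMr // -!natrM ler_nat ltnW // blk_le.
Qed.

(** At the last level blocks have length at most 2; the trivial bound 3 on the fluctuation is enough
    there, whence [xi_const_ge9]. *)
Lemma fluct_level_tail (t theta : R) q : (n < 2 ^ i.+1)%N -> (0 < q)%N -> 0 <= theta ->
  theta <= t -> theta * Num.sqrt q%:R <= t * Num.sqrt (2 ^ i)%:R ->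
  avg n (fun w => (t * Num.sqrt (2 * n%:R) <= `|lev i fluct w|)%R%:R)
    <= level_tail (2 ^ i)%:R q%:R theta.
Proof.
move=> ni' q0 th0 th_t th_q; rewrite -scale.
apply: abs_lev_tail => //; rewrite ?card_step ?xi_const_gt0 //.
  by move=> m _; exact: avg_fluct.
move=> m k bm.
have m2 : (m <= 2)%N.
  move: bm => /andP [_ bm]; rewrite -ltnS -(@ltn_pmul2r (2 ^ i)) ?expn_gt0 //.
  by move: ni'; rewrite expnS; lia.
apply: (@le_trans _ _ (xi_const ^+ k * 1 * 1)).
  rewrite !mulr1; apply: avg_le_const; first by rewrite card_step.
  move=> w sw; rewrite exprM; apply: lerXn2r; rewrite ?nnegrE ?sqr_ge0 //.
    by rewrite ltW // xi_const_gt0.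
  apply: le_trans xi_const_ge9.
  have cw := c_le w; have cw0 := c_ge0 w; rewrite sw in cw.
  have a0 : 0 <= avg m c by apply: avg_ge0.
  have am : avg m c <= m.+1%:R by apply: avg_le_const => [|u <-]; rewrite ?card_step.
  have m3 : m.+1%:R <= 3 :> R by rewrite ler_nat.
  rewrite /fluct sw; move: (c w) (avg m c) cw cw0 a0 am => x y *; nra.
have r1 : 1 <= rho ^+ 2.
  rewrite rho_sqr ler_pdivlMr // mul1r -natrM ler_nat; lia.
have xk0 : 0 <= xi_const ^+ k by rewrite exprn_ge0 // ltW // xi_const_gt0.
apply: ler_pM; rewrite ?mulr1 //; last by apply: exprn_ege1.
by rewrite ler_peMr // ler1n fact_gt0.
Qed.

End Level.

Lemma sqrt_pow_34 i : 1 <= (3 / 4) ^+ i * Num.sqrt (2 ^ i)%:R :> R.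
Proof.
rewrite -(@ler_pXn2r _ 2) ?nnegrE ?mulr_ge0 ?exprn_ge0 ?sqrtr_ge0 ?divr_ge0 //.
rewrite expr1n exprMn sqr_sqrtr ?ler0n // -exprM mulnC exprM natrX -exprMn.
by rewrite exprn_ege1 //; lra.
Qed.

(** Level [i] is allowed the share [theta (1 + sqrt q (3/4)^i)]: the two summands meet the two
    requirements of [lev_tail], the second one because [3/4 >= 1 / sqrt 2]. The shares sum to at
    most [(J + 4 sqrt q) theta]. *)
Lemma xi_sum_tail n J q (theta : R) : (0 < q)%N -> 0 <= theta ->
  (2 ^ J <= 2 * n)%N ->
  avg n (fun w => ((J%:R + 4 * Num.sqrt q%:R) * theta * Num.sqrt (2 * n%:R)
      < `|\sum_(i < J) lev i xi w|)%R%:R)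
    <= J%:R * level_tail (2 ^ J)%:R q%:R theta.
Proof.
move=> q0 th0 Jn.
pose t i := theta * (1 + Num.sqrt q%:R * (3 / 4) ^+ i) : R.
have sq0 : 0 <= Num.sqrt q%:R :> R by rewrite sqrtr_ge0.
have p0 i : 0 <= (3 / 4 : R) ^+ i by rewrite exprn_ge0 // divr_ge0.
apply: (@le_trans _ _ (avg n (fun w => \sum_(i < J) (t i * Num.sqrt (2 * n%:R) <= `|lev i xi w|)%R%:R))).
  apply: avg_le => w _.
  case: (boolP [exists i : 'I_J, t i * Num.sqrt (2 * n%:R) <= `|lev i xi w|]).
    move=> /existsP [i Hi]; rewrite [leRHS](bigD1 i isT) Hi /=.
    apply: (@le_trans _ _ 1); first by rewrite lern1; case: (_ < _)%R.
    by rewrite lerDl; apply: sumr_ge0.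
  rewrite negb_exists => /forallP H.
  case: ltP => [|_]; last by apply: sumr_ge0.
  rewrite ltNge; case/negP.
  apply: le_trans (ler_norm_sum _ _ _) _.
  apply: (@le_trans _ _ (\sum_(i < J) t i * Num.sqrt (2 * n%:R))).
    by apply: ler_sum => i _; rewrite ltW // ltNge.
  rewrite -mulr_suml; apply: ler_wpM2r; first by rewrite sqrtr_ge0.
  rewrite /t -mulr_sumr mulrC; apply: ler_wpM2r => //.
  rewrite big_split /= sumr_const card_ord lerD2l -mulr_sumr mulrC.
  by apply: ler_wpM2r => //; exact: sum_34_le.
rewrite avg_sum.
apply: (@le_trans _ _ (\sum_(i < J) level_tail (2 ^ J)%:R q%:R theta)); last first.
  by rewrite sumr_const card_ord mulr_natl.
apply: ler_sum => i _.
have iJ : (2 ^ i <= n)%N.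
  have : (2 ^ i.+1 <= 2 ^ J)%N by rewrite leq_exp2l.
  by rewrite expnS; lia.
apply: (@le_trans _ _ (level_tail (2 ^ i)%:R q%:R theta)).
  apply: xi_level_tail => //; rewrite /t.
    by rewrite ler_peMr // lerDl mulr_ge0.
  rewrite -mulrA; apply: ler_wpM2l => //.
  apply: (@le_trans _ _ (Num.sqrt q%:R * ((3 / 4) ^+ i * Num.sqrt (2 ^ i)%:R))).
    by rewrite ler_peMr // sqrt_pow_34.
  by rewrite mulrA; apply: ler_wpM2r; rewrite ?sqrtr_ge0 // lerDr.
rewrite /level_tail ler_pM2l // lerD2r; apply: ler_wpM2r; first exact: expR_ge0.
by rewrite ler_nat leq_exp2l // ltnW.
Qed.

(** Here the expansion is carried down to blocks of length at most 2, whose sum costs one more share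
    [1 + sqrt q]. *)
Lemma fluct_tail n q (theta : R) (J := trunc_log 2 n) :
  (0 < n)%N -> (0 < q)%N -> 0 <= theta ->
  avg n (fun w => ((J.+1%:R + 5 * Num.sqrt q%:R) * theta * Num.sqrt (2 * n%:R)
      < `|fluct w|)%R%:R) <= J.+1%:R * level_tail n%:R q%:R theta.
Proof.
move=> n0 q0 th0.
have /andP [J1 J2] := trunc_log_bounds (isT : 1 < 2)%N n0; rewrite -/J in J1 J2.
have sq0 : 0 <= Num.sqrt q%:R :> R by rewrite sqrtr_ge0.
have s2 : 0 <= Num.sqrt (2 * n%:R) :> R by rewrite sqrtr_ge0.
have Hx := xi_sum_tail q0 th0 (leq_trans J1 (leq_pmull n (isT : 0 < 2)%N)).
have Hf : avg n (fun w => (theta * (1 + Num.sqrt q%:R) * Num.sqrt (2 * n%:R)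
   <= `|lev J fluct w|)%R%:R) <= level_tail (2 ^ J)%:R q%:R theta.
  apply: fluct_level_tail => //; first by rewrite ler_peMr // lerDl.
  rewrite -mulrA; apply: ler_wpM2l => //.
  have H1 : 1 <= Num.sqrt (2 ^ J)%:R :> R.
    by rewrite -[leLHS]sqrtr1 ler_wsqrtr // ler1n expn_gt0.
  apply: (@le_trans _ _ (1 + Num.sqrt q%:R)); first by rewrite lerDr.
  by rewrite ler_peMr // addr_ge0.
apply: (@le_trans _ _ (J.+1%:R * level_tail (2 ^ J)%:R q%:R theta)); last first.
  apply: ler_wpM2l => //; rewrite /level_tail ler_pM2l // lerD2r.
  by apply: ler_wpM2r; rewrite ?expR_ge0 // ler_nat.
have EJ : J.+1%:R = J%:R + 1 :> R by rewrite natr1.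
rewrite [leRHS](_ : _ = J%:R * level_tail (2 ^ J)%:R q%:R theta
  + level_tail (2 ^ J)%:R q%:R theta); last by rewrite EJ mulrDl mul1r.
apply: le_trans (lerD Hx Hf).
rewrite -avgD; apply: avg_le => w _; rewrite (fluct_levels J).
set X := \sum_(i < J) _; set Y := lev J fluct w; set T := Num.sqrt (2 * n%:R) in s2 *.
set r := Num.sqrt q%:R in sq0 *.
case: ltP => H; last by rewrite addr_ge0.
have H2 := le_trans (ltW H) (ler_normB Y X).
case: (ltP ((J%:R + 4 * r) * theta * T) `|X|) => H3; first by rewrite lerDl.
case: (lerP (theta * (1 + r) * T) `|Y|) => H4; first by rewrite lerDr.
exfalso; have := lt_le_trans H (ler_normB Y X).
by rewrite ltNge; apply/negP/negPn; rewrite EJ; move: H3 H4; lra.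
Qed.

End Fluctuation.

Lemma near_expR_mul_ge (R : realType) (b : nat -> R) (g K : R) :
  b @ \oo --> +oo -> 0 < g -> \forall n \near \oo, K <= expR (b n * g).
Proof.
move=> b_oo g0; have /cvgryPge/(_ (K / g)) := b_oo; apply: filter_app.
near=> n => bK; apply: le_trans (expR_ge1Dx _).
by rewrite ler_pdivrMr // in bK; apply: le_trans bK _; rewrite lerDr.
Unshelve. all: by end_near.
Qed.

(** * A quadratic Gartner-Ellis theorem *)

Section GartnerEllis.
Variables (R : realType) (A : finType).
Hypothesis A_gt0 : (0 < #|A|)%N.
Notation avg := (@avg R A).
Variables (b : nat -> R) (W : nat -> seq A -> R) (sigma2 : R).
Hypothesis b_oo : b @ \oo --> +oo.
Hypothesis b_gt0 : forall n, 0 < b n.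
Hypothesis sigma2_gt0 : 0 < sigma2.
Hypothesis mgf_lim : forall theta eta, 0 < eta -> \forall n \near \oo,
  expR (b n * (theta ^+ 2 * sigma2 / 2 - eta))
    <= avg n (fun w => expR (theta * W n w))
    <= expR (b n * (theta ^+ 2 * sigma2 / 2 + eta)).

(** The exponential Markov inequality at the optimal tilt [x / sigma2]. *)
Lemma ldp_upper x eta : 0 < x -> 0 < eta -> \forall n \near \oo,
  avg n (fun w => (x * b n <= W n w)%R%:R)
    <= expR (- (b n * (x ^+ 2 / (2 * sigma2) - eta))).
Proof.
move=> x0 eta0; have := mgf_lim (x / sigma2) eta0; apply: filter_app.
near=> n => /andP [_ H].
have th0 : 0 <= x / sigma2 by rewrite divr_ge0 // ltW.
apply: (@le_trans _ _ (avg n (fun w => expR (- (x / sigma2 * (x * b n))) * expR (x / sigma2 * W n w)))).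
  apply: avg_le => w _; rewrite -expRD.
  case: (lerP (x * b n) (W n w)) => xW; last exact: expR_ge0.
  by rewrite -[leLHS]expR0 ler_expR addrC subr_ge0 ler_wpM2l.
rewrite avgZ; apply: le_trans (ler_wpM2l (expR_ge0 _) H) _.
rewrite -expRD ler_expR le_eqVlt; apply/orP; left; apply/eqP.
by field; rewrite gt_eqF.
Unshelve. all: by end_near.
Qed.

(** Tilting without a change of measure: the exponential moment at [th] is carried by the window
    from [x b] to [(x + 2 e) b] around its optimal point. Values below and above the window are
    bounded by the moments at [th - ka] and [th + ka]. *)
Lemma ldp_lower x eta : 0 < x -> 0 < eta -> \forall n \near \oo,
  expR (- (b n * (x ^+ 2 / (2 * sigma2) + eta)))
    <= avg n (fun w => (x * b n <= W n w)%R%:R).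
Proof.
move=> x0 eta0.
(* The window costs [4 x e + (3 + 3/4) e^2], at most [4 (x + 1) e] for [e <= 1]. *)
pose e : R := Num.min 1 (eta * sigma2 / (4 * (x + 1))).
have x1 : 0 < x + 1 by rewrite addr_gt0.
have e0 : 0 < e by rewrite lt_min ltr01 divr_gt0 // mulr_gt0.
have e1 : e <= 1 by rewrite ge_min lexx.
have e2 : e * (4 * (x + 1)) <= eta * sigma2.
  by rewrite -ler_pdivlMr ?mulr_gt0 // ge_min lexx orbT.
pose th := (x + e) / sigma2; pose ka := e / sigma2.
pose g := e ^+ 2 / (2 * sigma2).
have g0 : 0 < g by rewrite divr_gt0 ?exprn_gt0 // mulr_gt0.
have g40 : 0 < g / 4 by rewrite divr_gt0.
have th0 : 0 <= th by rewrite divr_ge0 ?addr_ge0 // ltW.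
have ka0 : 0 <= ka by rewrite divr_ge0 // ltW.
have s0 : sigma2 != 0 by rewrite gt_eqF.
near=> n.
have /andP [H1 _] : expR (b n * (th ^+ 2 * sigma2 / 2 - g / 4))
    <= avg n (fun w => expR (th * W n w))
    <= expR (b n * (th ^+ 2 * sigma2 / 2 + g / 4)) by near: n; exact: mgf_lim.
have /andP [_ H2] : expR (b n * ((th - ka) ^+ 2 * sigma2 / 2 - g / 4))
    <= avg n (fun w => expR ((th - ka) * W n w))
    <= expR (b n * ((th - ka) ^+ 2 * sigma2 / 2 + g / 4)) by near: n; exact: mgf_lim.
have /andP [_ H3] : expR (b n * ((th + ka) ^+ 2 * sigma2 / 2 - g / 4))
    <= avg n (fun w => expR ((th + ka) * W n w))
    <= expR (b n * ((th + ka) ^+ 2 * sigma2 / 2 + g / 4)) by near: n; exact: mgf_lim.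
have H4 : 4 <= expR (b n * (g / 2)).
  by near: n; apply: near_expR_mul_ge => //; rewrite divr_gt0.
have H5 : 2 <= expR (b n * (eta / 2)).
  by near: n; apply: near_expR_mul_ge => //; rewrite divr_gt0.
have bn0 := b_gt0 n.
set P := avg n (fun w => (x * b n <= W n w)%R%:R).
have split : avg n (fun w => expR (th * W n w)) <=
   expR (th * ((x + 2 * e) * b n)) * P
   + (expR (ka * (x * b n)) * avg n (fun w => expR ((th - ka) * W n w))
      + expR (- (ka * ((x + 2 * e) * b n))) * avg n (fun w => expR ((th + ka) * W n w))).
  rewrite -!avgZ -!avgD; apply: avg_le => w _; rewrite -!expRD.
  have q0 r : 0 <= expR r by exact: expR_ge0.
  case: (lerP (x * b n) (W n w)) => xW.
    rewrite mulr1; case: (lerP (W n w) ((x + 2 * e) * b n)) => Wx.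
      apply: le_trans (_ : expR (th * ((x + 2 * e) * b n)) <= _).
        by rewrite ler_expR ler_wpM2l.
      by rewrite lerDl addr_ge0.
    apply: le_trans (_ : expR (- (ka * ((x + 2 * e) * b n)) + (th + ka) * W n w) <= _).
      rewrite ler_expR -subr_ge0.
      rewrite (_ : _ - _ = ka * (W n w - (x + 2 * e) * b n)); last by ring.
      by rewrite mulr_ge0 // subr_ge0 ltW.
    by rewrite addrA lerDr addr_ge0.
  rewrite mulr0 add0r; apply: le_trans (_ : expR (ka * (x * b n) + (th - ka) * W n w) <= _).
    rewrite ler_expR -subr_ge0.
    rewrite (_ : _ - _ = ka * (x * b n - W n w)); last by ring.
    by rewrite mulr_ge0 // subr_ge0 ltW.
  by rewrite lerDl.
set E1 := avg n _ in H1 split; set E2 := avg n _ in H2 split; set E3 := avg n _ in H3 split.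
(* Shifting the tilt by [ka] gains [g], of which the error of the limit takes back [g / 4]. The
   lower bound of the full moment exceeds [expR a] by [expR (b g / 2) >= 4], so two copies remain
   for the window. *)
pose a := b n * (th ^+ 2 * sigma2 / 2 - 3 * g / 4).
have F2 : expR (ka * (x * b n)) * E2 <= expR a.
  apply: le_trans (ler_wpM2l (expR_ge0 _) H2) _; rewrite -expRD ler_expR.
  rewrite le_eqVlt; apply/orP; left; apply/eqP.
  by rewrite /a /g /th /ka; field.
have F3 : expR (- (ka * ((x + 2 * e) * b n))) * E3 <= expR a.
  apply: le_trans (ler_wpM2l (expR_ge0 _) H3) _; rewrite -expRD ler_expR.
  rewrite le_eqVlt; apply/orP; left; apply/eqP.
  by rewrite /a /g /th /ka; field.
have Ea : expR (b n * (th ^+ 2 * sigma2 / 2 - g / 4)) = expR a * expR (b n * (g / 2)).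
  by rewrite -expRD; congr expR; rewrite /a; field.
have a0 : 0 < expR a := expR_gt0 a.
have F4 : 2 * expR a <= expR (th * ((x + 2 * e) * b n)) * P.
  rewrite Ea in H1; nra.
set D := th * ((x + 2 * e) * b n) in F4 *.
have F5 : 2 * expR a * expR (- D) <= P.
  apply: le_trans (ler_wpM2r (expR_ge0 _) F4) _.
  by rewrite mulrAC -expRD subrr expR0 mul1r.
apply: le_trans F5.
have F6 : expR (- (b n * (x ^+ 2 / (2 * sigma2) + eta))) * expR (b n * (eta / 2))
   <= expR a * expR (- D).
  rewrite -!expRD ler_expR -subr_ge0.
  rewrite (_ : _ - _ = b n * ((eta * sigma2 - (4 * x * e + e ^+ 2 * (3 + 3 / 4))) / (2 * sigma2))); last first.
    by rewrite /a /D /g /th; field.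
  rewrite mulr_ge0 ?(ltW bn0) // divr_ge0 ?mulr_ge0 ?(ltW sigma2_gt0) // subr_ge0.
  nra.
have p0 := expR_ge0 (- (b n * (x ^+ 2 / (2 * sigma2) + eta))).
have p1 : 0 <= expR a * expR (- D) by rewrite mulr_ge0 ?expR_ge0.
move: F6 p0 p1 H5; rewrite -mulrA.
set u := expR (- (b n * _)); set v := expR a * _; set y := expR (b n * _).
by nra.
Unshelve. all: by end_near.
Qed.

End GartnerEllis.

(** * Elementary exponential and logarithmic estimates *)

Section Estimates.
Variable R : realType.

Lemma expR_ge_pow (x : R) k : 0 <= x -> x ^+ k <= k`!%:R * expR x.
Proof.
move=> x0; case: k => [|k].
  by rewrite expr0 mul1r; apply: le_trans (expR_ge1Dx x); rewrite lerDl.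
rewrite mulrC -ler_pdivrMr ?ltr0n ?fact_gt0 //.
by apply: le_trans (expR_ge1Dxn k x0); rewrite lerDr.
Qed.

(** From [1 - v <= expR (- v)] at [v = u / (1 + u)], where [1 - v = 1 / (1 + u)]. *)
Lemma expR_1D_ge (u : R) : 0 <= u -> expR (u / (1 + u)) <= 1 + u.
Proof.
move=> u0; have u1 : 0 < 1 + u by rewrite ltr_pwDl.
rewrite -[leLHS]invrK -expRN -[leRHS]invrK lef_pV2 ?posrE ?invr_gt0 ?expR_gt0 //.
apply: le_trans (expR_ge1Dx _); rewrite le_eqVlt; apply/orP; left; apply/eqP.
by field; rewrite gt_eqF.
Qed.

(** The error is relative to the quadratic term, so that it becomes a relative error of the
    variance. The series from order 3 on is at most [x^2 d], because [(3 + k)! >= 2^(k+1)]. *)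
Lemma expR_quad_bounds (x d : R) : 0 <= d -> d <= 1 -> `|x| <= d ->
  1 + x + x ^+ 2 / 2 * (1 - 2 * d) <= expR x <= 1 + x + x ^+ 2 / 2 * (1 + 2 * d).
Proof.
move=> d0 d1 xd; have x1 := le_trans xd d1.
have [N EN] : exists N : nat -> R, N = fun K => \sum_(k < K) x ^+ k / k`!%:R by eexists.
have cv : N @ \oo --> expR x.
  have -> : N = series (exp_coeff x).
    by apply/funext => K; rewrite EN /series /= big_mkord.
  exact: is_cvg_series_exp_coeff.
have xd2 : 0 <= x ^+ 2 * d by apply: mulr_ge0 => //; exact: sqr_ge0.
have B K : `|N (3 + K)%N - (1 + x + x ^+ 2 / 2)| <= x ^+ 2 * d.
  have -> : N (3 + K)%N - (1 + x + x ^+ 2 / 2) = \sum_(k < K) x ^+ (3 + k) / (3 + k)`!%:R.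
    rewrite EN big_split_ord /= !big_ord_recl big_ord0 /= /bump /=.
    transitivity (1 / 1 + (x / 1 + (x ^+ 2 / 2 + 0)) +
      \sum_(i < K) x ^+ (3 + i) / (3 + i)`!%:R - (1 + x + x ^+ 2 / 2)).
      by [].
    by field.
  apply: le_trans (ler_norm_sum _ _ _) _.
  apply: (@le_trans _ _ (\sum_(k < K) x ^+ 2 * d * (2^-1 * 2^-1 ^+ k))).
    apply: ler_sum => k _; rewrite normrM normrX.
    have xx : `|x| ^+ (3 + k) <= x ^+ 2 * d.
      rewrite exprD -(real_normK (num_real x)) (exprSr _ 2) -mulrA.
      apply: ler_wpM2l; first exact: sqr_ge0.
      apply: le_trans xd; rewrite ler_piMr // exprn_ile1 //.
    apply: ler_pM => //; rewrite ger0_norm ?invr_ge0 // -exprS.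
    have f : (2 ^ k.+1 <= (3 + k)`!)%N.
      elim: (nat_of_ord k) => [//|i IH]; rewrite addnS factS expnS leq_mul //.
    rewrite exprVn lef_pV2 ?posrE ?exprn_gt0 ?ltr0n ?fact_gt0 //.
    by rewrite -natrX ler_nat.
  rewrite -mulr_sumr -mulr_sumr; apply: ler_piMr => //.
  by have := @sum_half_le R K; lra.
have cv3 : (fun K => N (3 + K)%N) @ \oo --> expR x.
  rewrite (_ : (fun K => N (3 + K)%N) = (fun K => N (K + 3)%N)); last first.
    by apply/funext => K; rewrite addnC.
  by rewrite cvg_shiftn.
apply/andP; split.
  apply: (cvgr_to_ge cv3); near=> K.
  by have := B K; rewrite ler_norml => /andP [h1 h2]; lra.
apply: (cvgr_to_le cv3); near=> K.
by have := B K; rewrite ler_norml => /andP [h1 h2]; lra.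
Unshelve. all: by end_near.
Qed.

End Estimates.

Section Calculus.
Variable R : realType.

Lemma pow_le_expR (K k0 : R) k : 0 < k0 ->
  exists z0 : R, forall z, z0 <= z -> K * z ^+ k <= expR (k0 * z).
Proof.
move=> k00; pose z0 := Num.max 0 (K * (k.+1`!%:R / k0 ^+ k.+1)).
exists z0 => z zz0.
have z_ge0 : 0 <= z by apply: le_trans zz0; rewrite le_max lexx.
have f0 : 0 < k.+1`!%:R :> R by rewrite ltr0n fact_gt0.
have H := expR_ge_pow k.+1 (mulr_ge0 (ltW k00) z_ge0).
rewrite -ler_pdivrMl // in H; apply: le_trans H.
rewrite exprMn [z ^+ k.+1]exprS !mulrA; apply: ler_wpM2r; first by rewrite exprn_ge0.
rewrite -ler_pdivrMl ?mulr_gt0 ?invr_gt0 ?exprn_gt0 //.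
apply: le_trans zz0; rewrite le_max; apply/orP; right.
by rewrite le_eqVlt; apply/orP; left; apply/eqP; field; rewrite ?gt_eqF ?exprn_gt0.
Qed.

Lemma near_ln_ge (K : R) : \forall n \near \oo, K <= ln n%:R.
Proof.
exists (Num.bound (expR K)) => // n /= Kn.
rewrite -[leLHS]expRK ler_ln ?posrE ?expR_gt0 //.
  apply: le_trans (_ : (Num.bound (expR K))%:R <= _); last by rewrite ler_nat.
  by rewrite ltW // archi_boundP // expR_ge0.
have : (0 < Num.bound (expR K))%N.
  rewrite -(ltr0n R); apply: lt_trans (expR_gt0 K) _.
  by rewrite archi_boundP // expR_ge0.
by rewrite ltr0n => /leq_trans; apply.
Qed.

Lemma ln2_gt0 : 0 < ln (2 : R).
Proof. by rewrite ln_gt0 // ltr1n. Qed.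

Lemma trunc_log_ln m : (0 < m)%N ->
  (trunc_log 2 m)%:R * ln 2 <= ln (m%:R : R).
Proof.
move=> m0; have /andP [H _] := trunc_log_bounds (isT : 1 < 2)%N m0.
rewrite mulr_natl -lnXn // ler_ln ?posrE ?exprn_gt0 ?ltr0n //.
by rewrite -natrX ler_nat.
Qed.

End Calculus.

(** * The exponential moment of one truncated block *)

Section BlockMgf.
Variables (R : realType) (c : seq step -> R).
Hypothesis c_ge0 : forall w, 0 <= c w.
Hypothesis c_le : forall w, c w <= (size w).+1%:R.
Notation avg := (@avg R step).

Definition cut (H : R) w : R := if `|fluct c w| <= H then fluct c w else 0.

Lemma fluct_abs_le w : `|fluct c w| <= (size w).+1%:R.
Proof.
have a0 : 0 <= avg (size w) c by apply: avg_ge0.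
have am : avg (size w) c <= (size w).+1%:R.
  by apply: avg_le_const => [|u <-]; rewrite ?card_step.
have := c_ge0 w; have := c_le w; rewrite /fluct ler_norml.
by move: (c w) (avg _ c) a0 am => x y *; apply/andP; split; lra.
Qed.

Lemma cut_abs_le H w : 0 <= H -> `|cut H w| <= H.
Proof. by move=> H0; rewrite /cut; case: ifP => //; rewrite normr0. Qed.

(** After truncation the quadratic expansion is uniform. As the fluctuation is at most [m + 1],
    truncation moves the mean by at most [(m + 1) p] and the second moment by at most
    [(m + 1)^2 p]. *)
Lemma block_mgf m (t H p d : R) (V := avg m (fun w => fluct c w ^+ 2)) :
  0 <= H -> 0 <= d -> d <= 2^-1 -> `|t| * H <= d ->
  avg m (fun w => (H < `|fluct c w|)%R%:R) <= p ->
  1 + (t ^+ 2 / 2 * (1 - 2 * d) * V - (`|t| * m.+1%:R * p + t ^+ 2 / 2 * (m.+1%:R ^+ 2 * p)))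
    <= avg m (fun w => expR (t * cut H w))
    <= 1 + (`|t| * m.+1%:R * p + t ^+ 2 / 2 * (1 + 2 * d) * V).
Proof.
move=> H0 d0 d12 td Hp.
have d1 : d <= 1 by lra.
set I := avg m _ in Hp.
have I0 : 0 <= I by apply: avg_ge0.
have m1 : `|avg m (cut H)| <= m.+1%:R * p.
  have -> : avg m (cut H) = avg m (fun w => cut H w - fluct c w).
    by rewrite avgB avg_fluct subr0.
  have B w : size w = m -> `|cut H w - fluct c w| <= m.+1%:R * (H < `|fluct c w|)%R%:R.
    move=> sw; rewrite /cut; case: (lerP `|fluct c w| H) => HH.
      by rewrite subrr normr0 mulr0.
    by rewrite sub0r normrN mulr1 -sw fluct_abs_le.
  apply: (@le_trans _ _ (m.+1%:R * I)); last by apply: ler_wpM2l.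
  rewrite ler_norml -avgZ -avgN; apply/andP; split; apply: avg_le => w /B.
    by rewrite ler_norml => /andP [].
  by rewrite ler_norml => /andP [].
have v1 : avg m (fun w => cut H w ^+ 2) <= V.
  apply: avg_le => w _; rewrite /cut; case: ifP => // _.
  by rewrite expr0n /= sqr_ge0.
have v2 : V - m.+1%:R ^+ 2 * p <= avg m (fun w => cut H w ^+ 2).
  apply: (@le_trans _ _ (V - m.+1%:R ^+ 2 * I)).
    by rewrite lerB //; apply: ler_wpM2l; rewrite ?sqr_ge0.
  rewrite /V -avgZ -avgB; apply: avg_le => w sw; rewrite /cut.
  case: (lerP `|fluct c w| H) => HH; first by rewrite mulr0 subr0.
  rewrite mulr1 expr0n /= subr_le0 -(real_normK (num_real (fluct c w))).
  by apply: lerXn2r; rewrite ?nnegrE // -sw fluct_abs_le.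
have E w : 1 + t * cut H w + (t * cut H w) ^+ 2 / 2 * (1 - 2 * d) <= expR (t * cut H w)
   <= 1 + t * cut H w + (t * cut H w) ^+ 2 / 2 * (1 + 2 * d).
  apply: expR_quad_bounds => //; rewrite normrM; apply: le_trans td.
  by apply: ler_wpM2l => //; apply: cut_abs_le.
have X k : avg m (fun w => 1 + t * cut H w + (t * cut H w) ^+ 2 / 2 * k)
   = 1 + t * avg m (cut H) + t ^+ 2 / 2 * k * avg m (fun w => cut H w ^+ 2).
  rewrite -!avgZ -[X in X + _ + _](@avg_const R step card_step_gt0 m) -!avgD.
  by apply: avg_ext => w _; field.
have t1 : - (`|t| * m.+1%:R * p) <= t * avg m (cut H) <= `|t| * m.+1%:R * p.
  by rewrite -ler_norml normrM -mulrA; apply: ler_wpM2l.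
move: t1 => /andP [t1 t2].
have t20 : 0 <= t ^+ 2 / 2 by rewrite divr_ge0 ?sqr_ge0.
apply/andP; split.
  apply: (@le_trans _ _ (avg m (fun w => 1 + t * cut H w + (t * cut H w) ^+ 2 / 2 * (1 - 2 * d)))); last first.
    by apply: avg_le => w _; have /andP [] := E w.
  rewrite X -addrA lerD2l.
  have V0 : 0 <= avg m (fun w => cut H w ^+ 2) by apply: avg_ge0 => w _; exact: sqr_ge0.
  have p0 : 0 <= m.+1%:R ^+ 2 * p by rewrite mulr_ge0 ?sqr_ge0 //; apply: le_trans Hp.
  move: t1 v2 t20 V0 p0; set M := m.+1%:R ^+ 2 * p.
  move: (t ^+ 2 / 2) (avg m (fun w => cut H w ^+ 2)).
  move=> T v t1 v2 T0 v0 M0.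
  have : T * (1 - 2 * d) * (V - M) <= T * (1 - 2 * d) * v.
    by apply: ler_wpM2l => //; rewrite mulr_ge0 //; lra.
  have : 0 <= T * d * M by apply: mulr_ge0 => //; exact: mulr_ge0.
  by move: t1; set u := t * _; lra.
apply: (@le_trans _ _ (avg m (fun w => 1 + t * cut H w + (t * cut H w) ^+ 2 / 2 * (1 + 2 * d)))).
  by apply: avg_le => w _; have /andP [] := E w.
rewrite X -addrA lerD2l; apply: lerD => //.
by apply: ler_wpM2l => //; rewrite mulr_ge0 //; lra.
Qed.

End BlockMgf.

Lemma blk_leq j n m : (2 ^ j <= n)%N -> blk j n m -> (m <= n)%N.
Proof.
rewrite /blk; case: j => [|j] jn /andP [_]; first by rewrite !expn0; lia.
by move: jn; rewrite !expnS; nia.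
Qed.

(** * Moderate deviations over words *)

Section Scales.
Variable R : realType.
Variable b : nat -> R.
Hypothesis b_gt0 : forall n, 0 < b n.
Hypothesis b_oo : b @ \oo --> +oo.
Hypothesis b_small : (fun n => b n / Num.sqrt (ln (n%:R : R))) @ \oo --> (0 : R).

Definition lnn (n : nat) : R := ln n%:R.
Notation ell := lnn.

Lemma near_ell_ge K : \forall n \near \oo, K <= ell n.
Proof. exact: near_ln_ge. Qed.

Lemma near_b_ge K : \forall n \near \oo, K <= b n.
Proof. by move/cvgryPge : b_oo; apply. Qed.

Lemma near_b_small M : \forall n \near \oo, M * b n <= Num.sqrt (ell n).
Proof.
have M0 : 0 < (`|M| + 1)^-1 by rewrite invr_gt0 ltr_wpDl.
have /cvgrPdist_lt/(_ _ M0) := b_small; apply: filter_app; near=> n => H.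
have l0 : 0 < ell n by apply: lt_le_trans ltr01 _; near: n; exact: near_ell_ge.
have s0 : 0 < Num.sqrt (ell n) by rewrite sqrtr_gt0.
rewrite sub0r normrN -/(ell n) ger0_norm ?divr_ge0 ?ltW ?b_gt0 // in H.
rewrite ltr_pdivrMr // mulrC ltr_pdivlMr ?ltr_wpDl // in H.
apply: le_trans (ltW H); rewrite mulrC; apply: ler_wpM2l; first exact: ltW.
by apply: le_trans (ler_norm M) _; rewrite lerDl.
Unshelve. all: by end_near.
Qed.

Lemma near_pow_ell (K : R) k : \forall n \near \oo, K * ell n ^+ k <= n%:R.
Proof.
have [z0 Hz] := pow_le_expR K k (@ltr01 R).
have := near_ell_ge z0; apply: filter_app; near=> n => H.
apply: le_trans (Hz _ H) _; rewrite mul1r /lnn lnK // posrE ltr0n.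
by near: n; exact: nbhs_infty_gt.
Unshelve. all: by end_near.
Qed.

(* About [(ln n)^8] blocks: enough for each block to contribute only through its
   variance, few enough for the levels above the blocks to be negligible. *)
Definition depth (n : nat) : nat := trunc_log 2 (Num.truncn (ell n ^+ 8)).

Lemma depth_bounds n : 1 <= ell n ->
  (2 ^ depth n)%:R <= ell n ^+ 8 /\ ell n ^+ 8 <= 2 * (2 ^ depth n)%:R.
Proof.
move=> l1; have l8 : 1 <= ell n ^+ 8 by rewrite exprn_ege1.
have /andP [t1 t2] := truncn_itv (le_trans ler01 l8).
have t0 : (0 < Num.truncn (ell n ^+ 8))%N by rewrite truncn_gt0.
have /andP [h1 h2] := trunc_log_bounds (isT : 1 < 2)%N t0.
split; first by apply: le_trans t1; rewrite ler_nat.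
by apply: le_trans (ltW t2) _; rewrite -natrM ler_nat -expnS.
Qed.

End Scales.

Section MDP.
Variables (R : realType) (c : seq step -> R).
Hypothesis c_ge0 : forall w, 0 <= c w.
Hypothesis c_le : forall w, c w <= (size w).+1%:R.
Hypothesis chi_ge0 : forall u v, 0 <= chi c u v.
Hypothesis chi_green : forall n1 n2, exists M, forall u v,
  size u = n1 -> size v = n2 ->
  chi c u v <= 2 * (\sum_(i < n1.+1) \sum_(j < n2.+1)
     green R M (pos (drop i u) + pos (take j v))) + 1.
Notation avg := (@avg R step).
Notation ell := (@lnn R).
Notation depth := (@depth R).

Variable b : nat -> R.
Hypothesis b_gt0 : forall n, 0 < b n.
Hypothesis b_oo : b @ \oo --> +oo.
Hypothesis b_small : (fun n => b n / Num.sqrt (ln (n%:R : R))) @ \oo --> (0 : R).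

Let a := tail_scale (xi_const R).
Let Kt := tail_const (xi_const R).

Let a_gt0 : 0 < a.
Proof. by apply: tail_scale_gt0; exact: xi_const_gt0. Qed.

Let Kt_ge0 : 0 <= Kt.
Proof. exact: expR_ge0. Qed.

(** [xi_sum_tail] with [q] of order [r = sqrt (b sqrt (ln n))]: both exponents are then at least
    [k r], half of which absorbs the powers of [ln n] while the other half exceeds [M b]. *)
Lemma xi_levels_small (eps M : R) : 0 < eps -> \forall n \near \oo,
  avg n (fun w => (eps * Num.sqrt (n%:R * b n * ell n)
      < `|\sum_(i < depth n) lev i (xi c) w|)%R%:R) <= expR (- (M * b n)).
Proof.
move=> eps0.
have l20 := ln2_gt0 R.
(* With [l = ln n] and [z = l^(1/4)], [ln (l^8)] is [64 ln (sqrt z)], at most [64 sqrt z]; this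
   bounds the number of levels by [K1 sqrt r]. The 8 comes from [4 sqrt q <= 8 sqrt r]. *)
pose K1 := 64 / ln 2 : R; pose K := K1 + 8.
have K10 : 0 < K1 by rewrite divr_gt0.
have K0 : 0 < K by rewrite addr_gt0.
pose e := eps / (2 * K).
have e0 : 0 < e by rewrite divr_gt0 // mulr_gt0.
pose k := Num.min 1 (a * e).
have k0 : 0 < k by rewrite lt_min ltr01 mulr_gt0.
have k20 : 0 < k / 2 by rewrite divr_gt0.
(* [z^64 = l^16] covers one factor [2^J] for the number of levels and one for the number of
   blocks. *)
have [z0 Hz0] := pow_le_expR (4 * (1 + Kt)) 64 k20.
near=> n.
have b1 : 1 <= b n by near: n; exact: near_b_ge.
have l1 : 1 <= ell n by near: n; exact: near_ell_ge.
have lz : (Num.max z0 0) ^+ 4 <= ell n by near: n; exact: near_ell_ge.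
have bl : 1 * b n <= Num.sqrt (ell n) by near: n; exact: near_b_small.
have bM : (2 * `|M| / k) ^+ 2 * b n <= Num.sqrt (ell n) by near: n; exact: near_b_small.
have ln8 : 1 * ell n ^+ 8 <= n%:R by near: n; exact: near_pow_ell.
rewrite mul1r in bl; rewrite mul1r in ln8.
have [J1 J2] := depth_bounds l1.
move: (depth n) J1 J2 => J J1 J2.
set l := ell n in l1 lz bl bM ln8 J1 J2 *; set B := b n in b1 bl bM *.
have l0 : 0 < l by lra.
have B0 : 0 < B by lra.
pose s := Num.sqrt l; pose z := Num.sqrt s.
have s0 : 0 < s by rewrite sqrtr_gt0.
have sE : s ^+ 2 = l by rewrite sqr_sqrtr // ltW.
have z_gt0 : 0 < z by rewrite sqrtr_gt0.
have zE : z ^+ 2 = s by rewrite sqr_sqrtr // ltW.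
have s1 : 1 <= s by rewrite -[leLHS]sqrtr1 ler_wsqrtr.
have z1 : 1 <= z by rewrite -[leLHS]sqrtr1 ler_wsqrtr.
rewrite -/s in bl bM.
have z0z : z0 <= z.
  apply: le_trans (_ : Num.max z0 0 <= _); first by rewrite le_max lexx.
  rewrite -(@ler_pXn2r _ 4) ?nnegrE ?(ltW z_gt0) //; last by rewrite le_max lexx orbT.
  by rewrite (_ : 4 = 2 * 2)%N // [z ^+ _]exprM zE sE.
pose r := Num.sqrt (B * s).
have r0 : 0 < r by rewrite sqrtr_gt0 mulr_gt0.
have rE : r ^+ 2 = B * s by rewrite sqr_sqrtr // mulr_ge0 // ltW.
have rz : z <= r by rewrite ler_wsqrtr // ler_peMl // ltW.
have rs : r <= s.
  rewrite -(@ler_pXn2r _ 2) ?nnegrE ?(ltW r0) ?(ltW s0) // rE expr2.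
  by apply: ler_wpM2r => //; exact: ltW.
have rM : M * B <= k / 2 * r.
  have XB : 2 * `|M| / k * B <= r.
    rewrite -(@ler_pXn2r _ 2) ?nnegrE ?mulr_ge0 ?invr_ge0 ?(ltW k0) ?(ltW B0) ?(ltW r0) //.
    rewrite exprMn rE [B ^+ 2]expr2 mulrA [leRHS]mulrC.
    by apply: ler_wpM2r; [exact: ltW|].
  apply: (@le_trans _ _ (`|M| * B)); first by apply: ler_wpM2r; [exact: ltW|exact: ler_norm].
  have -> : `|M| * B = k / 2 * (2 * `|M| / k * B) by field; rewrite gt_eqF.
  by apply: ler_wpM2l XB; exact: ltW.
pose y := Num.sqrt r.
have y0 : 0 < y by rewrite sqrtr_gt0.
have yE : y ^+ 2 = r by rewrite sqr_sqrtr // ltW.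
pose q := (Num.truncn r).+1.
have /andP [q1 q2] := truncn_itv (ltW r0); rewrite -/q in q2.
have q3 : q%:R <= 4 * r.
  have r1 : 1 <= r by apply: le_trans rz.
  have -> : q%:R = (Num.truncn r)%:R + 1 :> R by rewrite natr1.
  by move: ((Num.truncn r)%:R) q1 r1 => u *; lra.
have sq : Num.sqrt q%:R <= 2 * y.
  rewrite -[2 * y]ger0_norm ?mulr_ge0 ?(ltW y0) // -sqrtr_sqr ler_wsqrtr // exprMn yE.
  by rewrite (_ : 2 ^+ 2 = 4) //; ring.
have NJ0 : 0 < (2 ^ J)%:R :> R by rewrite ltr0n expn_gt0.
have JK : J%:R <= K1 * y.
  rewrite /K1 mulrAC ler_pdivlMr //.
  have -> : J%:R * ln 2 = ln (2 ^ J)%:R :> R by rewrite natrX lnXn // mulr_natl.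
  apply: (@le_trans _ _ (ln (l ^+ 8))); first by rewrite ler_ln ?posrE ?exprn_gt0.
  have -> : l = Num.sqrt z ^+ 8.
    by rewrite (_ : 8 = 2 * (2 * 2))%N // !exprM sqr_sqrtr ?(ltW z_gt0) // zE sE.
  have sz0 : 0 < Num.sqrt z by rewrite sqrtr_gt0.
  rewrite !lnXn ?exprn_gt0 // -mulrnA -[_ *+ _]mulr_natl.
  apply: ler_wpM2l => //; apply: (@le_trans _ _ (Num.sqrt z)); last by rewrite ler_wsqrtr.
  by rewrite ltW // ln_sublinear.
(* The number of levels and [sqrt q] are both of order [y = sqrt r], so the sum of the shares
   reaches exactly the allowed deviation. Moreover [a th >= k r], because [r^3 <= B l]. *)
pose th := e * (Num.sqrt (B * l) / y).
have Bl0 : 0 < Num.sqrt (B * l) by rewrite sqrtr_gt0 mulr_gt0.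
have th0 : 0 <= th by rewrite /th mulr_ge0 ?(ltW e0) // divr_ge0 // ltW.
have thr : k * r <= a * th.
  apply: (@le_trans _ _ (a * e * r)).
    by apply: ler_wpM2r; [exact: ltW|rewrite /k ge_min lexx orbT].
  rewrite -mulrA; apply: ler_wpM2l; first exact: ltW.
  apply: ler_wpM2l; first exact: ltW.
  rewrite ler_pdivlMr // -(@ler_pXn2r _ 2) ?nnegrE ?mulr_ge0 ?(ltW r0) ?(ltW y0) ?(ltW Bl0) //.
  rewrite exprMn yE rE sqr_sqrtr ?mulr_ge0 ?(ltW B0) ?(ltW l0) // -sE expr2 mulrA.
  apply: ler_wpM2l => //; by rewrite mulr_ge0 // ltW.
have n0 : (0 < n)%N by rewrite -(ltr0n R); apply: lt_le_trans ln8; rewrite exprn_gt0.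
have J2n : (2 ^ J <= 2 * n)%N.
  by rewrite -(ler_nat R); apply: le_trans J1 _; apply: le_trans ln8 _; rewrite ler_nat leq_pmull.
have H := xi_sum_tail c_ge0 c_le chi_ge0 chi_green (isT : (0 < q)%N) th0 J2n.
apply: le_trans (le_trans _ H) _.
  apply: avg_le => w _.
  have T : (J%:R + 4 * Num.sqrt q%:R) * th * Num.sqrt (2 * n%:R) <= eps * Num.sqrt (n%:R * B * l).
    apply: (@le_trans _ _ (K * y * th * (2 * Num.sqrt n%:R))).
      apply: ler_pM; last 1 first.
      - rewrite sqrtrM //; apply: ler_wpM2r; first exact: sqrtr_ge0.
        rewrite -[leRHS]ger0_norm // -sqrtr_sqr ler_wsqrtr //.
        by rewrite expr2; lra.
      - by rewrite mulr_ge0 // addr_ge0 // mulr_ge0 // sqrtr_ge0.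
      - exact: sqrtr_ge0.
      apply: ler_wpM2r => //; rewrite [K * y]mulrDl; apply: lerD => //.
      by rewrite (_ : 8 * y = 4 * (2 * y)); [apply: ler_wpM2l|ring].
    rewrite le_eqVlt; apply/orP; left; apply/eqP.
    rewrite -[n%:R * B * l]mulrA [Num.sqrt (n%:R * _)]sqrtrM ?ler0n // /th /e.
    by field; rewrite ?gt_eqF //; apply/andP; split => //; rewrite gt_eqF.
  set X := `|_|; case: (ltP (eps * Num.sqrt (n%:R * B * l)) X) => h; last by [].
  by rewrite (le_lt_trans T h).
rewrite /level_tail -/a -/Kt.
have Er : expR (- q%:R) <= expR (- (k * r)) /\ expR (- (a * th)) <= expR (- (k * r)).
  rewrite !ler_expR !lerN2; split => //; apply: le_trans (ltW q2).
  by rewrite ler_piMl ?(ltW r0) // /k ge_min lexx.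
case: Er => Er1 Er2.
have Jle : J%:R <= (2 ^ J)%:R :> R by rewrite ler_nat ltnW // ltn_expl.
apply: (@le_trans _ _ ((2 ^ J)%:R * (2 * (((2 ^ J)%:R + Kt) * expR (- (k * r)))))).
  apply: ler_pM => //; first by rewrite mulr_ge0 // addr_ge0 // mulr_ge0 ?expR_ge0.
  apply: ler_wpM2l => //; rewrite mulrDl; apply: lerD; apply: ler_wpM2l => //.
apply: (@le_trans _ _ (4 * (1 + Kt) * z ^+ 64 * expR (- (k * r)))).
  rewrite [leLHS](_ : _ = (2 ^ J)%:R * 2 * ((2 ^ J)%:R + Kt) * expR (- (k * r))); last by ring.
  apply: ler_wpM2r; first exact: expR_ge0.
  have -> : z ^+ 64 = l ^+ 8 * l ^+ 8.
    by rewrite -expr2 -exprM (_ : 64 = 2 * (2 * (8 * 2)))%N // !exprM zE sE.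
  move: J1 NJ0; set N := (2 ^ J)%:R; set L := l ^+ 8 => NL N0.
  have L1 : 1 <= L by rewrite exprn_ege1.
  have : N * N <= L * L by apply: ler_pM => //; exact: ltW.
  have L0 : 0 <= L by apply: le_trans L1.
  have NLL : N <= L * L by apply: le_trans NL _; rewrite ler_peMl.
  have := mulr_ge0 L0 L0; have := mulr_ge0 (mulr_ge0 L0 L0) Kt_ge0.
  have := ler_wpM2r Kt_ge0 NLL.
  by lra.
apply: (@le_trans _ _ (expR (k / 2 * z) * expR (- (k * r)))).
  by apply: ler_wpM2r; [exact: expR_ge0|exact: Hz0].
rewrite -expRD ler_expR.
have : k / 2 * z <= k / 2 * r by apply: ler_wpM2l => //; exact: ltW.
by move: rM; rewrite mulrAC; lra.
Unshelve. all: by end_near.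
Qed.

(** The bracket bounds [(j + 1 + 5 sqrt q) / ln n] in [block_tail], [1 / a] comes from
    [theta = (ln n)^2 / a], and 3 from [sqrt (2 m) <= 3 sqrt n / (ln n)^4]. *)
Definition cut_const : R := 3 * ((ln 2)^-1 + 11) / a.
(* The exponent [lam n * cut_level n] tends to zero, while a block of length
   [n / (ln n)^8] exceeds this level with probability at most [n ^- 3]. *)
Definition cut_level (n : nat) : R := cut_const * Num.sqrt n%:R / ell n.

Lemma cut_const_gt0 : 0 < cut_const.
Proof. by rewrite divr_gt0 // mulr_gt0 // addr_gt0 // invr_gt0 ln2_gt0. Qed.

(** [fluct_tail] with [q] and [a theta] of order [(ln n)^2]. The threshold picks up a factor
    [(ln n)^3], against the [(ln n)^-4] in the size of a block, which leaves [sqrt n / ln n]. *)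
Lemma block_tail : \forall n \near \oo, forall m, blk (depth n) n m ->
  avg m (fun w => (cut_level n < `|fluct c w|)%R%:R) <= expR (- (3 * ell n)).
Proof.
have l20 := ln2_gt0 R.
pose K := (ln 2)^-1 + 11 : R.
have K0 : 0 < K by rewrite addr_gt0 // invr_gt0.
have [z0 Hz0] := pow_le_expR (2 * K * (1 + Kt)) 1 (@ltr01 R).
near=> n => m bm.
have l1 : 5 <= ell n by near: n; exact: near_ell_ge.
have lz : z0 <= ell n by near: n; exact: near_ell_ge.
have ln8 : 1 * ell n ^+ 8 <= n%:R by near: n; exact: near_pow_ell.
rewrite mul1r in ln8.
have l1' : 1 <= ell n by apply: le_trans l1; rewrite ler1n.
have [J1 J2] := depth_bounds l1'.
move: (depth n) J1 J2 bm => J J1 J2 bm.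
have n0' : 0 < n%:R :> R.
  by apply: lt_le_trans ln8; rewrite exprn_gt0 // (lt_le_trans ltr01).
have n0 : (0 < n)%N by rewrite -(ltr0n R).
have nE : expR (ell n) = n%:R by rewrite /lnn lnK // posrE.
have J2n : (2 ^ J <= n)%N by rewrite -(ler_nat R); apply: le_trans ln8.
have m0 := blk_gt0 J2n bm; have m2 := blk_le J2n bm.
set l := ell n in l1 lz ln8 l1' J1 J2 nE *.
have l0 : 0 < l by lra.
pose q := (Num.truncn (l ^+ 2)).+1.
have l20' : 0 <= l ^+ 2 by rewrite sqr_ge0.
have /andP [q1 q2] := truncn_itv l20'; rewrite -/q in q2.
have q3 : q%:R <= 4 * l ^+ 2.
  have l2 : 1 <= l ^+ 2 by rewrite exprn_ege1.
  have -> : q%:R = (Num.truncn (l ^+ 2))%:R + 1 :> R by rewrite natr1.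
  by move: ((Num.truncn (l ^+ 2))%:R) q1 l2 => u *; lra.
have sq : Num.sqrt q%:R <= 2 * l.
  rewrite -[2 * l]ger0_norm ?mulr_ge0 ?(ltW l0) // -sqrtr_sqr ler_wsqrtr // exprMn.
  by rewrite (_ : 2 ^+ 2 = 4) //; ring.
pose th := l ^+ 2 / a.
have th0 : 0 <= th by rewrite /th divr_ge0 ?sqr_ge0 ?(ltW a_gt0).
pose j := trunc_log 2 m.
have mn : (m <= n)%N := blk_leq J2n bm.
have jl : j.+1%:R <= ((ln 2)^-1 + 1) * l.
  have H : j%:R * ln 2 <= l.
    apply: le_trans (trunc_log_ln R m0) _.
    by rewrite /l /lnn ler_ln ?posrE ?ltr0n // ler_nat.
  rewrite -natr1 mulrDl mul1r; apply: lerD => //.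
  by rewrite mulrC ler_pdivlMr.
have jK : j.+1%:R + 5 * Num.sqrt q%:R <= K * l by rewrite /K; lra.
have H := fluct_tail c_ge0 c_le chi_ge0 chi_green m0 (isT : (0 < q)%N) th0.
apply: le_trans (le_trans _ H) _.
  apply: avg_le => w _; rewrite -/j.
  have T : (j.+1%:R + 5 * Num.sqrt q%:R) * th * Num.sqrt (2 * m%:R) <= cut_level n.
    have mR : m%:R * l ^+ 8 <= 4 * n%:R.
      apply: (@le_trans _ _ (m%:R * (2 * (2 ^ J)%:R))); first by apply: ler_wpM2l.
      rewrite mulrCA -!natrM ler_nat (_ : 4 * n = 2 * (2 * n))%N; last by rewrite mulnA.
      by rewrite leq_mul2l /= ltnW.
    have sm : Num.sqrt (2 * m%:R) <= 3 * Num.sqrt n%:R / l ^+ 4.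
      rewrite ler_pdivlMr ?exprn_gt0 // -(@ler_pXn2r _ 2) ?nnegrE ?mulr_ge0 ?sqrtr_ge0 ?exprn_ge0 ?(ltW l0) //.
      rewrite [leLHS]exprMn [leRHS]exprMn !sqr_sqrtr ?mulr_ge0 ?ler0n // -exprM -mulrA (_ : 3 ^+ 2 = 9); last by ring.
      by move: mR n0'; rewrite (_ : 4 * 2 = 8)%N //; move: (m%:R * _) => u; lra.
    apply: (@le_trans _ _ (K * l * th * (3 * Num.sqrt n%:R / l ^+ 4))).
      apply: ler_pM; [|exact: sqrtr_ge0|exact: ler_wpM2r|exact: sm].
      by rewrite mulr_ge0 // addr_ge0 // mulr_ge0 // sqrtr_ge0.
    rewrite /cut_level /cut_const -/K /th -/l le_eqVlt; apply/orP; left; apply/eqP.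
    by field; rewrite !gt_eqF.
  set X := `|_|; case: (ltP (cut_level n) X) => h; last by [].
  by rewrite (le_lt_trans T h).
rewrite /level_tail -/a -/Kt -/j.
have aE : a * th = l ^+ 2 by rewrite /th mulrCA mulfV ?mulr1 // gt_eqF.
rewrite aE.
have E1 : expR (- q%:R) <= expR (- l ^+ 2) by rewrite ler_expR lerN2 ltW.
have jl' : j.+1%:R <= K * l.
  by apply: le_trans jl _; apply: ler_wpM2r; [exact: ltW|rewrite /K; lra].
apply: (@le_trans _ _ (K * l * (2 * ((n%:R + Kt) * expR (- l ^+ 2))))).
  apply: ler_pM => //; first by rewrite mulr_ge0 // addr_ge0 // mulr_ge0 ?expR_ge0.
  apply: ler_wpM2l => //; rewrite mulrDl lerD2r.
  by apply: ler_pM => //; rewrite ?expR_ge0 // ler_nat.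
have n1 : 1 <= n%:R :> R by rewrite ler1n.
apply: (@le_trans _ _ (2 * K * (1 + Kt) * l ^+ 1 * (n%:R * expR (- l ^+ 2)))).
  rewrite expr1 !mulrA; apply: ler_wpM2r; first exact: expR_ge0.
  have Kl0 : 0 <= K * l by rewrite mulr_ge0 // ltW.
  have : 0 <= K * l * Kt * (n%:R - 1) by rewrite !mulr_ge0 ?subr_ge0 // ltW.
  by lra.
apply: (@le_trans _ _ (expR (1 * l) * (n%:R * expR (- l ^+ 2)))).
  by apply: ler_wpM2r; [rewrite mulr_ge0 ?expR_ge0|exact: Hz0].
rewrite -nE -!expRD ler_expR.
(* One [expR l] pays for the logarithmic factor and another is [n] itself; [l^2 - 2 l >= 3 l]
   remains. *)
have l5 : 5 * l <= l ^+ 2 by rewrite expr2 ler_pM2r.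
by move: l5; move: (l ^+ 2) => u; lra.
Unshelve. all: by end_near.
Qed.

End MDP.

(** * The limiting cumulant generating function *)

Lemma quad_upper (R : realFieldType) (T s e : R) : 0 <= T -> 0 < s -> 0 <= e -> e <= 8^-1 ->
  T / 2 * ((1 + e) ^+ 2 * (s + e)) <= T * s / 2 + e * ((1 + T) * (2 * s + 2)).
Proof.
move=> T0 s0 e0 e8.
have H : (1 + e) ^+ 2 * (s + e) <= s + e * (3 * s + 2).
  rewrite expr2; have : 0 <= e * e by rewrite mulr_ge0.
  have : e * e <= e * 8^-1 by apply: ler_wpM2l.
  have : e * e * (s + e) <= e * 8^-1 * (s + e) by apply: ler_wpM2r; [lra|apply: ler_wpM2l].
  have : 0 <= e * s by rewrite mulr_ge0 // ltW.
  by nra.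
have H2 : T / 2 * ((1 + e) ^+ 2 * (s + e)) <= T / 2 * (s + e * (3 * s + 2)).
  by apply: ler_wpM2l => //; lra.
apply: le_trans H2 _; have : 0 <= e * s by rewrite mulr_ge0 // ltW.
have : 0 <= T * (e * s) by rewrite !mulr_ge0 // ltW.
have : 0 <= T * e by rewrite mulr_ge0.
by nra.
Qed.

(** The four factors [1 - e] stand for the quadratic expansion, the comparison of [ln m] with
    [ln n], the total length of the blocks, and the passage from [1 + u] to an exponential. *)
Lemma quad_lower (R : realFieldType) (T s e : R) : 0 <= T -> 0 < s -> 0 <= e -> e <= 8^-1 -> e <= s ->
  T * s / 2 - e * ((1 + T) * (2 * s + 1)) <= T / 2 * ((1 - e) ^+ 4 * (s - e)).
Proof.
move=> T0 s0 e0 e8 es.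
have H4 : 1 - 4 * e <= (1 - e) ^+ 4.
  by apply: le_trans (bernoulli_le 4 e0 _); [lra|lra].
have H : s - e * (4 * s + 1) <= (1 - e) ^+ 4 * (s - e).
  apply: (@le_trans _ _ ((1 - 4 * e) * (s - e))); last by apply: ler_wpM2r => //; lra.
  have : 0 <= e * e by rewrite mulr_ge0.
  by nra.
apply: (@le_trans _ _ (T / 2 * (s - e * (4 * s + 1)))); last by apply: ler_wpM2l => //; lra.
have : 0 <= e * s by rewrite mulr_ge0 // ltW.
have : 0 <= T * (e * s) by rewrite !mulr_ge0 // ltW.
have : 0 <= T * e by rewrite mulr_ge0.
by nra.
Qed.

Lemma half_ratio (R : realFieldType) (u l e : R) :
  0 < l -> 0 < e -> 2 * u / e <= l -> u / l <= e / 2.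
Proof. by move=> l0 e0; rewrite ler_pdivrMr // ler_pdivrMr // => h; lra. Qed.

(** That is, [x (1 - e) <= x / (1 + x)], the exponent of [expR_1D_ge]. *)
Lemma damping (R : realFieldType) (x e : R) :
  0 <= x -> x <= e -> e <= 1 -> x * (1 - e) * (1 + x) <= x.
Proof.
move=> x0 xe e1; rewrite -mulrA ler_piMr //.
have : 0 <= e * x by rewrite mulr_ge0 // (le_trans x0).
by lra.
Qed.

Lemma inv_1B_le (R : realFieldType) (x : R) :
  0 <= x -> x <= 2^-1 -> 1 <= (1 + 2 * x) * (1 - x).
Proof. by move=> x0 x2; have : x * x <= 2^-1 * x by [apply: ler_wpM2r]; lra. Qed.

Section Limit.
Variables (R : realType) (c : seq step -> R).
Hypothesis c_ge0 : forall w, 0 <= c w.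
Hypothesis c_le : forall w, c w <= (size w).+1%:R.
Hypothesis chi_ge0 : forall u v, 0 <= chi c u v.
Hypothesis chi_green : forall n1 n2, exists M, forall u v,
  size u = n1 -> size v = n2 ->
  chi c u v <= 2 * (\sum_(i < n1.+1) \sum_(j < n2.+1)
     green R M (pos (drop i u) + pos (take j v))) + 1.
Notation avg := (@avg R step).
Notation ell := (@lnn R).
Notation depth := (@depth R).

Variable b : nat -> R.
Hypothesis b_gt0 : forall n, 0 < b n.
Hypothesis b_oo : b @ \oo --> +oo.
Hypothesis b_small : (fun n => b n / Num.sqrt (ln (n%:R : R))) @ \oo --> (0 : R).

Variable sigma2 : R.
Hypothesis sigma2_gt0 : 0 < sigma2.
Hypothesis var_lim :
  (fun n => avg n (fun w => fluct c w ^+ 2) / (n%:R * ell n)) @ \oo --> sigma2.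

(** Normalised by [lam n * sqrt (n b ln n) = b n], so that deviations become multiples of the speed
    [b n]. *)
Definition lam (n : nat) : R := Num.sqrt (b n / (n%:R * ell n)).
Definition core (n : nat) (w : seq step) : R :=
  lev (depth n) (cut c (cut_level R n)) w.

(* [n] and a block length [m] differ by a power of [ln n] only, so that [ln m]
   and [ln n] are equivalent. *)
Lemma near_scales (theta e : R) : 0 < e -> e <= 8^-1 -> \forall n \near \oo,
  [/\ [/\ 1 <= b n, b n <= ell n, 1 <= ell n & 2 * (2 * `|theta| + 2 * theta ^+ 2) <= n%:R],
      [/\ (2 ^ depth n)%:R <= e * n%:R :> R, `|theta * lam n| * cut_level R n <= e / 2,
          theta ^+ 2 * b n / (2 ^ depth n)%:R * sigma2 <= e & (2 ^ depth n <= n)%N] &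
      forall m, blk (depth n) n m ->
      [/\ avg m (fun w => (cut_level R n < `|fluct c w|)%R%:R) <= n%:R ^- 3,
          (1 - e) * n%:R <= m%:R * (2 ^ depth n)%:R <= (1 + e) * n%:R,
          (sigma2 - e) * (m%:R * ((1 - e) * ell n)) <= avg m (fun w => fluct c w ^+ 2)
          & avg m (fun w => fluct c w ^+ 2) <= (sigma2 + e) * (m%:R * ell n)]].
Proof.
move=> e0 e8.
have /cvgrPdist_lt/(_ _ e0)[N0 _ HN0] := var_lim.
(* [2 (ln n)^8 <= n^e] is what makes [ln m >= (1 - e) ln n] for every block length [m]. *)
have [z0 Hz0] := pow_le_expR 2 8 e0.
near=> n.
have b1 : 1 <= b n by near: n; exact: near_b_ge.
have l1 : 1 <= ell n by near: n; exact: near_ell_ge.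
have lz : z0 <= ell n by near: n; exact: near_ell_ge.
have bs : 1 * b n <= Num.sqrt (ell n) by near: n; exact: near_b_small.
have le1 : 2 * `|theta| * cut_const R / e <= ell n by near: n; exact: near_ell_ge.
have le2 : 2 * theta ^+ 2 * sigma2 / e <= ell n by near: n; exact: near_ell_ge.
(* As there are at most [(ln n)^8] blocks, all of them are longer than [N0], and the variance limit
   applies to each. *)
have nN : (N0.+1%:R) * ell n ^+ 8 <= n%:R by near: n; exact: near_pow_ell.
have ne : e^-1 * ell n ^+ 8 <= n%:R by near: n; exact: near_pow_ell.
have nth : 2 * (2 * `|theta| + 2 * theta ^+ 2) * ell n ^+ 0 <= n%:R by near: n; exact: near_pow_ell.
have Hb : forall m, blk (depth n) n m ->
  avg m (fun w => (cut_level R n < `|fluct c w|)%R%:R) <= expR (- (3 * ell n)).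
  by near: n; exact: (block_tail c_ge0 c_le chi_ge0 chi_green).
have [J1 J2] := depth_bounds l1.
rewrite mul1r in bs; rewrite expr0 mulr1 in nth.
have l0 : 0 < ell n by apply: lt_le_trans l1.
have l8 : 0 < ell n ^+ 8 by rewrite exprn_gt0.
have n0 : 0 < n%:R :> R.
  by apply: lt_le_trans nN; rewrite mulr_gt0.
have n0' : (0 < n)%N by rewrite -(ltr0n R).
have nE : expR (ell n) = n%:R by rewrite /lnn lnK // posrE.
have bl : b n <= ell n.
  apply: le_trans bs _; rewrite -[leRHS]ger0_norm ?(ltW l0) // -sqrtr_sqr ler_wsqrtr //.
  by rewrite expr2 ler_peMr // ltW.
have lam2 : lam n ^+ 2 = b n / (n%:R * ell n).
  by rewrite sqr_sqrtr // divr_ge0 ?mulr_ge0 // ltW.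
have cl0 : 0 <= cut_level R n.
  by rewrite /cut_level divr_ge0 ?(ltW l0) // mulr_ge0 ?sqrtr_ge0 // ltW // cut_const_gt0.
have tH : `|theta * lam n| * cut_level R n <= e / 2.
  apply: (@le_trans _ _ (`|theta| * cut_const R / ell n)); last first.
    by apply: half_ratio => //; rewrite mulrA.
  have cc0 := cut_const_gt0 R; rewrite /cut_level.
  move: (cut_const R) cc0 => k k0.
  rewrite normrM -[leLHS]mulrA -[leRHS]mulrA; apply: ler_wpM2l => //.
  rewrite -(@ler_pXn2r _ 2) ?nnegrE ?mulr_ge0 ?invr_ge0 ?sqrtr_ge0 ?(ltW l0) ?(ltW k0) //.
  rewrite [leLHS]exprMn real_normK ?num_real // lam2 !expr_div_n [(_ * Num.sqrt n%:R) ^+ 2]exprMn sqr_sqrtr ?ler0n //.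
  rewrite [leLHS](_ : _ = b n / ell n * (k ^+ 2 / ell n ^+ 2)); last first.
    by field; rewrite !gt_eqF.
  by rewrite ler_piMl ?divr_ge0 ?sqr_ge0 // ler_pdivrMr // mul1r.
move: (depth n) J1 J2 Hb => J J1 J2 Hb.
have N0' : 0 < (2 ^ J)%:R :> R by rewrite ltr0n expn_gt0.
have Je : (2 ^ J)%:R <= e * n%:R :> R.
  by apply: le_trans J1 _; rewrite -ler_pdivrMl.
have Jn : (2 ^ J <= n)%N.
  rewrite -(ler_nat R); apply: le_trans Je _; rewrite ler_piMl ?(ltW n0) //.
  by apply: le_trans e8 _; rewrite invf_le1 // ler1n.
split; first by split.
  split => //.
  rewrite mulrAC ler_pdivrMr //.
  apply: (@le_trans _ _ (theta ^+ 2 * ell n * sigma2)).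
    by apply: ler_wpM2r; [exact: ltW|apply: ler_wpM2l; rewrite ?sqr_ge0].
  rewrite ler_pdivrMr // in le2.
  have l2 : ell n * ell n <= ell n ^+ 8.
    by rewrite -expr2; apply: ler_weXn2l.
  have : theta ^+ 2 * sigma2 * 2 * ell n <= e * (ell n * ell n).
    by rewrite mulrA; apply: ler_wpM2r; [exact: ltW|move: le2; rewrite mulrC; lra].
  have : e * (ell n * ell n) <= e * (2 * (2 ^ J)%:R).
    by apply: ler_wpM2l; [exact: ltW|apply: le_trans l2 J2].
  move: (theta ^+ 2) (ell n) ((2 ^ J)%:R) => t l N; lra.
move=> m bm.
have := bm; rewrite /blk => /andP [bm1 bm2].
have m_lo : (1 - e) * n%:R <= m%:R * (2 ^ J)%:R.
  have : n%:R <= m%:R * (2 ^ J)%:R + (2 ^ J)%:R :> R.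
    by rewrite -natrM -natrD ler_nat ltnW // addnC -mulSn.
  by move: Je; lra.
have m_hi : m%:R * (2 ^ J)%:R <= (1 + e) * n%:R.
  have : m%:R * (2 ^ J)%:R <= n%:R + (2 ^ J)%:R :> R.
    by rewrite -natrM -natrD ler_nat ltnW.
  by move: Je; lra.
have mN : (N0 <= m)%N.
  have : (N0.+1 * 2 ^ J <= n)%N.
    rewrite -(ler_nat R) natrM; apply: le_trans nN; apply: ler_wpM2l => //.
  by move=> /leq_ltn_trans/(_ bm1); rewrite ltn_pmul2r ?expn_gt0 // ltnS => /ltnW.
have m0 := blk_gt0 Jn bm; have mn := blk_leq Jn bm.
have m0' : 0 < m%:R :> R by rewrite ltr0n.
have lm1 : ell m <= ell n by rewrite /lnn ler_ln ?posrE // ler_nat.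
have lm2 : (1 - e) * ell n <= ell m.
  rewrite /lnn -ler_expR lnK ?posrE // mulrBl mul1r expRD nE -/(ell n).
  rewrite expRN ler_pdivrMr ?expR_gt0 //.
  apply: (@le_trans _ _ (m%:R * (2 * ell n ^+ 8))); last by apply: ler_wpM2l => //; exact: Hz0.
  rewrite mulrCA -ler_pdivrMl //; apply: le_trans (le_trans m_lo _).
    by apply: ler_wpM2r; [exact: ltW|lra].
  exact: ler_wpM2l.
have lm0 : 0 < ell m.
  by apply: lt_le_trans lm2; rewrite mulr_gt0 //; lra.
have ml0 : 0 < m%:R * ell m by rewrite mulr_gt0.
set V := avg m (fun w => fluct c w ^+ 2).
have : `|sigma2 - V / (m%:R * ell m)| < e by apply: HN0.
rewrite ltr_norml => /andP [V1 V2].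
have V3 : V <= (sigma2 + e) * (m%:R * ell m).
  rewrite -ler_pdivrMr //; move: V1; lra.
have V4 : (sigma2 - e) * (m%:R * ell m) <= V.
  rewrite -ler_pdivlMr //; move: V2; lra.
have V0 : 0 <= V by apply: avg_ge0 => w _; exact: sqr_ge0.
split.
- apply: le_trans (Hb _ bm) _.
  by rewrite -nE expRN -expRM_natl.
- by rewrite m_lo m_hi.
- case: (lerP e sigma2) => es.
    apply: le_trans V4; apply: ler_wpM2l; first by rewrite subr_ge0.
    by apply: ler_wpM2l => //; exact: ltW.
  apply: le_trans V0; rewrite mulr_le0_ge0 ?subr_le0 ?(ltW es) //.
  by rewrite !mulr_ge0 ?(ltW l0) ?subr_ge0 //; lra.
apply: le_trans V3 _; apply: ler_wpM2l; first by rewrite addr_ge0 // ltW.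
by apply: ler_wpM2l => //; exact: ltW.
Unshelve. all: by end_near.
Qed.

(** The blocks are independent, so the moment is a product of [2 ^ depth n] factors close to
    [1 + sigma2 S], where [2 ^ depth n] times [S] is [theta^2 b n / 2]. As [sigma2 S] is small, the
    product is nearly the exponential of the sum. *)
Lemma mgf_limit (theta eta : R) : 0 < eta -> \forall n \near \oo,
  expR (b n * (theta ^+ 2 * sigma2 / 2 - eta))
    <= avg n (fun w => expR (theta * (lam n * core n w)))
    <= expR (b n * (theta ^+ 2 * sigma2 / 2 + eta)).
Proof.
move=> eta0; pose T := theta ^+ 2.
have T0 : 0 <= T := sqr_ge0 _.
(* The lower bound loses [2 sigma2 + 1] in [quad_lower] and [8 = 2 * 4] through [2 N e0']; the upper
   bound loses less. *)
have D0 : 0 < (1 + T) * (2 * sigma2 + 9) by apply: mulr_gt0; [lra|move: sigma2_gt0; lra].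
pose e : R := Num.min 8^-1 (Num.min sigma2 (eta / ((1 + T) * (2 * sigma2 + 9)))).
have e0 : 0 < e by rewrite /e !lt_min invr_gt0 sigma2_gt0 (divr_gt0 eta0 D0) ltr0n.
have e8 : e <= 8^-1 by rewrite ge_min lexx.
have es : e <= sigma2 by rewrite !ge_min lexx !orbT.
have eeta : e * ((1 + T) * (2 * sigma2 + 9)) <= eta.
  by rewrite -ler_pdivlMr // !ge_min lexx !orbT.
have e1 : e <= 1 by lra.
have := near_scales theta e0 e8; apply: filter_app; near=> n.
move=> [[b1 bl l1 nth] [Je tH tu Jn] Hb].
have n0 : (0 < n)%N by apply: leq_trans Jn; rewrite expn_gt0.
have n0' : 0 < n%:R :> R by rewrite ltr0n.
have n1 : 1 <= n%:R :> R by rewrite ler1n.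
have l0 : 0 < ell n by apply: lt_le_trans l1.
have bn0 := b_gt0 n.
have lam2 : lam n ^+ 2 = b n / (n%:R * ell n).
  by rewrite sqr_sqrtr // divr_ge0 ?mulr_ge0 // ltW.
have lam1 : lam n <= 1.
  rewrite -[leRHS]sqrtr1 ler_wsqrtr // ler_pdivrMr ?mulr_gt0 // mul1r.
  by apply: le_trans bl _; rewrite ler_peMl // ltW.
have cl0 : 0 <= cut_level R n.
  by rewrite /cut_level divr_ge0 ?(ltW l0) // mulr_ge0 ?sqrtr_ge0 // ltW // cut_const_gt0.
set t := theta * lam n in tH.
have t2 : t ^+ 2 = T * b n / (n%:R * ell n) by rewrite exprMn lam2 mulrA.
have t1 : `|t| <= `|theta|.
  by rewrite normrM ler_piMr // ger0_norm // sqrtr_ge0.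
have tT : t ^+ 2 <= T.
  by rewrite -(real_normK (num_real t)) /T -(real_normK (num_real theta)); apply: lerXn2r; rewrite ?nnegrE.
rewrite /core; move: (depth n) Je tu Jn Hb => J Je tu Jn Hb.
set N : R := (2 ^ J)%:R in Je tu Hb.
have N0 : 0 < N by rewrite ltr0n expn_gt0.
(* Truncation error of one block: its probability [n^-3] meets [m + 1 <= 2 n] at most squared.
   Summed over the blocks it is negligible because [2^J <= e n]. *)
pose e0' := (2 * `|theta| + 2 * T) / n%:R.
have e0'0 : 0 <= e0' by rewrite divr_ge0 // addr_ge0 // mulr_ge0.
have e0'2 : e0' <= 2^-1 by rewrite ler_pdivrMr // ler_pdivlMl.
have Ne0 : N * e0' <= 4 * (1 + T) * e * b n.
  apply: (@le_trans _ _ (e * (2 * `|theta| + 2 * T))).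
    rewrite /e0' mulrA ler_pdivrMr // mulrAC; apply: ler_wpM2r => //.
    by rewrite addr_ge0 // mulr_ge0.
  have th1 : `|theta| <= 1 + T.
    rewrite /T -(real_normK (num_real theta)); move: (normr_ge0 theta).
    by move: `|theta| => x x0; nra.
  apply: (@le_trans _ _ (4 * (1 + T) * e)); last by rewrite ler_peMr // !mulr_ge0 ?addr_ge0 // ltW.
  rewrite mulrC; apply: ler_wpM2r; [exact: ltW|lra].
pose S := t ^+ 2 / 2 * (n%:R * ell n / N).
have SE : S = T / 2 * (b n / N) by rewrite /S t2; field; rewrite !gt_eqF.
have S0 : 0 <= S by rewrite SE; apply: mulr_ge0; apply: divr_ge0; rewrite ?(ltW bn0) ?(ltW N0).
have t22 : 0 <= t ^+ 2 / 2 by rewrite divr_ge0 ?sqr_ge0.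
have err m : blk J n m ->
  `|t| * m.+1%:R * n%:R ^- 3 + t ^+ 2 / 2 * (m.+1%:R ^+ 2 * n%:R ^- 3) <= e0'.
  move=> bm; have mn := blk_leq Jn bm.
  have m2 : m.+1%:R <= 2 * n%:R :> R by rewrite -natrM ler_nat mul2n -addnn -addn1 leq_add.
  have n3 : 0 <= n%:R ^- 3 :> R by rewrite invr_ge0 exprn_ge0.
  apply: (@le_trans _ _ (`|theta| * (2 * n%:R) * n%:R ^- 3 + T / 2 * ((2 * n%:R) ^+ 2 * n%:R ^- 3))).
    apply: lerD.
      by apply: ler_wpM2r => //; apply: ler_pM.
    apply: ler_pM => //.
      by apply: ler_wpM2r.
    by apply: ler_wpM2r => //; apply: lerXn2r; rewrite ?nnegrE // mulr_ge0.
  rewrite /e0' [leRHS]mulrDl; apply: lerD.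
    rewrite (_ : _ * _ = 2 * `|theta| / n%:R * n%:R^-1); last by field; rewrite gt_eqF.
    by rewrite ler_piMr ?divr_ge0 ?mulr_ge0 // invf_le1.
  by rewrite le_eqVlt; apply/orP; left; apply/eqP; field; rewrite gt_eqF.
have e22 : e / 2 <= 2^-1 by lra.
have mgf m (bm : blk J n m) := block_mgf c_ge0 c_le cl0 (ltW (divr_gt0 e0 (ltr0n R 2)))
   e22 tH (let: And4 h _ _ _ := Hb m bm in h).
have E w : theta * (lam n * lev J (cut c (cut_level R n)) w)
   = lev J (fun u => t * cut c (cut_level R n) u) w by rewrite levZ mulrA.
have -> : avg n (fun w => expR (theta * (lam n * lev J (cut c (cut_level R n)) w)))
   = avg n (fun w => expR (lev J (fun u => t * cut c (cut_level R n) u) w)).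
  by apply: avg_ext => w _; rewrite E.
have ed : 2 * (e / 2) = e by field.
have mS m : blk J n m -> (1 - e) * S <= t ^+ 2 / 2 * (m%:R * ell n) <= (1 + e) * S.
  move=> bm; have [_ /andP [h1 h2] _ _] := Hb m bm.
  have -> : t ^+ 2 / 2 * (m%:R * ell n) = t ^+ 2 / 2 * (ell n / N) * (m%:R * N).
    by field; rewrite gt_eqF.
  have q0 : 0 <= t ^+ 2 / 2 * (ell n / N) by rewrite mulr_ge0 // divr_ge0 // ltW.
  have SE' k : k * S = t ^+ 2 / 2 * (ell n / N) * (k * n%:R) by rewrite /S; field; rewrite gt_eqF.
  by rewrite !SE'; apply/andP; split; apply: ler_wpM2l.
apply/andP; split.
  (* A lower bound for the variance term of a block. From [u0 <= e] follows [1 + u0 - e0' >= (1 +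
     u0)(1 - e0') >= expR (u0 (1 - e) - 2 e0')], by [expR_1D_ge] and [inv_1B_le]. *)
  pose u0 := (1 - e) * (sigma2 - e) * ((1 - e) * ((1 - e) * S)).
  have c1 : 0 <= 1 - e by lra.
  have c2 : 0 <= sigma2 - e by lra.
  have u00 : 0 <= u0 by apply: mulr_ge0; [exact: mulr_ge0|apply: mulr_ge0 => //; exact: mulr_ge0].
  have u0e : u0 <= e.
    apply: le_trans tu; rewrite -/T.
    have -> : T * b n / N * sigma2 = 2 * sigma2 * S by rewrite SE; field; rewrite gt_eqF.
    have : (1 - e) * (sigma2 - e) <= sigma2 by nra.
    have : (1 - e) * ((1 - e) * S) <= S.
      have : (1 - e) * S <= S by rewrite ler_piMl //; lra.
      have : (1 - e) * ((1 - e) * S) <= (1 - e) * S by rewrite ler_piMl ?(mulr_ge0 c1 S0) //; lra.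
      by lra.
    have X0 : 0 <= (1 - e) * ((1 - e) * S) by apply: mulr_ge0 => //; exact: mulr_ge0.
    have Y0 : 0 <= (1 - e) * (sigma2 - e) by rewrite mulr_ge0.
    rewrite /u0; move: X0 Y0; set X := (1 - e) * (_ * _); set Y := (1 - e) * _ => X0 Y0 h1 h2.
    have : Y * X <= sigma2 * S by apply: ler_pM.
    have : 0 <= sigma2 * S by rewrite mulr_ge0 ?(ltW sigma2_gt0).
    by lra.
  pose B := expR (u0 * (1 - e) - 2 * e0').
  have HB m : blk J n m -> B <= avg m (fun u => expR (t * cut c (cut_level R n) u)).
    move=> bm; have /andP [h _] := mgf m bm; apply: le_trans h.
    have [_ _ V1 _] := Hb m bm; have /andP [mS1 _] := mS m bm; have er := err m bm.
    set V := avg m (fun w => fluct c w ^+ 2) in V1 *.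
    have uV : u0 <= t ^+ 2 / 2 * (1 - 2 * (e / 2)) * V.
      rewrite ed; apply: (@le_trans _ _ (t ^+ 2 / 2 * (1 - e) * ((sigma2 - e) * (m%:R * ((1 - e) * ell n))))).
        rewrite (_ : t ^+ 2 / 2 * (1 - e) * _ = (1 - e) * (sigma2 - e) * ((1 - e) * (t ^+ 2 / 2 * (m%:R * ell n)))); last by ring.
        by apply: ler_wpM2l; [rewrite mulr_ge0|apply: ler_wpM2l].
      by apply: ler_wpM2l => //; rewrite mulr_ge0.
    apply: (@le_trans _ _ (1 + u0 - e0')); last by lra.
    rewrite /B expRD; apply: (@le_trans _ _ ((1 + u0) * (1 - e0'))); last first.
      by move: (mulr_ge0 u00 e0'0); move: (u0) (e0') => x y; lra.
    apply: ler_pM; rewrite ?expR_ge0 //.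
      by apply: le_trans (expR_1D_ge u00); rewrite ler_expR ler_pdivlMr ?ltr_pwDl // damping.
    rewrite expRN -[leRHS]invrK lef_pV2 ?posrE ?invr_gt0 ?expR_gt0 //; last by lra.
    apply: le_trans (expR_ge1Dx _).
    rewrite -[leLHS]mul1r ler_pdivrMr; last by lra.
    exact: inv_1B_le.
  apply: le_trans (avg_expR_lev_ge card_step_gt0 (expR_ge0 _) HB).
  rewrite /B -expRM_natl ler_expR -/N.
  have Lw : T * sigma2 / 2 - e * ((1 + T) * (2 * sigma2 + 1)) <= T / 2 * ((1 - e) ^+ 4 * (sigma2 - e)).
    by apply: quad_lower => //; exact: ltW.
  have EQ : N * (u0 * (1 - e) - 2 * e0') = b n * (T / 2 * ((1 - e) ^+ 4 * (sigma2 - e))) - 2 * (N * e0').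
    by rewrite /u0 SE; field; rewrite gt_eqF.
  rewrite EQ.
  have h3 := ler_wpM2l (ltW bn0) Lw.
  have h4 := ler_wpM2l (ltW bn0) eeta.
  by move: h3 h4 Ne0; rewrite -/T; move: (N * e0') => y; lra.
pose B := expR (e0' + (1 + e) * (sigma2 + e) * ((1 + e) * S)).
have HB m : blk J n m -> avg m (fun u => expR (t * cut c (cut_level R n) u)) <= B.
  move=> bm; have /andP [_ h] := mgf m bm; apply: le_trans h _.
  have [_ _ _ V1] := Hb m bm; have /andP [_ mS1] := mS m bm; have er := err m bm.
  set V := avg m (fun w => fluct c w ^+ 2) in V1 *.
  apply: le_trans (expR_ge1Dx _) _; rewrite ler_expR; apply: lerD.
    apply: le_trans er; rewrite lerDl mulr_ge0 // mulr_ge0 ?sqr_ge0 // invr_ge0 exprn_ge0 //.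
  rewrite ed; apply: (@le_trans _ _ (t ^+ 2 / 2 * (1 + e) * ((sigma2 + e) * (m%:R * ell n)))).
    by apply: ler_wpM2l => //; rewrite mulr_ge0 //; lra.
  rewrite (_ : t ^+ 2 / 2 * (1 + e) * _ = (1 + e) * (sigma2 + e) * (t ^+ 2 / 2 * (m%:R * ell n))); last by ring.
  by apply: ler_wpM2l => //; rewrite mulr_ge0 ?addr_ge0 // ltW.
apply: le_trans (avg_expR_lev_le card_step_gt0 (expR_ge0 _) HB) _.
rewrite /B -expRM_natl ler_expR -/N.
have Up : T / 2 * ((1 + e) ^+ 2 * (sigma2 + e)) <= T * sigma2 / 2 + e * ((1 + T) * (2 * sigma2 + 2)).
  by apply: quad_upper => //; exact: ltW.
have EQ : N * (e0' + (1 + e) * (sigma2 + e) * ((1 + e) * S)) = b n * (T / 2 * ((1 + e) ^+ 2 * (sigma2 + e))) + N * e0'.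
  by rewrite SE; field; rewrite gt_eqF.
rewrite EQ.
have h3 := ler_wpM2l (ltW bn0) Up.
have h4 := ler_wpM2l (ltW bn0) eeta.
have h5 : 0 <= b n * (e * (1 + T)) by rewrite !mulr_ge0 ?addr_ge0 // ltW.
by move: h3 h4 h5 Ne0; rewrite -/T; move: (N * e0') => y; lra.
Unshelve. all: by end_near.
Qed.

Notation dev n := (Num.sqrt (n%:R * b n * ell n)).

(** Unless some block is truncated, the difference is the sum of the upper levels, treated in
    [xi_levels_small]. A truncation occurs with probability at most [n * n^-3 <= 1 / n], below
    [expR (- M b)] because [b] is much smaller than [ln n]. *)
Lemma core_close (eps M : R) : 0 < eps -> \forall n \near \oo,
  avg n (fun w => (eps * dev n < `|fluct c w - core n w|)%R%:R) <= expR (- (M * b n)).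
Proof.
move=> eps0.
have e80 : 0 < 8^-1 :> R by [].
have := near_scales 0 e80 (lexx _).
have := xi_levels_small c_ge0 c_le chi_ge0 chi_green b_gt0 b_oo b_small (M + 1) eps0.
apply: filter_app2; near=> n => S1 [[b1 bl l1 _] [_ _ _ Jn] Hb].
have bM : (M + 1) * b n <= Num.sqrt (ell n) by near: n; exact: near_b_small.
have n0 : (0 < n)%N by apply: leq_trans Jn; rewrite expn_gt0.
have n0' : 0 < n%:R :> R by rewrite ltr0n.
have n1 : 1 <= n%:R :> R by rewrite ler1n.
rewrite /core; move: (depth n) S1 Jn Hb => J S1 Jn Hb.
pose k w : R := (cut_level R n < `|fluct c w|)%R%:R.
have lk : avg n (lev J k) <= expR (- ((M + 1) * b n)).
  apply: (@le_trans _ _ (n%:R ^- 3 *+ 2 ^ J)).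
    by apply: (avg_lev_le card_step_gt0) => m bm; have [] := Hb m bm.
  apply: (@le_trans _ _ (n%:R^-1)).
    apply: (@le_trans _ _ (n%:R ^- 3 *+ n)); first by apply: ler_wpMn2l => //; rewrite invr_ge0 exprn_ge0.
    rewrite -[leLHS]mulr_natr (_ : _ * _ = n%:R^-1 * n%:R^-1); last by field; rewrite gt_eqF.
    by rewrite ler_piMl ?invr_ge0 ?ler0n // invf_le1.
  have nE : expR (ell n) = n%:R by rewrite /lnn lnK // posrE.
  rewrite -nE -expRN ler_expR lerN2; apply: le_trans bM _.
  have l0 : 0 <= ell n by apply: le_trans l1.
  by rewrite -[leRHS]ger0_norm // -sqrtr_sqr ler_wsqrtr // expr2 ler_peMr.
apply: (@le_trans _ _ (expR (- ((M + 1) * b n)) + expR (- ((M + 1) * b n)))).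
  apply: le_trans (lerD S1 lk); rewrite -avgD; apply: avg_le => w _.
  have k0 u : 0 <= k u by rewrite /k.
  have lk0 : 0 <= lev J k w by exact: lev_ge0.
  have gk u : fluct c u = cut c (cut_level R n) u \/ 1 <= k u.
    by rewrite /cut /k; case: (lerP (`|fluct c u|) (cut_level R n)) => _; [left|right].
  have [E|k1] := lev_change J w k0 gk; last first.
    by apply: (@le_trans _ _ 1); [rewrite lern1; case: (_ < _)|rewrite -[leLHS]add0r lerD].
  rewrite -[leLHS]addr0; apply: lerD => //.
  by rewrite (fluct_levels c J w) E addrAC subrr add0r normrN.
rewrite -mulr2n -[leLHS]mulr_natl; apply: (@le_trans _ _ (expR 1 * expR (- ((M + 1) * b n)))).
  by apply: ler_wpM2r; [exact: expR_ge0|exact: le_trans (expR_ge1Dx 1)].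
by rewrite -expRD ler_expR mulrDl mul1r opprD addrCA gerDl subr_le0.
Unshelve. all: by end_near.
Qed.

Variable s : R.
Hypothesis hs : s = 1 \/ s = -1.

Let norm_s (x : R) : `|s * x| = `|x|.
Proof. by case: hs => ->; rewrite ?mul1r // mulN1r normrN. Qed.

Let W n w := s * (lam n * core n w).

Let W_mgf theta eta : 0 < eta -> \forall n \near \oo,
  expR (b n * (theta ^+ 2 * sigma2 / 2 - eta))
    <= avg n (fun w => expR (theta * W n w))
    <= expR (b n * (theta ^+ 2 * sigma2 / 2 + eta)).
Proof.
move=> eta0.
have := mgf_limit (theta * s) eta0.
have -> : (theta * s) ^+ 2 = theta ^+ 2 by case: hs => ->; rewrite ?mulr1 // mulrN1 sqrrN.
apply: filterS => n.
rewrite (@avg_ext _ _ _ _ (fun w => expR (theta * W n w))) // => w _.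
by rewrite /W -mulrA.
Qed.

Let W_iff x n w : 1 <= ell n -> (0 < n)%N -> (x * b n <= W n w) = (x * dev n <= s * core n w).
Proof.
move=> l1 n0; have l0 : 0 < ell n by apply: lt_le_trans l1.
have n0' : 0 < n%:R :> R by rewrite ltr0n.
have lam0 : 0 < lam n by rewrite sqrtr_gt0 divr_gt0 // mulr_gt0.
have lamD : lam n * dev n = b n.
  rewrite /lam -sqrtrM ?divr_ge0 ?mulr_ge0 ?(ltW l0) ?(ltW (b_gt0 n)) //.
  rewrite [X in Num.sqrt X](_ : _ = b n ^+ 2) ?sqrtr_sqr ?ger0_norm ?(ltW (b_gt0 n)) //.
  by field; rewrite !gt_eqF.
have -> : x * b n = lam n * (x * dev n) by rewrite mulrCA lamD.
by rewrite /W [s * _]mulrCA ler_pM2l.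
Qed.

(** Exponential equivalence: off an event of probability [expR (- (I + eta) b)], the bounds for
    [core] at [x + e] and [x - e] carry over to [fluct] at [x]. *)
Lemma mdp_word (x eta : R) : 0 < x -> 0 < eta -> \forall n \near \oo,
  expR (- (b n * (x ^+ 2 / (2 * sigma2) + eta)))
    <= avg n (fun w => (x * dev n <= s * fluct c w)%R%:R)
    <= expR (- (b n * (x ^+ 2 / (2 * sigma2) - eta))).
Proof.
move=> x0 eta0; pose I := x ^+ 2 / (2 * sigma2).
have D0 : 0 < 3 * (2 * x + 1) by lra.
have s20 : 0 < 2 * sigma2 by rewrite mulr_gt0.
(* [e] moves the rate by at most [eta / 3]; another third is the error of the bounds for [core], and
   the last absorbs a factor 2. *)
pose e : R := Num.min (Num.min 1 (x / 2)) (2 * sigma2 * eta / (3 * (2 * x + 1))).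
have e0 : 0 < e by rewrite /e !lt_min ltr01 !divr_gt0 // mulr_gt0.
have e1 : e <= 1 by rewrite !ge_min lexx.
have ex : e <= x / 2 by rewrite !ge_min lexx orbT.
have ee : e * (3 * (2 * x + 1)) <= 2 * sigma2 * eta.
  by rewrite -ler_pdivlMr // ge_min lexx orbT.
have I_up : (x + e) ^+ 2 / (2 * sigma2) <= I + eta / 3.
  rewrite ler_pdivrMr // mulrDl /I divfK ?gt_eqF // !expr2.
  have : e * e <= 1 * e by apply: ler_wpM2r; [exact: ltW|].
  by move: ee; lra.
have I_lo : I - eta / 3 <= (x - e) ^+ 2 / (2 * sigma2).
  rewrite ler_pdivlMr // mulrBl /I divfK ?gt_eqF // !expr2.
  have : 0 <= e * e by rewrite mulr_ge0 // ltW.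
  by move: ee; lra.
have eta30 : 0 < eta / 3 by rewrite divr_gt0.
have xe0 : 0 < x - e by lra.
have xe1 : 0 < x + e by lra.
have hU := ldp_upper sigma2_gt0 W_mgf xe0 eta30.
have hL := ldp_lower b_oo b_gt0 sigma2_gt0 W_mgf xe1 eta30.
have hC := core_close (I + eta) e0.
move: hU hL hC; apply: filter_app3; near=> n => U L C.
have l1 : 1 <= ell n by near: n; exact: near_ell_ge.
have n0 : (0 < n)%N by near: n; exact: nbhs_infty_gt.
have be : 3 / eta <= b n by near: n; exact: near_b_ge.
have two (X : R) : 0 <= X -> 2 * X <= expR (b n * (eta / 3)) * X.
  move=> X0; apply: ler_wpM2r => //; apply: le_trans (expR_ge1Dx _).
  by move: be; rewrite ler_pdivrMr //; lra.
have bn0 := ltW (b_gt0 n).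
have close w : `|fluct c w - core n w| <= e * dev n ->
   s * core n w - e * dev n <= s * fluct c w <= s * core n w + e * dev n.
  by rewrite -norm_s mulrBr ler_norml => /andP [h1 h2]; apply/andP; split; lra.
apply/andP; split.
  apply: (@le_trans _ _ (expR (- (b n * ((x + e) ^+ 2 / (2 * sigma2) + eta / 3)))
                          - expR (- ((I + eta) * b n)))).
    rewrite lerBrDr -/I [(I + eta) * _]mulrC -mulr2n -[leLHS]mulr_natl.
    apply: le_trans (two _ (expR_ge0 _)) _; rewrite -expRD ler_expR.
    by have := ler_wpM2l bn0 I_up; lra.
  apply: (le_trans (lerB L C)); rewrite -avgB; apply: avg_le => w _; rewrite W_iff //.
  case: (lerP ((x + e) * dev n) (s * core n w)) => h1; last first.
    by apply: (@le_trans _ _ 0); rewrite ?ler0n // sub0r oppr_le0 ler0n.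
  case: (ltrP (e * dev n) (`|fluct c w - core n w|)) => h2; first by rewrite subrr ler0n.
  have /andP [h3 _] := close w h2.
  by rewrite (_ : x * dev n <= s * fluct c w) ?subr0 //; move: h1; rewrite mulrDl; lra.
apply: (@le_trans _ _ (expR (- (b n * ((x - e) ^+ 2 / (2 * sigma2) - eta / 3))) + expR (- ((I + eta) * b n)))).
  apply: (le_trans _ (lerD U C)); rewrite -avgD; apply: avg_le => w _; rewrite W_iff //.
  case: (lerP (x * dev n) (s * fluct c w)) => h1; last by rewrite addr_ge0 ?ler0n.
  case: (ltrP (e * dev n) (`|fluct c w - core n w|)) => h2; first by rewrite lerDr ler0n.
  have /andP [_ h3] := close w h2.
  by rewrite (_ : (x - e) * dev n <= s * core n w) ?addr0 //; move: h1; rewrite mulrBl; lra.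
apply: (@le_trans _ _ (2 * expR (- (b n * (I - 2 * eta / 3))))).
  rewrite [leRHS]mulr_natl [leRHS]mulr2n; apply: lerD; rewrite ler_expR lerN2 ?[(I + eta) * _]mulrC; apply: ler_wpM2l => //.
    by move: I_lo; lra.
  by move: eta0; lra.
apply: le_trans (two _ (expR_ge0 _)) _; rewrite -expRD ler_expR -/I; lra.
Unshelve. all: by end_near.
Qed.

End Limit.

(** * Law of the walk *)

Lemma avg_tuple (R : realFieldType) (A : finType) n (f : seq A -> R) :
  avg n f = (#|A|%:R ^- n) * \sum_(w : n.-tuple A) f w.
Proof.
elim: n f => [|n IH] f /=.
  rewrite expr0 invr1 mul1r (big_pred1 [tuple]) // => w.
  by rewrite [w]tuple0; apply/esym/eqP.
rewrite (eq_bigr (fun a => #|A|%:R ^- n * \sum_(w : n.-tuple A) f (a :: w))) //.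
rewrite -mulr_sumr mulrA -exprVn -exprS exprVn; congr (_ * _).
rewrite pair_big /= (reindex (fun p : A * n.-tuple A => [tuple of p.1 :: p.2])) //=.
exists (fun w : n.+1.-tuple A => (thead w, [tuple of behead w])).
  by move=> [a w] _ /=; rewrite theadE; congr pair; apply/val_inj.
by move=> w _; rewrite -tuple_eta.
Qed.

Definition stations (w : seq step) : seq 'rV[int]_5 :=
  [seq pos (take i w) | i <- iota 0 (size w).+1].

Lemma dir_inj : injective dir.
Proof.
move=> [j a] [k e] /rowP H; have := H j; have := H k.
rewrite /dir !mxE !eqxx /=.
case: (eqVneq j k) => [<-|jk] /=; last first.
  by rewrite mulr0 mulr1; case: e {H} => /eqP.
by rewrite !mulr1; case: a e {H} => [] [] // /eqP.
Qed.

Section WalkLaw.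
Variables (R : realType) (d : measure_display) (T : measurableType d).
Variables (P : probability T R) (S : nat -> T -> 'rV[int]_5).
Hypothesis hS : simple_random_walk P 0 S.
Notation avg := (@avg R step).

Definition path n (om : T) := [seq S i om | i <- iota 0 n.+1].

Lemma nth_path n i om : (i <= n)%N -> nth 0 (path n om) i = S i om.
Proof. by move=> le_in; rewrite (nth_map 0%N) ?size_iota // nth_iota. Qed.

(** Paths take values in a countable type, so an arbitrary property of the path is a countable union
    of measurable events. *)
Lemma measurable_path n (Q : seq 'rV[int]_5 -> Prop) :
  measurable [set om | Q (path n om)].
Proof.
have meq k m t : measurable [set om | [seq S i om | i <- iota m k] = t].
  elim: k m t => [|k IH] m [|x t] /=.
  - by rewrite (_ : [set _ | _] = setT) //; apply/seteqP; split.
  - by rewrite (_ : [set _ | _] = set0) //; apply/seteqP; split.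
  - by rewrite (_ : [set _ | _] = set0) //; apply/seteqP; split.
  rewrite (_ : [set _ | _] = S m @^-1` [set x] `&` [set om | [seq S i om | i <- iota m.+1 k] = t]).
    by apply: measurableI; [exact: srw_measurable hS _ _|exact: IH].
  by apply/seteqP; split => om /= [-> ->].
rewrite (_ : [set _ | _] = \bigcup_t ([set om | path n om = t] `&` [set om | Q t])).
  apply: countable_bigcupT_measurable => [|t]; first exact: countableP.
  apply: measurableI; first exact: meq.
  have [Qt|nQt] := pselect (Q t).
    by rewrite (_ : [set _ | _] = setT) //; apply/seteqP; split.
  by rewrite (_ : [set _ | _] = set0) //; apply/seteqP; split.
apply/seteqP; split => [om Qo|om [t _ [/= <-]]] //.
by exists (path n om).
Qed.

Lemma measurable_increment i (B : set 'rV[int]_5) : measurable (increment S i @^-1` B).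
Proof.
rewrite (_ : _ @^-1` _ = [set om | B (nth 0 (path i.+1 om) i.+1 - nth 0 (path i.+1 om) i)]).
  exact: (measurable_path i.+1 (fun t => B (nth 0 t i.+1 - nth 0 t i))).
by apply/seteqP; split => om; rewrite /preimage /mkset !nth_path ?leqnSn.
Qed.

Let s0 : step := (ord0, false).

Definition cylinder (w : seq step) : set T := S 0%N @^-1` [set 0] `&`
  \bigcap_(i in [set i | (i < size w)%N])
     (increment S i @^-1` [set dir (nth s0 w i)]).

Lemma cylinderP w om : cylinder w om <-> path (size w) om = stations w.
Proof.
have E : path (size w) om = stations w <-> forall i, (i <= size w)%N -> S i om = pos (take i w).
  split=> [E i iw|E].
    rewrite -(nth_path om iw) E (nth_map 0%N) ?size_iota // nth_iota //.
  by apply/eq_in_map => i; rewrite mem_iota add0n ltnS => /andP [_ iw]; exact: E.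
rewrite E; split => [[/= S0 H] i|H]; last split => /=.
- elim: i => [|i IH] iw; first by rewrite S0 take0 pos_nil.
  have := H i iw; rewrite /= /increment => /eqP; rewrite subr_eq => /eqP ->.
  rewrite IH; last exact: ltnW.
  by rewrite (take_nth s0 iw) -cats1 pos_cat pos_cons pos_nil addr0 addrC.
- by rewrite H // take0 pos_nil.
move=> i /= iw.
rewrite /increment (H _ iw) (H _ (ltnW iw)) (take_nth s0 iw) -cats1 pos_cat pos_cons pos_nil.
by rewrite addr0 addrC addKr.
Qed.

Lemma measurable_cylinder w : measurable (cylinder w).
Proof.
rewrite (_ : cylinder w = [set om | path (size w) om = stations w]).
  exact: (measurable_path _ (fun t => t = stations w)).
by apply/seteqP; split => om /cylinderP.
Qed.

Lemma cylinder_inj w w' om : size w = size w' -> cylinder w om -> cylinder w' om -> w = w'.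
Proof.
move=> sw [_ H] [_ H']; apply: (@eq_from_nth _ s0) => // i iw.
have /= e1 := H i iw; rewrite sw in iw; have /= e2 := H' i iw.
by apply: dir_inj; rewrite -e1 -e2.
Qed.

(** Independence is assumed among increments only; the start event has probability one, so
    intersecting with it preserves the measure. *)
Lemma P_cylinder w : P (cylinder w) = (10%:R ^- size w)%:E.
Proof.
rewrite /cylinder (_ : [set i | (i < size w)%N] = [set` seq_fset tt (iota 0 (size w))]); last first.
  apply/funext => i; apply/propext.
  by rewrite -[X in _ <-> X]/(is_true (i \in seq_fset tt _)) seq_fsetE mem_iota.
set B := bigcap _ _.
have mA : measurable (S 0%N @^-1` [set 0]) by exact: srw_measurable hS _ _.
have mB : measurable B.
  by apply: fin_bigcap_measurable => [|i _]; [exact: finite_fset|exact: measurable_increment].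
have <- : P B = P (S 0%N @^-1` [set 0] `&` B).
  rewrite (measureDI P mB mA) [B `&` _]setIC -[RHS]add0e; congr (_ + _)%E.
  apply/eqP; rewrite -measure_le0; apply: (@le_trans _ _ (P (~` (S 0%N @^-1` [set 0])))).
    by apply: le_measure; rewrite ?inE; [exact: measurableD|exact: measurableC|move=> om []].
  by rewrite probability_setC // (srw_start hS) subee.
rewrite /B (srw_indep hS).
rewrite (eq_bigr (fun=> (10%:R^-1 : R)%:E)) => [|i _]; last by rewrite (srw_step hS).
rewrite prodEFin (perm_big (iota 0 (size w))); last first.
  by apply: uniq_perm; rewrite ?fset_uniq ?iota_uniq //; move=> i; rewrite seq_fsetE.
by rewrite big_const_seq count_predT size_iota iter_mulr_1 exprVn.
Qed.

Lemma sum_cylinder n (w : n.-tuple step) (F : seq step -> R) om : cylinder w om ->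
  \sum_(u : n.-tuple step) F u * \1_(cylinder u) om = F w.
Proof.
move=> wo; rewrite (bigD1 w) //= big1 ?addr0 => [|u uw].
  by rewrite indicE mem_set // mulr1.
rewrite indicE memNset ?mulr0 // => uo; case/eqP: uw; apply/val_inj.
by apply: cylinder_inj uo wo; rewrite !size_tuple.
Qed.

Lemma integrable_cylinder n (w : n.-tuple step) (F : seq step -> R) :
  P.-integrable setT (fun om => (F w)%:E * (\1_(cylinder w) om)%:E)%E.
Proof.
apply: integrableZl => //; apply: integrable_indic; exact: measurable_cylinder.
Qed.

Lemma integral_cylinders n (F : seq step -> R) :
  (\int[P]_om (\sum_(w : n.-tuple step) (F w)%:E * (\1_(cylinder w) om)%:E) = (avg n F)%:E)%E.
Proof.
rewrite integral_sum //; last by move=> w; exact: integrable_cylinder.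
rewrite (eq_bigr (fun w : n.-tuple step => (10%:R ^- n * F w)%:E)) => [|w _]; last first.
  rewrite integralZl //; last by apply: integrable_indic; exact: measurable_cylinder.
  rewrite integral_indic //; last exact: measurable_cylinder.
  rewrite setIT mulrC EFinM; congr (_ * _)%E.
  by rewrite -[X in (_ ^- X)%:E](size_tuple w); exact: P_cylinder.
by rewrite sumEFin -mulr_sumr avg_tuple card_step.
Qed.

(** The [10^n] cylinders are disjoint and have mass [10^-n] each, so they exhaust the total mass. *)
Lemma ae_cylinder n : \forall om \ae P, exists w : n.-tuple step, cylinder w om.
Proof.
pose U := [set om | exists w : n.-tuple step, cylinder w om].
have mU : measurable U.
  rewrite (_ : U = \bigcup_(w : n.-tuple step) cylinder w).
    by apply: countable_bigcupT_measurable => [|w]; [exact: countableP|exact: measurable_cylinder].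
  by apply/seteqP; split => [om [w wo]|om [w _ wo]]; exists w.
exists (~` U); split => //; first exact: measurableC.
rewrite probability_setC //.
have -> : P U = (\int[P]_om (\sum_(w : n.-tuple step) 1%:E * (\1_(cylinder w) om)%:E))%E.
  transitivity (\int[P]_om (\1_U om)%:E)%E; first by rewrite integral_indic // setIT.
  apply: eq_integral => om _.
  under eq_bigr do rewrite -EFinM; rewrite sumEFin; congr (_%:E).
  case: (pselect (U om)) => [|nU].
    by move=> Uo; have [w wo] := Uo; rewrite (sum_cylinder (fun=> 1) wo) indicE mem_set.
  rewrite indicE memNset // big1 // => w _; rewrite indicE memNset ?mulr0 //.
  by move=> wo; apply: nU; exists w.
by rewrite (integral_cylinders n (fun=> 1)) avg_const ?card_step // subee.
Qed.

(** Almost surely the path is one of finitely many, so no integrability condition on [F] appears. *)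
Lemma expectation_path n (F : seq 'rV[int]_5 -> R) :
  ('E_P[fun om => F (path n om)] = (avg n (F \o stations))%:E)%E.
Proof.
rewrite unlock -integral_cylinders; apply: ae_eq_integral => //.
- apply/measurable_EFinP => _ B mB; rewrite setTI.
  exact: (measurable_path n (fun t => B (F t))).
- apply: measurable_int; apply: integrable_sum => // w _.
  exact: (integrable_cylinder w (F \o stations)).
apply: filterS (ae_cylinder n) => om [w wo] _ /=.
under eq_bigr do rewrite -EFinM; rewrite sumEFin.
rewrite (sum_cylinder (F \o stations) wo) /=.
by have /cylinderP := wo; rewrite size_tuple => ->.
Qed.

Lemma P_path n (Q : pred (seq 'rV[int]_5)) :
  (P [set om | Q (path n om)] = (avg n (fun w => (Q (stations w))%:R))%:E)%E.
Proof.
have mQ := measurable_path n Q.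
rewrite -(expectation_indic _ mQ) -(expectation_path n (fun t => (Q t)%:R)).
congr ('E_P[_])%E; apply/funext => om; rewrite indicE; congr (_%:R); congr nat_of_bool.
by apply/idP/idP => [/set_mem|h] //; exact: mem_set.
Qed.

Lemma P_walk n z : P [set om | S n om = z] = (heat R n z)%:E.
Proof.
rewrite (_ : [set _ | _] = [set om | nth 0 (path n om) n == z]).
  rewrite (P_path n (fun t => nth 0 t n == z)); congr (_%:E); apply: avg_ext => w sw.
  by rewrite /stations (nth_map 0%N) ?size_iota ?sw // nth_iota // -sw take_size.
by apply/seteqP; split => om /=; rewrite nth_path // => /eqP.
Qed.

End WalkLaw.

(** * The capacity of the range as a function of words *)

Lemma ler_sum_subset (R : numDomainType) (I : eqType) (r s : seq I) (F : I -> R) :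
  uniq r -> {subset r <= s} -> (forall i, 0 <= F i) ->
  \sum_(i <- r) F i <= \sum_(i <- s) F i.
Proof.
elim: r s => [|x r IH] s; first by move=> _ _ F0; rewrite big_nil sumr_ge0.
move=> /= /andP [xr ur] rs F0.
have xs : x \in s by apply: rs; rewrite inE eqxx.
rewrite big_cons (perm_big _ (perm_to_rem xs)) big_cons lerD2l.
apply: IH => // y yr; apply: rem_mem; last by apply: rs; rewrite inE yr orbT.
by apply: contraNneq xr => <-.
Qed.

Lemma ratio_le1 (R : realFieldType) (k N m X r : R) : k * N <= m ->
  2 * m <= X -> 1 <= r -> 0 < X -> N * (2 * (k / (X * r))) <= 1.
Proof.
move=> kN mX r1 X0; have r0 : 0 < r by apply: lt_le_trans r1.
rewrite (_ : N * _ = 2 * (k * N) / (X * r)); last by field; rewrite !gt_eqF.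
rewrite ler_pdivrMr ?mulr_gt0 // mul1r; apply: (@le_trans _ _ X); first by lra.
by rewrite ler_peMr // ltW.
Qed.

Lemma mem_stations w z : z \in stations w -> exists2 i, (i <= size w)%N & z = pos (take i w).
Proof. by move=> /mapP [i]; rewrite mem_iota add0n ltnS => iw ->; exists i. Qed.

Lemma stations_mem w i : (i <= size w)%N -> pos (take i w) \in stations w.
Proof. by move=> iw; apply/mapP; exists i => //; rewrite mem_iota add0n ltnS. Qed.

Lemma mem_stations_cat u v z :
  (z \in stations (u ++ v)) = (z \in stations u) || (z \in [seq pos u + y | y <- stations v]).
Proof.
apply/idP/orP => [/mem_stations [i]|[/mem_stations [i iu ->]|/mapP [y /mem_stations [i iv ->] ->]]].
- rewrite size_cat => iuv ->; rewrite take_cat; case: (ltnP i (size u)) => iu.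
    by left; apply: stations_mem; exact: ltnW.
  right; rewrite pos_cat; apply: map_f; apply: stations_mem.
  by rewrite leq_subLR.
- rewrite -(takel_cat v iu); apply: stations_mem.
  by rewrite size_cat (leq_trans iu) ?leq_addr.
- rewrite -pos_cat (_ : u ++ take i v = take (size u + i) (u ++ v)).
    by apply: stations_mem; rewrite size_cat leq_add2l.
  by rewrite take_cat ltnNge leq_addr /= addnC addnK.
Qed.

Lemma sum_stations (R : nmodType) w (F : 'rV[int]_5 -> R) :
  \sum_(x <- stations w) F x = \sum_(i < (size w).+1) F (pos (take i w)).
Proof. by rewrite /stations big_map -[X in iota 0 X]subn0 -/(index_iota _ _) big_mkord. Qed.

Section CapacityBounds.
Variables (R : realType) (d : measure_display) (T : measurableType d).
Variables (P : probability T R) (S : nat -> T -> 'rV[int]_5).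
Hypothesis hS : simple_random_walk P 0 S.
Notation heat := (@heat R).
Notation green := (@green R).
Implicit Types (A B : {fset 'rV[int]_5}) (x y z : 'rV[int]_5).

Definition Pr (X : set T) : R := fine (P X).

Lemma PrE X : measurable X -> P X = (Pr X)%:E.
Proof. by move=> mX; rewrite fineK // fin_num_measure. Qed.

Lemma Pr_ge0 X : 0 <= Pr X.
Proof. by rewrite fine_ge0 // measure_ge0. Qed.

Lemma Pr_le1 X : measurable X -> Pr X <= 1.
Proof. by move=> mX; rewrite -lee_fin -PrE // probability_le1. Qed.

Lemma Pr_le X Y : measurable X -> measurable Y -> X `<=` Y -> Pr X <= Pr Y.
Proof. by move=> mX mY XY; rewrite -lee_fin -!PrE //; apply: le_measure; rewrite ?inE. Qed.

Lemma Pr_le_sum (I : eqType) (r : seq I) (X Y : set T) (F : I -> set T) :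
  measurable X -> measurable Y -> (forall i, measurable (F i)) ->
  (forall om, X om -> Y om \/ exists2 i, i \in r & F i om) ->
  Pr X <= Pr Y + \sum_(i <- r) Pr (F i).
Proof.
move=> + + mF; elim: r X Y => [|i r IH] X Y mX mY XY.
  by rewrite big_nil addr0; apply: Pr_le => // om /XY [//|[]].
rewrite big_cons addrA; apply: (le_trans (IH X (Y `|` F i) mX _ _)); first exact: measurableU.
  move=> om /XY [|[j]]; first by left; left.
  by rewrite inE => /orP [/eqP ->|jr] Fj; [left; right|right; exists j].
rewrite lerD2r -lee_fin EFinD -!PrE //; last exact: measurableU.
exact: measureU2.
Qed.

(** The shift [i.+1] reflects that only positive times count in the hitting time. *)
Definition avoid A x : set T := [set om | forall i, x + S i.+1 om \notin A].
Definition meet x y : set T := [set om | exists i, x + S i.+1 om = y].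
Definition escape x A : R := Pr (avoid A x).

Lemma measurable_walk i (Q : 'rV[int]_5 -> Prop) : measurable [set om | Q (S i om)].
Proof. exact: (srw_measurable hS i (mkset Q)). Qed.

Lemma measurable_avoid A x : measurable (avoid A x).
Proof.
rewrite (_ : avoid A x = \bigcap_i [set om | x + S i.+1 om \notin A]).
  by apply: bigcapT_measurable => i; exact: (measurable_walk i.+1 (fun z => x + z \notin A)).
by apply/seteqP; split => [om H i _|om H i]; [exact: H|exact: (H i I)].
Qed.

Lemma measurable_meet x y : measurable (meet x y).
Proof.
rewrite (_ : meet x y = \bigcup_i [set om | x + S i.+1 om = y]).
  by apply: bigcupT_measurable => i; exact: (measurable_walk i.+1 (fun z => x + z = y)).
by apply/seteqP; split => [om [i H]|om [i _ H]]; exists i.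
Qed.

Lemma capacityE A : capacity P S A = \sum_(x <- A) escape x A.
Proof.
apply: eq_bigr => x _; rewrite /escape /Pr; congr (fine (P _)).
apply/seteqP; split => om /=; rewrite /hitting_time ereal_inf_pinfty => H.
  move=> i; apply/negP => iA; have /= : ((i.+1)%:R%:E : \bar R) = +oo%E by apply: H; exists i.+1.
  by [].
by move=> _ [[|i] [/= i0 iA] <-] //; case/negP: (H i).
Qed.

Lemma escape_ge0 x A : 0 <= escape x A.
Proof. exact: Pr_ge0. Qed.

Lemma escape_le1 x A : escape x A <= 1.
Proof. exact/Pr_le1/measurable_avoid. Qed.

Lemma escape_mono x A B : {subset A <= B} -> escape x B <= escape x A.
Proof.
move=> AB; apply: Pr_le; [exact: measurable_avoid|exact: measurable_avoid|].
by move=> om H i; apply: contra (H i); exact: AB.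
Qed.

Lemma capacity_ge0 A : 0 <= capacity P S A.
Proof. by rewrite capacityE sumr_ge0 // => x _; exact: escape_ge0. Qed.

Lemma capacity_le A : capacity P S A <= (size A)%:R.
Proof.
rewrite capacityE; apply: (@le_trans _ _ (\sum_(x <- A) 1)); last first.
  by rewrite big_const_seq count_predT iter_addr_0.
by apply: ler_sum => x _; exact: escape_le1.
Qed.

Lemma sum_fsetU A B (F : 'rV[int]_5 -> R) :
  \sum_(x <- (A `|` B)%fset) F x =
  \sum_(x <- A) F x + \sum_(x <- B) F x - \sum_(x <- B | x \in A) F x.
Proof.
rewrite (perm_big (A ++ [seq x <- B | x \notin A])) /=; last first.
  apply: uniq_perm; first exact: fset_uniq.
    rewrite cat_uniq fset_uniq filter_uniq ?fset_uniq // andbT /=.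
    by apply/hasPn => x; rewrite mem_filter => /andP [].
  by move=> x; rewrite mem_cat mem_filter in_fsetU; case: (x \in A).
rewrite big_cat /= big_filter [\sum_(x <- B) F x](bigID (mem A)) /=; ring.
Qed.

Lemma capacityU_le A B : capacity P S (A `|` B)%fset <= capacity P S A + capacity P S B.
Proof.
rewrite !capacityE sum_fsetU.
have : \sum_(x <- A) escape x (A `|` B)%fset <= \sum_(x <- A) escape x A.
  by apply: ler_sum => x _; apply: escape_mono => y yA; rewrite in_fsetU yA.
have : \sum_(x <- B) escape x (A `|` B)%fset <= \sum_(x <- B) escape x B.
  by apply: ler_sum => x _; apply: escape_mono => y yA; rewrite in_fsetU yA orbT.
have : 0 <= \sum_(x <- B | x \in A) escape x (A `|` B)%fset.
  by rewrite sumr_ge0 // => x _; exact: escape_ge0.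
lra.
Qed.

Lemma escape_sub x A B : escape x A - escape x (A `|` B)%fset <= \sum_(y <- B) Pr (meet x y).
Proof.
rewrite lerBlDl; apply: Pr_le_sum; [exact: measurable_avoid|exact: measurable_avoid| |].
  by move=> y; exact: measurable_meet.
move=> om H; case: (pselect (avoid (A `|` B)%fset x om)) => [?|nH]; [by left|right].
have [i Hi] : exists i, x + S i.+1 om \in (A `|` B)%fset.
  by apply: contrapT => nE; apply: nH => i; apply/negP => Hi; apply: nE; exists i.
exists (x + S i.+1 om); last by exists i.
by move: Hi; rewrite in_fsetU (negbTE (H i)).
Qed.

(** A starting point in one set loses escape probability only if its walk meets the other set, and a
    common point is counted twice with escape probability at most 1. *)
Lemma capacity_cross A B :
  capacity P S A + capacity P S B - capacity P S (A `|` B)%fset <=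
  \sum_(x <- A) \sum_(y <- B) (Pr (meet x y) + Pr (meet y x) + (x == y)%:R).
Proof.
rewrite !capacityE sum_fsetU; set U := (A `|` B)%fset.
have h1 : \sum_(x <- A) escape x A - \sum_(x <- A) escape x U
    <= \sum_(x <- A) \sum_(y <- B) Pr (meet x y).
  by rewrite -sumrB; apply: ler_sum => x _; exact: escape_sub.
have h2 : \sum_(x <- B) escape x B - \sum_(x <- B) escape x U
    <= \sum_(x <- A) \sum_(y <- B) Pr (meet y x).
  rewrite [leRHS]exchange_big -sumrB; apply: ler_sum => x _.
  by rewrite /U fsetUC; exact: escape_sub.
have h3 : \sum_(x <- B | x \in A) escape x U <= \sum_(x <- A) \sum_(y <- B) (x == y)%:R.
  rewrite [leRHS]exchange_big big_mkcond /=; apply: ler_sum => x _.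
  have -> : \sum_(z <- A) (z == x)%:R = (x \in A)%:R :> R.
    rewrite -(count_uniq_mem x (fset_uniq A)) -sum1_count natr_sum [RHS]big_mkcond /=.
    by apply: eq_bigr => z _; case: eqP.
  by case: (x \in A) => //; exact: escape_le1.
have -> : \sum_(x <- A) \sum_(y <- B) (Pr (meet x y) + Pr (meet y x) + (x == y)%:R) =
  \sum_(x <- A) \sum_(y <- B) Pr (meet x y) + \sum_(x <- A) \sum_(y <- B) Pr (meet y x)
  + \sum_(x <- A) \sum_(y <- B) (x == y)%:R.
  rewrite -!big_split /=; apply: eq_bigr => x _.
  by rewrite -!big_split.
lra.
Qed.

(** The bound of [sum_kbound] for the times from [2 M] on. *)
Definition green_tail (M : nat) : R := 112 / (M.*2.+1%:R * Num.sqrt M.*2.+1%:R).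

(** A union bound over the positive visiting times; the indicator is the term of time zero in the
    Green function. *)
Lemma meet_green M x y : Pr (meet x y) + (x == y)%:R <= green M (y - x) + green_tail M.
Proof.
set B := _ + green_tail M.
have part N : \sum_(i < N) heat i (y - x) <= B.
  apply: (@le_trans _ _ (\sum_(i < M.*2 + N) heat i (y - x))).
    rewrite [leRHS](eq_bigl xpredT) // addnC big_split_ord /= lerDl.
    by rewrite sumr_ge0 // => i _; exact: heat_ge0.
  rewrite big_split_ord /= lerD2l; apply: le_trans (sum_kbound R N M.*2).
  by apply: ler_sum => i _; rewrite addnC; exact: heat_le.
rewrite -lerBrDr -lee_fin -PrE; last exact: measurable_meet.
pose F i := [set om | x + S i.+1 om = y].
have mF i : measurable (F i) by exact: (measurable_walk i.+1 (fun z => x + z = y)).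
have PF i : P (F i) = (heat i.+1 (y - x))%:E.
  rewrite -(P_walk hS); congr (P _); apply/seteqP; split => om /=.
    by move=> <-; rewrite addrC addKr.
  by move=> E; rewrite /F /= E addrC subrK.
have FS : meet x y `<=` \bigcup_i F i by move=> om [i H]; exists i.
have H := @measure_sigma_subadditive _ _ _ P (meet x y) F mF (measurable_meet x y) FS.
apply: (le_trans H).
apply: lime_le; first by apply: is_cvg_nneseries => i _ _; exact: measure_ge0.
near=> N; rewrite (eq_bigr (fun i => (heat i.+1 (y - x))%:E)) => [|i _]; last exact: PF.
rewrite sumEFin lee_fin.
have := part N.+1; rewrite big_ord_recl heat0 /= subr_eq0 [y == x]eq_sym.
by rewrite big_mkord lerBrDr addrC.
Unshelve. all: by end_near.
Qed.

Definition word_range w : {fset 'rV[int]_5} := seq_fset tt (stations w).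
Definition word_cap w : R := capacity P S (word_range w).

Lemma word_cap_ge0 w : 0 <= word_cap w.
Proof. exact: capacity_ge0. Qed.

Lemma word_cap_le w : word_cap w <= (size w).+1%:R.
Proof.
apply: le_trans (capacity_le _) _; rewrite ler_nat size_seq_fset.
by apply: leq_trans (size_undup _) _; rewrite size_map size_iota.
Qed.

Lemma capacity_shift z A B : (B =i [seq z + a | a <- A]) -> capacity P S B = capacity P S A.
Proof.
move=> BA; rewrite !capacityE (perm_big [seq z + a | a <- A]); last first.
  by apply: uniq_perm; rewrite ?fset_uniq // map_inj_uniq ?fset_uniq //; exact: addrI.
rewrite big_map; apply: eq_bigr => a _; rewrite /escape; congr Pr.
apply/seteqP; split => om H i; apply: contra (H i).
  by move=> ?; rewrite -addrA BA map_f.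
by rewrite -addrA BA mem_map //; exact: addrI.
Qed.

Lemma word_range_cat u v : exists B,
  [/\ word_range (u ++ v) = (word_range u `|` B)%fset, word_cap v = capacity P S B
    & B =i [seq pos u + y | y <- stations v]].
Proof.
exists (seq_fset tt [seq pos u + y | y <- stations v]).
have E : seq_fset tt [seq pos u + y | y <- stations v] =i [seq pos u + y | y <- stations v].
  by move=> x; rewrite seq_fsetE.
split=> //.
  by apply/fsetP => x; rewrite in_fsetU !seq_fsetE mem_stations_cat.
apply/esym/(@capacity_shift (pos u)) => x; rewrite E.
by apply: eq_mem_map => y; rewrite seq_fsetE.
Qed.

Lemma chi_word_cap_ge0 u v : 0 <= chi word_cap u v.
Proof.
have [B [E1 E2 _]] := word_range_cat u v.
by rewrite /chi /word_cap E1 -/(word_cap v) E2 subr_ge0 capacityU_le.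
Qed.

(** Each pair of points meets in two directions, whence the factor 2. The horizon depends on the
    lengths, so that the tails of all [(n1 + 1)(n2 + 1)] pairs add up to at most 1. *)
Lemma chi_word_cap_le n1 n2 : exists M, forall u v, size u = n1 -> size v = n2 ->
  chi word_cap u v <= 2 * (\sum_(i < n1.+1) \sum_(j < n2.+1)
     green M (pos (drop i u) + pos (take j v))) + 1.
Proof.
have [M HM] : exists M, (n1.+1 * n2.+1)%:R * (2 * green_tail M) <= 1.
  have [M HM] : exists M : nat, 112 * (n1.+1 * n2.+1)%:R <= M%:R :> R.
    exists (Num.truncn (112 * (n1.+1 * n2.+1)%:R : R)).+1.
    by rewrite ltW // truncnS_gt.
  exists M; apply: (ratio_le1 HM) => //; first by rewrite -natrM ler_nat leqW // -mul2n.
  by rewrite -[leLHS]sqrtr1 ler_wsqrtr // ler1n.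
exists M => u v su sv; have [B [E1 E2 EB]] := word_range_cat u v.
have tail0 : 0 <= green_tail M by rewrite divr_ge0 // mulr_ge0 // sqrtr_ge0.
have G0 x y : 0 <= 2 * green M (y - x) + 2 * green_tail M.
  by rewrite addr_ge0 // mulr_ge0 // green_ge0.
rewrite /chi /word_cap E1 -/(word_cap v) E2.
apply: (le_trans (capacity_cross _ _)).
apply: (@le_trans _ _ (\sum_(x <- word_range u) \sum_(y <- B) (2 * green M (y - x) + 2 * green_tail M))).
  apply: ler_sum => x _; apply: ler_sum => y _.
  have h1 := meet_green M x y; have h2 := meet_green M y x.
  rewrite -[x - y]opprB greenN [y == x]eq_sym in h2.
  have : 0 <= (x == y)%:R :> R by [].
  lra.
(* Passing from the distinct points of the ranges to all times adds only nonnegative terms. *)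
apply: (@le_trans _ _ (\sum_(x <- stations u) \sum_(y <- stations v)
          (2 * green M (pos u + y - x) + 2 * green_tail M))).
  apply: (@le_trans _ _ (\sum_(x <- word_range u) \sum_(y <- stations v)
          (2 * green M (pos u + y - x) + 2 * green_tail M))).
    apply: ler_sum => x _; rewrite -(big_map (fun y => pos u + y) xpredT
       (fun y => 2 * green M (y - x) + 2 * green_tail M)).
    by apply: ler_sum_subset => [||y //]; [exact: fset_uniq|move=> y; rewrite EB].
  apply: ler_sum_subset => [||x]; [exact: fset_uniq|by move=> x; rewrite seq_fsetE|].
  by rewrite sumr_ge0.
rewrite sum_stations su (eq_bigr (fun i : 'I_n1.+1 =>
   2 * (\sum_(j < n2.+1) green M (pos (drop i u) + pos (take j v))) + n2.+1%:R * (2 * green_tail M))).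
  rewrite big_split /= -mulr_sumr lerD2l sumr_const card_ord -[leLHS]mulr_natl mulrA -natrM.
  exact: HM.
move=> i _; rewrite sum_stations sv big_split /= -mulr_sumr sumr_const card_ord -[X in _ + X = _]mulr_natl.
congr (_ * _ + _); apply: eq_bigr => j _; congr green.
by rewrite -{1}(cat_take_drop i u) pos_cat addrAC; congr (_ + _); rewrite addrC addKr.
Qed.

End CapacityBounds.

(** * Transfer from words to the random walk *)

Section CapRange.
Variables (R : realType) (d : measure_display) (T : measurableType d).
Variables (P : probability T R) (S : nat -> T -> 'rV[int]_5).
Hypothesis hS : simple_random_walk P 0 S.
Notation c := (word_cap P S).
Notation avg := (@avg R step).
Notation G := (fun t : seq 'rV[int]_5 => capacity P S (seq_fset tt t)).

Lemma cap_range_path n : cap_range P S n = fun om => G (path S n om).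
Proof.
apply/funext => om; rewrite /cap_range; congr capacity; apply/fsetP => x.
rewrite seq_fsetE; apply/imfsetP/mapP => -[i /= ii ->]; by exists i.
Qed.

Lemma expectation_cap_range n : 'E_P[cap_range P S n]%E = (avg n c)%:E.
Proof. by rewrite cap_range_path (expectation_path hS n G). Qed.

Lemma variance_cap_range n : 'V_P[cap_range P S n]%E = (avg n (fun w => fluct c w ^+ 2))%:E.
Proof.
rewrite /variance unlock expectation_cap_range /= cap_range_path.
rewrite (expectation_path hS n (fun t => (G t - avg n c) * (G t - avg n c))).
by congr (_%:E); apply: avg_ext => w sw; rewrite /= -expr2 /fluct sw.
Qed.

Lemma P_cap_range n (x s : R) :
  P [set om | x <= s * (cap_range P S n om - fine 'E_P[cap_range P S n]%E)] =
  (avg n (fun w => (x <= s * fluct c w)%R%:R))%:E.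
Proof.
rewrite expectation_cap_range cap_range_path /=.
rewrite (P_path hS n (fun t => x <= s * (G t - avg n c))).
by congr (_%:E); apply: avg_ext => w sw; rewrite /fluct sw.
Qed.

End CapRange.

Theorem theorem1 (R : realType) (d : measure_display) (T : measurableType d)
    (P : probability T R) (S : nat -> T -> 'rV[int]_5)
    (hS : simple_random_walk P 0 S)
    (sigma2 : R) (hsigma2 : 0 < sigma2)
    (hvar : (fun n : nat =>
       ('V_P[cap_range P S n] * ((n%:R * ln (n%:R : R))^-1)%:E)%E)
         @ \oo --> sigma2%:E)
    (b : nat -> R) (hb : forall n : nat, 0 < b n)
    (hb_infty : b @ \oo --> +oo)
    (hb_small : (fun n : nat => b n / Num.sqrt (ln (n%:R : R))) @ \oo
       --> (0 : R))
    (lambda : R) (hlambda : 0 < lambda)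
    (s : R) (hs : s = 1 \/ s = -1) :
  (fun n : nat =>
     (((b n)^-1)%:E *
      lne (P [set w : T |
         (lambda * Num.sqrt (n%:R * b n * ln (n%:R : R))
         <= s * (cap_range P S n w - fine 'E_P[cap_range P S n]))%R]))%E)
    @ \oo --> (- (lambda ^+ 2 / (2 * sigma2)))%:E.
Proof.
pose c := word_cap P S.
have var_lim : (fun n => avg n (fun w => fluct c w ^+ 2) / (n%:R * lnn R n)) @ \oo --> sigma2.
  apply: cvg_trans (fine_cvg hvar); apply: near_eq_cvg; near=> n.
  by rewrite /= (variance_cap_range hS) -EFinM.
pose A n := avg n (fun w => (lambda * Num.sqrt (n%:R * b n * lnn R n) <= s * fluct c w)%R%:R) : R.
pose I := lambda ^+ 2 / (2 * sigma2).
have mdp eta : 0 < eta -> \forall n \near \oo,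
    expR (- (b n * (I + eta))) <= A n <= expR (- (b n * (I - eta))).
  exact: (mdp_word (word_cap_ge0 P S) (word_cap_le hS) (chi_word_cap_ge0 hS)
    (chi_word_cap_le hS) hb hb_infty hb_small hsigma2 var_lim hs hlambda).
have g_lim : (fun n => (b n)^-1 * ln (A n)) @ \oo --> - I.
  apply/cvgrPdist_le => eta eta0; have := mdp eta eta0; apply: filterS => n /andP [h1 h2].
  have A0 : 0 < A n by apply: lt_le_trans h1; exact: expR_gt0.
  have h3 : - (b n * (I + eta)) <= ln (A n) by rewrite -[leLHS]expRK ler_ln ?posrE ?expR_gt0.
  have h4 : ln (A n) <= - (b n * (I - eta)) by rewrite -[leRHS]expRK ler_ln ?posrE ?expR_gt0.
  have h5 : - (I + eta) <= (b n)^-1 * ln (A n) by rewrite ler_pdivlMl // mulrN.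
  have h6 : (b n)^-1 * ln (A n) <= - (I - eta) by rewrite ler_pdivrMl // mulrN.
  by rewrite ler_norml; apply/andP; split; lra.
(* [lne] is infinite at probability zero; the lower bound makes [A n] positive for large [n], so the
   limit can be taken in the reals. *)
have lneA : \forall n \near \oo, (((b n)^-1)%:E * lne (P [set w : T |
    (lambda * Num.sqrt (n%:R * b n * ln (n%:R : R))
      <= s * (cap_range P S n w - fine 'E_P[cap_range P S n]))%R]) =
    ((b n)^-1 * ln (A n))%:E)%E.
  have := mdp 1 ltr01; apply: filterS => n /andP [h _].
  have A0 : 0 < A n by apply: lt_le_trans h; exact: expR_gt0.
  by rewrite (P_cap_range hS) lne_EFin -?EFinM.
apply/fine_cvgP; split; first by apply: filterS lneA => n ->.
by apply: cvg_trans g_lim; apply: near_eq_cvg; apply: filterS lneA => n /= ->.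
Unshelve. all: by end_near.
Qed.
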